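(* Let $\underline{\lambda}^{(1)}, \underline{\lambda}^{(2)}, \ldots$ be a sequence of block diagonal skew partitions, and for each $N$ let $X_N$ be the random variable $\mathrm{maj}(T)$, where $T$ is chosen uniformly at random from the set $\mathrm{SYT}(\underline{\lambda}^{(N)})$ of standard Young tableaux of shape $\underline{\lambda}^{(N)}$. Then the sequence $(X_N^* )_{N\ge 1}$ of normalized random variables converges in distribution if and only if (i) $\mathrm{aft}(\underline{\lambda}^{(N)}) \to \infty$; or (ii) $|\underline{\lambda}^{(N)}| \to \infty$ and $\mathrm{aft}(\underline{\lambda}^{(N)}) \to M < \infty$ for some $M$; or (iii) the distribution of $X_N^*$ is eventually constant (as a function of $N$). The limit law is the standard normal distribution $\mathcal{N}(0,1)$ in case (i), the normalized Irwin--Hall distribution $\mathcal{IH}_M^*$ in case (ii), and discrete in case (iii).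
   Context: Diagrams are drawn in English notation (row 1 at the top). A block diagonal skew partition $\underline{\lambda}=(\lambda^{1},\ldots,\lambda^{m})$ is a finite sequence of partitions, identified with the skew shape obtained by translating the Young diagrams of $\lambda^1,\dots,\lambda^m$ so that the rows and columns occupied by different components are disjoint, they form a valid skew shape, and they appear in order from top to bottom (so $\lambda^1$ is topmost and rightmost). Its size is $|\underline{\lambda}|=\sum_i|\lambda^i|$, and $\mathrm{aft}(\underline{\lambda}) := |\underline{\lambda}| - \max_i\{\lambda^{i}_1, (\lambda^{i})'_1\}$, the maximum being over all row lengths $\lambda^i_1$ and column lengths $(\lambda^i)'_1$ (where $'$ denotes the conjugate partition). A standard Young tableau of a skew shape with $n$ cells is a bijective filling of its cells with $1,\ldots,n$ increasing to the right along rows and downward along columns. An integer $i\in\{1,\dots,n-1\}$ is a descent of $T$ if $i+1$ lies in a strictly lower row of $T$ than $i$; $\mathrm{maj}(T)$ is the sum of the descents of $T$. For a real random variable $X$ with mean $\mu$ and variance $\sigma^2>0$, the normalized variable is $X^* := (X-\mu)/\sigma$; if $\sigma=0$, by convention $X^*:=0$. The Irwin--Hall random variable $\mathcal{IH}_M$ is the sum of $M$ independent random variables uniformly distributed on $[0,1]$ ($\mathcal{IH}_0=0$), and $\mathcal{IH}_M^*$ is its normalization. Convergence in distribution means convergence of cumulative distribution functions at every continuity point of the limiting cumulative distribution function. *)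

(* Defs.v *)
From HB Require Import structures.
From mathcomp Require Import all_boot all_order all_algebra.
From mathcomp Require Import finmap.
From mathcomp Require Import all_classical all_reals all_analysis.
From mathcomp Require Import measurable_realfun.

Set Implicit Arguments.
Unset Strict Implicit.
Unset Printing Implicit Defensive.

Import Order.TTheory GRing.Theory Num.Theory.
Import numFieldNormedType.Exports.

Local Open Scope classical_set_scope.
Local Open Scope ring_scope.

Record intpart := IntPart {
  parts :> seq nat;
  _ : sorted geq parts && (0%N \notin parts) }.

Definition conj_part (p : seq nat) : seq nat :=
  mkseq (fun j => count (fun r => (j < r)%N) p) (head 0%N p).

(** A block diagonal skew partition is a sequence of partitions, listed from
    top (and rightmost) to bottom (and leftmost). *)
Definition block_skew := seq intpart.

Definition block_size (l : block_skew) : nat := (\sum_(p <- l) sumn p)%N.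

Definition aft (l : block_skew) : nat :=
  (block_size l
   - \max_(p <- l) maxn (head 0 p) (head 0 (conj_part p)))%N.

(** Cells are pairs (row, column), rows being numbered downwards and columns
    rightwards, both from 0. *)
Definition diagram (p : seq nat) : seq (nat * nat) :=
  [seq (r, c) | r <- iota 0 (size p), c <- iota 0 (nth 0%N p r)].

Definition shift_cell (dr dc : nat) (x : nat * nat) : nat * nat :=
  ((x.1 + dr)%N, (x.2 + dc)%N).

(** The first block is moved to the right of all the columns of the following
    blocks, which are themselves moved below all the rows of the first one. *)
Fixpoint skew_cells (l : block_skew) : seq (nat * nat) :=
  if l is p :: l' then
    map (shift_cell 0 (\sum_(q <- l') head 0%N q)) (diagram p)
    ++ map (shift_cell (size p) 0) (skew_cells l')
  else [::].

Lemma size_diagram p : size (diagram p) = sumn p.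
Proof.
rewrite /diagram size_allpairs_dep; congr sumn.
under eq_map do rewrite size_iota.
by rewrite -[RHS](mkseq_nth 0).
Qed.

Lemma size_skew_cells l : size (skew_cells l) = block_size l.
Proof.
rewrite /block_size; elim: l => [|p l IH] /=; first by rewrite big_nil.
by rewrite size_cat !size_map size_diagram IH big_cons.
Qed.

Lemma diagram_row p x : x \in diagram p -> (x.1 < size p)%N.
Proof. by move=> /allpairsPdep[r [c [+ _ ->]]] /=; rewrite mem_iota. Qed.

Lemma uniq_skew_cells l : uniq (skew_cells l).
Proof.
have inj dr dc : injective (shift_cell dr dc).
  by move=> [a b] [c d] [/addIn -> /addIn ->].
elim: l => [//|p l IH] /=; rewrite cat_uniq !map_inj_uniq// IH andbT.
apply/andP; split.
  by rewrite /diagram allpairs_uniq_dep ?iota_uniq// => [? _|[? ?] [? ?] _ _ [-> ->]//]; exact: iota_uniq.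
apply/hasPn => _ /mapP[x _ ->]; apply/negP => /mapP[y /diagram_row yp].
by rewrite /shift_cell !addn0 => -[e _]; move: yp; rewrite -e ltnNge leq_addl.
Qed.

Section Tableaux.
Variable D : seq (nat * nat).

Definition cell := seq_sub D.
Definition row_of (x : cell) : nat := (val x).1.
Definition col_of (x : cell) : nat := (val x).2.

(** The value [k : 'I_n] of a filling stands for the entry [k + 1] of
    [{1, ..., n}]; see [entry]. *)
Definition filling := {ffun cell -> 'I_#|{: cell}|}.

Definition is_syt (T : filling) : bool :=
  [&& injectiveb T,
      [forall x, forall y,
        (row_of x == row_of y) && (col_of x < col_of y)%N ==> (T x < T y)%N] &
      [forall x, forall y,
        (col_of x == col_of y) && (row_of x < row_of y)%N ==> (T x < T y)%N]].

Definition SYT := {T : filling | is_syt T}.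

Definition entry (T : SYT) (x : cell) : nat := (val T x).+1.

Definition is_descent (T : SYT) (i : nat) : bool :=
  [exists x, exists y,
    [&& entry T x == i, entry T y == i.+1 & (row_of x < row_of y)%N]].

Definition maj (T : SYT) : nat :=
  (\sum_(1 <= i < #|{: cell}| | is_descent T i) i)%N.

(** Filling the cells row by row gives a standard tableau, so that [SYT] is
    nonempty. *)
Definition lex_lt (x y : cell) : bool :=
  (row_of x < row_of y)%N || (row_of x == row_of y) && (col_of x < col_of y)%N.

Lemma lex_lt_irr x : lex_lt x x = false.
Proof. by rewrite /lex_lt !ltnn andbF. Qed.

Lemma lex_lt_trans y x z : lex_lt x y -> lex_lt y z -> lex_lt x z.
Proof.
rewrite /lex_lt => /orP[xy|/andP[/eqP -> xy]] /orP[yz|/andP[/eqP yz yz']].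
- by rewrite (ltn_trans xy yz).
- by rewrite -yz xy.
- by rewrite yz.
- by rewrite yz eqxx (ltn_trans xy yz') orbT.
Qed.

Lemma lex_lt_total x y : [|| lex_lt x y, x == y | lex_lt y x].
Proof.
rewrite /lex_lt; case: (ltngtP (row_of x) (row_of y)) => //= xy; rewrite ?orbT//.
case: (ltngtP (col_of x) (col_of y)) => //= xy'; rewrite ?orbT//.
by rewrite orbF; apply/eqP/val_inj/injective_projections.
Qed.

Lemma lex_rank_subproof x : (#|[pred y | lex_lt y x]| < #|{: cell}|)%N.
Proof.
by apply/proper_card/properP; split; [apply/fintype.subsetP | exists x; rewrite // inE lex_lt_irr].
Qed.

Definition lex_filling : filling := [ffun x => Ordinal (lex_rank_subproof x)].

Lemma lex_filling_lt x y : lex_lt x y -> (lex_filling x < lex_filling y)%N.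
Proof.
move=> xy; rewrite !ffunE; apply/proper_card/properP; split.
  by apply/fintype.subsetP => z; rewrite !inE => /lex_lt_trans; apply.
by exists x; rewrite inE// lex_lt_irr.
Qed.

Lemma lex_filling_syt : is_syt lex_filling.
Proof.
apply/and3P; split.
- apply/injectiveP => x y xy; case/or3P: (lex_lt_total x y) => [|/eqP//|].
    by move/lex_filling_lt; rewrite xy ltnn.
  by move/lex_filling_lt; rewrite xy ltnn.
- apply/forallP => x; apply/forallP => y; apply/implyP => xy.
  by apply: lex_filling_lt; rewrite /lex_lt xy orbT.
- apply/forallP => x; apply/forallP => y; apply/implyP => /andP[_ xy].
  by apply: lex_filling_lt; rewrite /lex_lt xy.
Qed.

Definition lex_syt : SYT := exist _ lex_filling lex_filling_syt.

HB.instance Definition _ := Finite.on SYT.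
HB.instance Definition _ := isPointed.Build SYT lex_syt.
HB.instance Definition _ := @isMeasurable.Build default_measure_display SYT
  discrete_measurable discrete_measurable0
  discrete_measurableC discrete_measurableU.

End Tableaux.

Lemma card_cells l : #|{: cell (skew_cells l)}| = block_size l :> nat.
Proof. by rewrite card_seq_sub ?uniq_skew_cells// size_skew_cells. Qed.

Section MajRandomVariable.
Variables (R : realType) (D : seq (nat * nat)).

Definition card_inv : {nonneg R} := (#|{: SYT D}|%:R^-1)%:nng.

Definition uniform_syt : set (SYT D) -> \bar R := mscale card_inv counting.

HB.instance Definition _ := Measure.on uniform_syt.

Lemma uniform_syt_setT : uniform_syt [set: SYT D] = 1%E.
Proof.
rewrite /uniform_syt /mscale /= /counting asboolT; last exact: finite_finset.
have -> : fset_set [set: SYT D] = [fset x in enum {: SYT D}]%fset.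
  apply/fsetP => x; rewrite in_fset_set; last exact: finite_finset.
  by rewrite !inE mem_enum in_setT.
rewrite card_fseq undup_id ?enum_uniq// -cardE -EFinM mulVf//.
by rewrite pnatr_eq0 -lt0n; apply/card_gt0P; exists (lex_syt D).
Qed.

HB.instance Definition _ :=
  Measure_isProbability.Build _ _ _ uniform_syt uniform_syt_setT.

Definition maj_rv : SYT D -> R := fun T => (maj T)%:R.

Lemma measurable_maj_rv : measurable_fun setT maj_rv.
Proof. by []. Qed.

HB.instance Definition _ := isMeasurableFun.Build _ _ _ _ maj_rv measurable_maj_rv.

End MajRandomVariable.
Arguments uniform_syt R D : clear implicits.
Arguments maj_rv R D : clear implicits.

Section Normalization.
Context d (T : measurableType d) (R : realType) (P : probability T R).
Variable X : {RV P >-> R}.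

(** When the standard deviation is 0 the quotient is 0, as the inverse of 0
    is 0 in a [fieldType]. *)
Definition normalized : T -> R :=
  fun t => (X t - fine 'E_P[X]) / Num.sqrt (fine 'V_P[X]).

Lemma measurable_normalized : measurable_fun setT normalized.
Proof. by apply: measurable_funM => //; apply: measurable_funB. Qed.

HB.instance Definition _ :=
  isMeasurableFun.Build _ _ _ _ normalized measurable_normalized.

Definition normalized_law : probability R R := distribution P normalized.

End Normalization.

Definition maj_star_law (R : realType) (l : block_skew) : probability R R :=
  normalized_law (maj_rv R (skew_cells l) : {RV uniform_syt R (skew_cells l) >-> R}).

Section LimitLaws.
Variable R : realType.

(** [measurableTypeR R], on which the distributions of the library live, and
    [R] carry the same sigma-algebra under two displays. *)
Definition toR : measurableTypeR R -> R := idfun.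

HB.instance Definition _ :=
  isMeasurableFun.Build _ _ _ _ toR (@measurable_id _ _ setT).

Definition id_rv : R -> R := idfun.

HB.instance Definition _ :=
  isMeasurableFun.Build _ _ _ _ id_rv (@measurable_id _ _ setT).

Definition std_normal_law : probability R R :=
  distribution (normal_prob (0 : R) 1) toR.

Definition uniform01_law : probability R R :=
  distribution (uniform_prob (@ltr01 R)) toR.

Definition add_pair : R * R -> R := fun z => z.1 + z.2.

Lemma measurable_add_pair : measurable_fun setT add_pair.
Proof. exact: measurable_funD. Qed.

HB.instance Definition _ :=
  isMeasurableFun.Build _ _ _ _ add_pair measurable_add_pair.

(** Under the product measure the two summands of [add_pair] are
    independent. *)
Fixpoint irwin_hall (M : nat) : probability R R :=
  if M is M'.+1 then
    distribution (irwin_hall M' \x uniform01_law)%E add_pair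
  else \d_(0 : R).

Definition irwin_hall_star (M : nat) : probability R R :=
  normalized_law (id_rv : {RV irwin_hall M >-> R}).

End LimitLaws.

Section Laws.
Variable R : realType.
Implicit Types mu nu : probability R R.

Definition law_cdf mu : R -> \bar R := cdf (@id_rv R : {RV mu >-> R}).

Definition cvg_in_law (mu_ : nat -> probability R R) nu :=
  forall x : R, {for x, continuous (law_cdf nu)} ->
    law_cdf (mu_ n) x @[n --> \oo] --> law_cdf nu x.

Definition same_law mu nu := forall A : set R, measurable A -> mu A = nu A.

Definition discrete_law mu :=
  exists2 A : set R, countable A & mu A = 1%E.

End Laws.

(* Main.v *)
(** MacMahon's P-partition argument, a Gelfand-Tsetlin count of strict plane
    partitions and the hook lengths turn the generating function of maj into
    [X^b [n]_X! / prod_h [h]_X], the product ranging over the hook lengths [h].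
    The hooks of the longest row or column cancel all but [k = aft] of the
    factors of the numerator, which leaves
    [X^b prod_(c in C) [c]_X / prod_(b in B) [b]_X] with [k] factors above and
    below, the [b]'s being at most [k] and the [c]'s at most [n] but, up to
    O(k^2), close to [n].  Hence the characteristic function of the centered
    statistic at [2 x] is [prod sinc (c x) / prod sinc (b x)], and its variance
    is [(sum c^2 - sum b^2) / 12], of order [k n^2].  After normalization this
    tends to exp (- t^2 / 2) when [k] tends to infinity, and to the [M]-th power
    of a sinc when [k = M] and [n] tends to infinity; Levy's continuity theorem
    gives the limit laws.  These are told apart by the zeros of their
    characteristic functions and, but for [M = 0], have no atoms, unlike the law
    of any shape.  As shapes of bounded size have finitely many laws, comparing
    the limits of subsequences yields the converse. *)

Require Import Defs.
From HB Require Import structures.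
From mathcomp Require Import all_boot all_order all_algebra.
From mathcomp Require Import all_classical all_reals all_analysis.
From mathcomp Require Import measurable_realfun.
From mathcomp Require Import perm.
From mathcomp Require Import zify ring lra.

Set Implicit Arguments.
Unset Strict Implicit.
Unset Printing Implicit Defensive.

Import Order.TTheory GRing.Theory Num.Theory.
Import numFieldNormedType.Exports.

(** * Counting strict plane partitions by Gelfand-Tsetlin patterns *)

(** The exact identities are kept free of quotients. Instead of power series there are plane
    partitions with entries below [k], and identities are read modulo ['X^m] for every [m]. This
    fits the Gelfand-Tsetlin count, which bounds the entries by the number of rows, a number that
    empty rows can raise. In the identity for maj the denominator stays on the other side, where
    multiplying by [[b]_X] means adding an independent uniform variable; likewise for characteristic
    functions, whose sinc factors may vanish. As many factors remain above as below, so spare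
    factors [sinc h] and the constants in the variances cancel. Characteristic functions are real:
    the integrals of [cos (t * x + a)] for all [a] carry both the real and the imaginary part, and a
    translation changes [a] alone. The order of the variance must be uniform in the shape; this
    takes two arguments, one when the longest line is long and one when all hooks are short. Levy's
    theorem is used with a given limit law, and in the converse the limit is a hypothesis, so
    smoothing by a narrow Gaussian does the work and no tightness argument occurs. *)

Section GelfandTsetlin.
Variable K : fieldType.
Local Open Scope ring_scope.

Definition natfun (m k : nat) (b : {ffun 'I_m -> 'I_k}) (i : nat) : nat :=
  oapp (fun j => nat_of_ord (b j)) 0%N (insub i).

Lemma natfunE m k (b : {ffun 'I_m -> 'I_k}) (i : 'I_m) : natfun b i = b i.
Proof. by rewrite /natfun insubT //= => h; congr (nat_of_ord (b _)); apply: val_inj. Qed.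

Definition interlacing m k (a : nat -> nat) (b : {ffun 'I_m -> 'I_k}) :=
  [forall i : 'I_m, (a i <= b i <= a i.+1)%N].

(** The top row [a] carries no weight: in the recursion for plane partitions the weight counts the
    positive cells, which form the shape [b]. The bound [k] makes the set of candidate rows
    finite. *)
Fixpoint gt_poly (k m : nat) (a : nat -> nat) : {poly K} :=
  if m is m'.+1 then
    \sum_(b : {ffun 'I_m' -> 'I_k} | interlacing a b)
       'X^(\sum_i b i) * gt_poly k m' (natfun b)
  else 1.

(** The exponents [a j + j] are the beta-numbers; the Vandermonde determinant of this row is the
    alternant of a Schur function specialized at powers of ['X]. *)
Definition beta_row m (a : nat -> nat) : 'rV[{poly K}]_m :=
  \row_j 'X^(a j + j).

(** The alternant at [a = 0], that is, the product of ['X^k - 'X^j] over [j < k < m]. *)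
Definition gt_denom (m : nat) : {poly K} :=
  \prod_(k < m) ('X^('C(k, 2)) * \prod_(j < k) ('X^(j.+1) - 1)).

Lemma telescope_geom (x : nat) (u v : nat) : (u <= v)%N ->
  (\sum_(u <= c < v) 'X^(c * x)) * ('X^x - 1) = 'X^(v * x) - 'X^(u * x) :> {poly K}.
Proof.
move=> uv; rewrite mulr_suml -(telescope_sumr (fun c => 'X^(c * x))) //.
by apply: eq_bigr => i _; rewrite mulrBr mulr1 -exprD mulSn addnC.
Qed.

(** Subtracting from each column its left neighbour, a unimodular operation, turns the first row of
    ones into (1, 0, ..., 0); the expansion along that row leaves one minor. *)
Lemma det_Vandermonde_diff m (a : nat -> nat) :
  \det (Vandermonde m.+1 (beta_row m.+1 a)) =
  \det (\matrix_(i < m, j < m)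
     ('X^((a j.+1 + j.+1) * i.+1) - 'X^((a j + j) * i.+1)) : 'M[{poly K}]_m).
Proof.
pose U : 'M[{poly K}]_m.+1 :=
  \matrix_(i, j) ((i == j)%:R - (i.+1 == j)%:R).
have detU : \det U = 1.
  rewrite -det_tr det_trig; last first.
    apply/is_trig_mxP => i j ij; rewrite !mxE.
    by rewrite (gtn_eqF (leq_trans ij (leqnSn _))) gt_eqF ?subrr.
  by apply: big1 => i _; rewrite !mxE eqxx gtn_eqF ?subr0.
rewrite -[LHS]mulr1 -detU -det_mulmx.
set V := Vandermonde _ _; set M := V *m U.
have ME i j : M i j = V i j - (if unlift ord0 j is Some j' then V i (widen_ord (leqnSn m) j') else 0).
  rewrite !mxE; under eq_bigr do rewrite [U _ _]mxE mulrBr.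
  rewrite sumrB (bigD1 j) //= eqxx mulr1 big1 ?addr0; last first.
    by move=> k /negbTE kj; rewrite kj mulr0.
  congr (_ - _); first by rewrite !mxE.
  case: (unliftP ord0 j) => [j' ->|->]; last first.
    by rewrite big1 // => k _; rewrite mulr0.
  rewrite (bigD1 (widen_ord (leqnSn m) j')) //= {1}[_ == _]eqxx mulr1 big1 ?addr0 //.
  move=> k kj; rewrite /= /bump add1n eqSS; case: eqP => [e|]; last by rewrite mulr0.
  by case/eqP: kj; apply: val_inj.
rewrite (expand_det_row _ ord0) big_ord_recl big1 ?addr0; last first.
  by move=> i _; rewrite ME liftK !mxE !expr0 subrr mul0r.
rewrite ME unlift_none subr0 !mxE expr0 mul1r /cofactor /= expr0 mul1r.
congr (\det _); apply/matrixP => i j.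
transitivity (M (lift ord0 i) (lift ord0 j)); first by rewrite [LHS]mxE [LHS]mxE.
rewrite ME liftK !mxE.
by rewrite -!exprM /= /bump leq0n !add1n.
Qed.

Lemma det_sum_cols m k (P : 'I_m -> pred 'I_k) (g : 'I_m -> 'I_m -> 'I_k -> {poly K}) :
  \det (\matrix_(i, j) \sum_(c | P j c) g i j c) =
  \sum_(b in family P) \det (\matrix_(i, j) g i j (b j)).
Proof.
rewrite -det_tr; under [RHS]eq_bigr do rewrite -det_tr.
rewrite /determinant exchange_big /=; apply: eq_bigr => s _.
rewrite -big_distrr /=; congr (_ * _).
rewrite (eq_bigr (fun j => \sum_(c | P j c) g (s j) j c)); last by move=> i _; rewrite !mxE.
rewrite bigA_distr_big_dep; apply: eq_bigr => b _; apply: eq_bigr => i _.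
by rewrite !mxE.
Qed.

(** This is the quotient of alternants for a Schur function at 1, X, ..., X^(m-1). A difference of
    neighbouring columns is a geometric sum whose range is exactly the interlacing condition, so
    multilinearity in the columns reproduces the recursion. *)
Lemma gt_poly_Vandermonde k m (a : nat -> nat) :
  (forall i, i.+1 < m -> a i <= a i.+1)%N -> (forall i, i < m -> a i < k)%N ->
  gt_poly k m a * gt_denom m = \det (Vandermonde m (beta_row m a)).
Proof.
elim: m a => [|m IH] a mono bnd.
  by rewrite /= /gt_denom big_ord0 mulr1 det_mx00.
rewrite /= /gt_denom big_ord_recr /= -/(gt_denom m) mulr_suml.
rewrite det_Vandermonde_diff.
pose P (j : 'I_m) := [pred c : 'I_k | (a j <= c <= a j.+1)%N].
(* The last factor depends on the row alone, and a factor ['X^(c + j)] comes out of each column;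
   what remains is a Vandermonde matrix of order [m]. *)
pose g (i j : 'I_m) (c : 'I_k) : {poly K} := ('X^((c + j) * i.+1)) * ('X^(i.+1) - 1).
rewrite (_ : \matrix_(i, j) _ = \matrix_(i, j) \sum_(c | P j c) g i j c); last first.
  apply/matrixP => i j; rewrite !mxE /g -mulr_suml.
  have aj : (a j <= a j.+1)%N by apply: mono; rewrite ltnS.
  have aj1 : (a j.+1 < k)%N by apply: bnd; rewrite ltnS.
  (* The staircase [j] moves the open upper end by one, so the range becomes [a j <= c <= a j.+1],
     both ends included. *)
  rewrite addnS -telescope_geom; last by lia.
  congr (_ * _).
  transitivity (\sum_(a j <= c < (a j.+1).+1) 'X^((c + j) * i.+1) : {poly K}).
    by rewrite big_addn -addSn addnK.
  rewrite (big_nat_widenl _ 0%N) // (big_nat_widen _ _ k) // big_mkord.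
  by apply: eq_bigl => c.
rewrite det_sum_cols; apply: eq_big => [b|b ab].
  by apply/forallP/familyP => h i; have := h i; rewrite inE.
have bb i : (i.+1 < m)%N -> (natfun b i <= natfun b i.+1)%N.
  move=> im; have im' := ltnW im.
  rewrite -[i]/(val (Ordinal im')) -[(val _).+1]/(val (Ordinal im)) !natfunE.
  move/forallP: ab => ab; have /andP[_ h1] := ab (Ordinal im').
  by have /andP[h2 _] := ab (Ordinal im); apply: leq_trans h1 h2.
have bk i : (i < m)%N -> (natfun b i < k)%N.
  by move=> im; rewrite -[i]/(val (Ordinal im)) natfunE ltn_ord.
rewrite ['X^_ * gt_poly _ _ _]mulrC mulrACA IH //.
rewrite (_ : \matrix_(i, j) g i j (b j) =
   diag_mx (\row_(i < m) ('X^(i.+1) - 1)) *m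
   (Vandermonde m (beta_row m (natfun b)) *m diag_mx (beta_row m (natfun b)))); last first.
  apply/matrixP => i j; rewrite mul_diag_mx mul_mx_diag !mxE natfunE /g.
  by rewrite -exprM -exprD mulnS mulrC; congr (_ * 'X^_); lia.
rewrite !det_mulmx !det_diag; under [\prod_i (\row__ _) _ _]eq_bigr do rewrite mxE.
rewrite [RHS]mulrCA; congr (_ * _); rewrite mulrA mulrC; congr (_ * _).
(* The column factors multiply to the weight of [b] times ['X^('C(m, 2))], the new power of ['X] in
   [gt_denom]. *)
under [RHS]eq_bigr do rewrite mxE natfunE.
by rewrite -expr_sum big_split /= exprD -bin2_sum big_mkord.
Qed.

Lemma det_beta_row m (a : nat -> nat) :
  (forall i, i.+1 < m -> a i <= a i.+1)%N ->
  \det (Vandermonde m (beta_row m a)) =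
  \prod_(j < m) \prod_(i < j) ('X^(a i + i) * ('X^(a j + j - (a i + i)) - 1)).
Proof.
move=> mono; rewrite det_Vandermonde.
rewrite (exchange_big_dep xpredT) //=; apply: eq_bigr => j _.
have amono (i : nat) : (i <= j)%N -> (a i <= a j)%N.
  have := ltn_ord j; move: (nat_of_ord j) => j' jm; elim: j' jm => [|j' IH] jm; first by rewrite leqn0 => /eqP->.
  by rewrite leq_eqVlt => /predU1P[->//|]; rewrite ltnS => /IH h; apply: leq_trans (h (ltnW jm)) (mono _ _).
rewrite (big_ord_widen_cond m xpredT (fun i : nat => 'X^(a i + i) * ('X^(a j + j - (a i + i)) - 1))) ?(ltnW (ltn_ord j)) //.
apply: eq_bigr => i ij; rewrite !mxE mulrBr mulr1 -exprD subnKC //.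
by have := amono _ (ltnW ij); lia.
Qed.

End GelfandTsetlin.

Lemma big_iota0 (T : Type) (idx : T) (op : T -> T -> T) n (F : nat -> T) :
  \big[op/idx]_(i <- iota 0 n) F i = \big[op/idx]_(i < n) F i.
Proof. by rewrite -(big_mkord xpredT) /index_iota subn0. Qed.

(** * Hook lengths and beta-numbers *)

Section Hooks.

(** [s] lists the rows below. In column [c] the cell and its arm count [p - c], and the leg counts
    the rows of [s] longer than [c]. *)
Definition row_hooks (p : nat) (s : seq nat) : seq nat :=
  [seq (p - c + count (fun r => c < r) s)%N | c <- iota 0 p].

Fixpoint hooks (s : seq nat) : seq nat :=
  if s is p :: s' then row_hooks p s' ++ hooks s' else [::].

Definition rows_upto m (a : nat -> nat) : seq nat := rev (mkseq a m).

Lemma rows_uptoS m a : rows_upto m.+1 a = a m :: rows_upto m a.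
Proof. by rewrite /rows_upto /mkseq -addn1 iotaD map_cat rev_cat. Qed.

Lemma size_hooks s : size (hooks s) = sumn s.
Proof. by elim: s => //= p s IH; rewrite size_cat size_map size_iota IH. Qed.

Lemma hooks_nseq0 s k : hooks (s ++ nseq k 0%N) = hooks s.
Proof.
elim: s => [|p s IH] /=; first by elim: k.
rewrite IH; congr (_ ++ _); apply: eq_map => c.
by rewrite count_cat count_nseq mul0n addn0.
Qed.

Lemma count_rows_upto m (a : nat -> nat) c :
  count (fun r => c < r)%N (rows_upto m a) = count (fun i => c < a i)%N (iota 0 m).
Proof. by rewrite /rows_upto count_rev count_map; apply: eq_count. Qed.

Lemma nondecr_upto m (a : nat -> nat) :
  (forall i, i.+1 < m -> a i <= a i.+1)%N ->
  forall i j, (i <= j < m)%N -> (a i <= a j)%N.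
Proof.
move=> mono i j /andP[]; elim: j => [|j IH]; first by rewrite leqn0 => /eqP->.
rewrite leq_eqVlt => /predU1P[->//|]; rewrite ltnS => ij jm.
exact: leq_trans (IH ij (ltnW jm)) (mono _ _).
Qed.

Lemma count_gt_lb m (a : nat -> nat) c i : (forall i j, i <= j < m -> a i <= a j)%N ->
  (i < m)%N -> (c < a i)%N -> (m - i <= count (fun i => c < a i)%N (iota 0 m))%N.
Proof.
move=> mono im cai; rewrite -{2}(subnKC (ltnW im)) iotaD count_cat add0n.
rewrite (_ : count _ (iota i _) = m - i)%N ?leq_addl //.
rewrite -[RHS](size_iota i) -[in RHS](count_predT); apply: eq_in_count => j.
rewrite mem_iota => /andP[ij jm] /=; rewrite (leq_trans cai) // mono //; lia.
Qed.

Lemma count_gt_ub m (a : nat -> nat) c i : (forall i j, i <= j < m -> a i <= a j)%N ->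
  (i < m)%N -> (a i <= c)%N -> (count (fun i => c < a i)%N (iota 0 m) <= m - i.+1)%N.
Proof.
move=> mono im cai; rewrite -{1}(subnKC im) iotaD count_cat add0n.
rewrite (_ : count _ (iota 0 i.+1) = 0)%N.
  by rewrite -[leqRHS](size_iota i.+1) add0n count_size.
rewrite (@eq_in_count _ _ pred0) ?count_pred0 // => j.
rewrite mem_iota => /andP[_]; rewrite add0n ltnS => ij; apply/negbTE; rewrite -leqNgt.
by rewrite (leq_trans _ cai) // mono // ij.
Qed.

(* The classical complementation between the hook lengths of a row and the
   differences of beta-numbers (Macdonald, I.1, (1.7)). *)
Lemma perm_row_hooks m (a : nat -> nat) :
  (forall i, i.+1 < m.+1 -> a i <= a i.+1)%N ->
  perm_eq (row_hooks (a m) (rows_upto m a) ++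
           [seq (a m + m - (a i + i))%N | i <- iota 0 m])
          (iota 1 (a m + m)).
Proof.
move=> mono0; have mono := nondecr_upto mono0.
have monom i j : (i <= j < m)%N -> (a i <= a j)%N by move=> h; apply: mono; lia.
have cm c : (count (fun r => c < r)%N (rows_upto m a) <= m)%N.
  by rewrite (leq_trans (count_size _ _)) // size_rev size_mkseq.
(* Both lists lie in [1, ..., a m + m] and together have that many elements, so it is enough that no
   value is repeated. *)
have U : uniq (row_hooks (a m) (rows_upto m a) ++
           [seq (a m + m - (a i + i))%N | i <- iota 0 m]).
  rewrite cat_uniq; apply/and3P; split.
  - rewrite map_inj_in_uniq ?iota_uniq // => c d; rewrite !mem_iota add0n.
    move=> /andP[_ cp] /andP[_ dp].
    wlog cd : c d cp dp / (c <= d)%N.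
      by move=> H; case/orP: (leq_total c d) => h e; [apply: H|apply/esym/H].
    move=> e; apply/eqP; rewrite eqn_leq cd leqNgt; apply/negP => lt.
    have : (count (fun r => d < r)%N (rows_upto m a) <=
            count (fun r => c < r)%N (rows_upto m a))%N.
      by apply: sub_count => r /=; apply: leq_ltn_trans.
    lia.
  - apply/hasPn => x /mapP[i]; rewrite mem_iota add0n => /andP[_ im] ->.
    (* A common value would force the leg to be [c + m - a i - i]; but the leg is at least [m - i]
       if [c < a i], and at most [m - i - 1] otherwise. *)
    apply/negP => /mapP[c]; rewrite mem_iota add0n => /andP[_ cp].
    rewrite count_rows_upto.
    have aim : (a i <= a m)%N by apply: mono; lia.
    have := cm c; rewrite count_rows_upto.
    case: (ltnP c (a i)) => h.
      by have := count_gt_lb monom im h; lia.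
    by have := count_gt_ub monom im h; lia.
  - rewrite map_inj_in_uniq ?iota_uniq // => i j; rewrite !mem_iota add0n.
    move=> /andP[_ im] /andP[_ jm].
    wlog ij : i j im jm / (i <= j)%N.
      by move=> H; case/orP: (leq_total i j) => h e; [apply: H|apply/esym/H].
    have h1 : (a i <= a j)%N by apply: monom; lia.
    have h2 : (a j <= a m)%N by apply: mono; lia.
    lia.
apply: uniq_perm; rewrite ?iota_uniq //.
apply: (uniq_min_size U _ _).2; last first.
  by rewrite size_cat !size_map !size_iota.
move=> x; rewrite mem_cat => /orP[]/mapP[c]; rewrite mem_iota add0n => /andP[_ h] ->; rewrite mem_iota.
  by have := cm c; lia.
have : (a c <= a m)%N by apply: mono; lia.
lia.
Qed.

End Hooks.

Section GelfandTsetlinHooks.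
Variable K : fieldType.
Local Open Scope ring_scope.

Lemma Xn_sub1_neq0 h : (0 < h)%N -> 'X^h - 1 != 0 :> {poly K}.
Proof. by move=> h0; rewrite -size_poly_eq0 size_XnsubC. Qed.

(** Stanley's hook-content formula: [(j + i).+1] is [m] plus the content of the cell in column [i]
    of row [j] from the bottom. In each row the Vandermonde differences and the hooks together
    exhaust [1, ..., a j + j]; the first [j] of these factors belong to the denominator, the others
    are the contents. *)
Lemma gt_poly_hooks k m (a : nat -> nat) :
  (forall i, i.+1 < m -> a i <= a i.+1)%N -> (forall i, i < m -> a i < k)%N ->
  gt_poly K k m a * \prod_(h <- hooks (rows_upto m a)) ('X^h - 1) =
  'X^(\sum_(j < m) \sum_(i < j) a i) *
  \prod_(j < m) \prod_(i < a j) ('X^((j + i).+1) - 1).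
Proof.
move=> mono bnd.
pose d := \prod_(j < m) 'X^('C(j, 2)) : {poly K}.
pose e := \prod_(j < m) \prod_(i < j) ('X^(i.+1) - 1) : {poly K}.
have dE : gt_denom K m = d * e by rewrite /gt_denom big_split.
have d0 : d != 0 by apply/prodf_neq0 => i _; rewrite -size_poly_eq0 size_polyXn.
have e0 : e != 0 by apply/prodf_neq0 => i _; apply/prodf_neq0 => j _; apply: Xn_sub1_neq0.
have hooksE : \prod_(h <- hooks (rows_upto m a)) ('X^h - 1) =
    \prod_(j < m) \prod_(h <- row_hooks (a j) (rows_upto j a)) ('X^h - 1) :> {poly K}.
  elim: (m) => [|m' IH]; first by rewrite big_nil big_ord0.
  by rewrite rows_uptoS big_ord_recr /= big_cat IH mulrC.
apply: (mulIf (mulf_neq0 d0 e0)); rewrite mulrAC -dE gt_poly_Vandermonde //.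
rewrite det_beta_row // hooksE -big_split /=.
have rowE (j : 'I_m) : \prod_(i < j) ('X^(a i + i) * ('X^(a j + j - (a i + i)) - 1)) *
     \prod_(h <- row_hooks (a j) (rows_upto j a)) ('X^h - 1) =
   ('X^(\sum_(i < j) a i) * 'X^('C(j, 2))) *
    (\prod_(i < j) ('X^(i.+1) - 1) * \prod_(i < a j) ('X^((j + i).+1) - 1)) :> {poly K}.
  rewrite big_split -[LHS]mulrA; congr (_ * _) => /=.
    by rewrite -expr_sum big_split /= exprD -bin2_sum big_mkord.
  have -> : \prod_(i < j) ('X^(a j + j - (a i + i)) - 1) =
     \prod_(h <- [seq (a j + j - (a i + i))%N | i <- iota 0 j]) ('X^h - 1) :> {poly K}.
    by rewrite big_map big_iota0.
  rewrite mulrC -big_cat.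
  have monoj i : (i.+1 < j.+1)%N -> (a i <= a i.+1)%N.
    by move=> h; apply: mono; have := ltn_ord j; lia.
  rewrite (perm_big _ (perm_row_hooks monoj)) /=.
  rewrite addnC iotaD big_cat /=; congr (_ * _).
    by rewrite (iotaDl 1 0) big_map big_iota0.
  rewrite -[(1 + j)%N]addn0 iotaDl big_map big_iota0.
  by apply: eq_bigr => i _; rewrite addSn.
under eq_bigr do rewrite rowE.
rewrite dE !big_split /= -/d -/e expr_sum; ring.
Qed.

End GelfandTsetlinHooks.

(** * Strict plane partitions, peeled layer by layer *)

Section StrictPlanePartitions.
Variable K : fieldType.
Local Open Scope ring_scope.

(** The row and column relations are abstract, so that one notion serves diagrams numbered from the
    bottom, skew shapes and disjoint unions. *)
Definition strictpp (I : finType) (r c : rel I) n (f : {ffun I -> 'I_n}) :=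
  [forall x, forall y, (r x y ==> (f y <= f x)%N) && (c x y ==> (f y < f x)%N)].

Lemma strictppP (I : finType) (r c : rel I) n (f : {ffun I -> 'I_n}) :
  reflect (forall x y, (r x y -> (f y <= f x)%N) /\ (c x y -> (f y < f x)%N))
          (strictpp r c f).
Proof.
apply: (iffP idP) => [/forallP h x y|h].
  by have /forallP/(_ y)/andP[/implyP h1 /implyP h2] := h x.
apply/forallP => x; apply/forallP => y; have [h1 h2] := h x y.
by apply/andP; split; apply/implyP.
Qed.

Definition pp_poly (I : finType) (r c : rel I) n : {poly K} :=
  \sum_(f : {ffun I -> 'I_n} | strictpp r c f) 'X^(\sum_x f x).

Definition pos_row (I : finType) (pos : I -> nat * nat) : rel I :=
  fun x y => ((pos x).1 == (pos y).1) && ((pos x).2 < (pos y).2)%N.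
Definition pos_col (I : finType) (pos : I -> nat * nat) : rel I :=
  fun x y => ((pos x).2 == (pos y).2) && ((pos y).1 < (pos x).1)%N.

(** A downward closed set of indices is an initial segment, hence determined by its size. *)
Lemma count_initial (p : pred nat) n :
  (forall c d, (c <= d < n)%N -> p d -> p c) ->
  forall c, (c < n)%N -> p c = (c < count p (iota 0 n))%N.
Proof.
move=> mono c cn; apply/idP/idP => [pc|].
  rewrite -(subnKC cn) iotaD count_cat; apply: leq_trans (leq_addr _ _).
  rewrite -[leqLHS](size_iota 0) -[leqLHS]count_predT; apply/eq_leq/eq_in_count => d.
  by rewrite mem_iota add0n ltnS => /andP[_ dc]; rewrite (mono d c) // dc.
apply: contraTT => npc; rewrite -leqNgt -(subnKC (ltnW cn)) iotaD count_cat add0n.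
rewrite (@eq_in_count _ _ pred0 (iota c _)) ?count_pred0 ?addn0.
  by rewrite -[leqRHS](size_iota 0 c) count_size.
move=> d; rewrite mem_iota => /andP[cd dn] /=; apply/negbTE; apply: contra npc.
by apply: mono; lia.
Qed.

(* Rows are numbered from the bottom: row [i] of the diagram has [a i] cells. *)
Definition diagram_pos (I : finType) (pos : I -> nat * nat) m (a : nat -> nat) :=
  [/\ injective pos, forall x, ((pos x).1 < m)%N && ((pos x).2 < a (pos x).1)%N &
      forall r c, (r < m)%N -> (c < a r)%N -> exists x, pos x = (r, c)].

Lemma card_diagram_pos (I : finType) (pos : I -> nat * nat) m a :
  diagram_pos pos m a -> #|I| = (\sum_(i < m) a i)%N.
Proof.
move=> [inj posP surj]; rewrite cardE -(size_map pos).
have /perm_size -> : perm_eq (map pos (enum I))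
     [seq (r, c) | r <- iota 0 m, c <- iota 0 (a r)].
  apply: uniq_perm.
  - by rewrite map_inj_uniq ?enum_uniq.
  - by rewrite allpairs_uniq_dep ?iota_uniq // => [? _|[? ?] [? ?] _ _ [-> ->]//]; exact: iota_uniq.
  - move=> [r c]; apply/mapP/allpairsPdep => [[x _ e]|[r' [c' [+ + [-> ->]]]]].
      by exists r, c; have := posP x; rewrite -e !mem_iota /= => /andP[].
    rewrite !mem_iota !add0n /= => rm cm; have [x e] := surj _ _ rm cm.
    by exists x; rewrite ?mem_enum.
rewrite size_allpairs_dep; under eq_map do rewrite size_iota.
by rewrite sumnE big_map big_iota0.
Qed.

(** As rows grow upwards, the column of [x] continues up to row [n - 1], with strictly increasing
    values that are at most [n - 1]. In particular the bottom row vanishes. *)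
Lemma strictpp_row_ub (I : finType) (pos : I -> nat * nat) n a (f : {ffun I -> 'I_n}) :
  diagram_pos pos n a -> (forall i, i.+1 < n -> a i <= a i.+1)%N ->
  strictpp (pos_row pos) (pos_col pos) f -> forall x, (f x <= (pos x).1)%N.
Proof.
move=> [inj posP surj] mono /strictppP st x.
move: {2}(n - (pos x).1)%N (leqnn (n - (pos x).1)) => d.
elim: d x => [|d IH] x; have /andP[xn xa] := posP x; first by rewrite leqn0 subn_eq0 leqNgt xn.
move=> hd; case: (ltnP (pos x).1.+1 n) => x1n; last first.
  by have := ltn_ord (f x); lia.
have [|y e] := surj (pos x).1.+1 (pos x).2 x1n.
  by apply: leq_trans xa _; apply: mono.
have /IH : (n - (pos y).1 <= d)%N by rewrite e /=; lia.
have [_ /(_ _)] := st y x; rewrite /pos_col e /= eqxx ltnSn => /(_ isT); lia.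
Qed.

Section Step.
Variables (I : finType) (pos : I -> nat * nat) (n k : nat) (a : nat -> nat).
Hypothesis posI : diagram_pos pos n.+1 a.
Hypothesis mono : forall i, (i.+1 < n.+1 -> a i <= a i.+1)%N.
Hypothesis bnd : forall i, (i < n.+1 -> a i < k)%N.
Let r := pos_row pos.
Let c := pos_col pos.

Let F (f : {ffun I -> 'I_n.+1}) (i j : nat) : nat :=
  oapp (fun x => nat_of_ord (f x)) 0%N [pick x | pos x == (i, j)].

Let FE f x : F f (pos x).1 (pos x).2 = f x.
Proof.
have [inj _ _] := posI; rewrite /F; case: pickP => [y|/(_ x)].
  by rewrite -surjective_pairing => /eqP/inj ->.
by rewrite -surjective_pairing eqxx.
Qed.

(** The positive entries of row [i.+1]; row 0 has none. These counts are the next row of the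
    Gelfand-Tsetlin pattern: the positive entries lowered by one form a strict plane partition with
    one row fewer. *)
Let support_card f i : nat := count (fun j => 0 < F f i.+1 j)%N (iota 0 (a i.+1)).

Let support_lt f (i : 'I_n) : (support_card f i < k)%N.
Proof.
apply: leq_ltn_trans (count_size _ _) _; rewrite size_iota; apply: bnd.
by rewrite ltnS.
Qed.

Let shape f : {ffun 'I_n -> 'I_k} := [ffun i : 'I_n => Ordinal (support_lt f i)].

Let supported (f : {ffun I -> 'I_n.+1}) (b : {ffun 'I_n -> 'I_k}) :=
  [forall x, (0 < f x)%N == (0 < (pos x).1)%N && ((pos x).2 < natfun b (pos x).1.-1)%N].

Let strict_support f i j : strictpp r c f -> (i < n)%N -> (j < a i.+1)%N ->
  (0 < F f i.+1 j)%N = (j < natfun (shape f) i)%N.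
Proof.
move=> /strictppP st im ja; have [inj posP surj] := posI.
rewrite -[i in natfun _ i]/(val (Ordinal im)) natfunE ffunE /=.
apply: (@count_initial (fun j => 0 < F f i.+1 j)%N) ja => d e /andP[de ea] p.
have [x ex] := surj i.+1 d im (leq_ltn_trans de ea).
have [y ey] := surj i.+1 e im ea.
move: p; rewrite -[i.+1]/((i.+1, e).1) -[e in F _ _ e]/((i.+1, e).2) -ey FE ey.
rewrite -[X in F _ X d]/((i.+1, d).1) -[d in F _ _ d]/((i.+1, d).2) -ex FE.
move: de; rewrite leq_eqVlt => /predU1P[de|de].
  by have -> : x = y by apply: inj; rewrite ex ey de.
have [/(_ _) h _] := st x y; move=> p; apply: leq_trans p (h _).
by rewrite /r /pos_row ex ey eqxx.
Qed.

Let strict_supported f : strictpp r c f -> supported f (shape f).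
Proof.
move=> st; apply/forallP => x; have [inj posP surj] := posI.
have /andP[xm xa] := posP x.
case E: (pos x).1 => [|i].
  by have := strictpp_row_ub posI mono st x; rewrite E leqn0 => /eqP ->.
rewrite /= -(@strict_support f i) //; first by rewrite -E FE.
  by move: xm; rewrite E.
by rewrite -E.
Qed.

(** If [shape f i < a i], the cell of row [i] in column [shape f i] would lie below a zero entry,
    against column strictness. The other inequality is the length of row [i.+1]. *)
Let strict_shape f : strictpp r c f -> interlacing a (shape f).
Proof.
move=> st; apply/forallP => i; apply/andP; split; last first.
  by rewrite ffunE /= -[leqRHS](size_iota 0) count_size.
rewrite leqNgt; apply/negP => lt; have [inj posP surj] := posI.
have im := ltn_ord i.
have ai : (a i <= a i.+1)%N by apply: mono.
have [x ex] := surj i.+1 (shape f i : nat) im (leq_trans lt ai).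
have [y ey] := surj i (shape f i : nat) (ltnW im) lt.
have := forallP (strict_supported st) x; rewrite ex /= natfunE ltnn => /eqP.
have /strictppP st' := st; have [_] := st' x y; rewrite /c /pos_col ex ey /= eqxx ltnSn.
by move=> /(_ isT); lia.
Qed.

Let supported_shape f b : interlacing a b -> supported f b -> shape f = b.
Proof.
move=> ab /forallP sup; apply/ffunP => i; apply/val_inj; rewrite ffunE /= /support_card.
have [inj posP surj] := posI; have im := ltn_ord i.
have /andP[_ bi] := forallP ab i.
rewrite -(subnKC bi) iotaD count_cat add0n.
rewrite (@eq_in_count _ _ predT (iota 0 _)) => [|j].
  rewrite count_predT size_iota (@eq_in_count _ _ pred0 (iota (b i) _)).
    by rewrite count_pred0 addn0.
  move=> j; rewrite mem_iota subnKC // => /andP[bj ja] /=.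
  have [x ex] := surj i.+1 j im ja.
  have /eqP := sup x; rewrite -FE ex /= natfunE => ->.
  by apply/negbTE; rewrite -leqNgt.
rewrite mem_iota add0n => /andP[_ bj] /=.
have [x ex] := surj i.+1 j im (leq_trans bj bi).
by have /eqP := sup x; rewrite -FE ex /= natfunE => ->.
Qed.

Section Inner.
Variables (b : {ffun 'I_n -> 'I_k}).
Hypothesis ab : interlacing a b.

Definition inner_cells : finType :=
  {x : I | (0 < (pos x).1)%N && ((pos x).2 < natfun b (pos x).1.-1)%N}.

Definition inner_pos (x : inner_cells) := ((pos (val x)).1.-1, (pos (val x)).2).

Lemma inner_diagram : diagram_pos inner_pos n (natfun b).
Proof.
have [inj posP surj] := posI; split.
- move=> [x xb] [y yb]; rewrite /inner_pos /= => -[e1 e2]; apply: val_inj => /=.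
  apply: inj; move: e1 e2 xb yb; case: (pos x) (pos y) => [[|p] q] [[|p'] q'] //=.
  by move=> -> ->.
- move=> [x xb]; rewrite /inner_pos /=; have /andP[xm xa] := posP x.
  by case/andP: xb => x0 -> ; rewrite andbT; lia.
- move=> p q pm; rewrite -[p]/(val (Ordinal pm)) natfunE => qb.
  have /andP[_ bi] := forallP ab (Ordinal pm).
  have [x ex] := surj p.+1 q pm (leq_trans qb bi).
  have xb : (0 < (pos x).1)%N && ((pos x).2 < natfun b (pos x).1.-1)%N.
    by rewrite ex /= -[p]/(val (Ordinal pm)) natfunE.
  by exists (Sub x xb); rewrite /inner_pos /= ex.
Qed.

Definition raise (g : {ffun inner_cells -> 'I_n}) : {ffun I -> 'I_n.+1} :=
  [ffun x => oapp (fun x' => lift ord0 (g x')) ord0 (insub x)].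

Lemma raise_val g x' : raise g (val x') = (g x').+1 :> nat.
Proof. by rewrite ffunE valK. Qed.

Lemma raise_out g x : ~~ ((0 < (pos x).1)%N && ((pos x).2 < natfun b (pos x).1.-1)%N) ->
  raise g x = 0%N :> nat.
Proof. by move=> h; rewrite ffunE insubN. Qed.

Let lower_lt (f : {ffun I -> 'I_n.+1}) (x' : inner_cells) : ((f (val x')).-1 < n)%N.
Proof.
have [inj posP surj] := posI; have /andP[xm _] := posP (val x').
have /andP[x0 _] := valP x'; have := ltn_ord (f (val x')); lia.
Qed.

Definition lower f : {ffun inner_cells -> 'I_n} := [ffun x' => Ordinal (lower_lt f x')].

Lemma raiseK g : lower (raise g) = g.
Proof. by apply/ffunP => x'; apply: val_inj; rewrite ffunE /= raise_val. Qed.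

Lemma lowerK f : supported f b -> raise (lower f) = f.
Proof.
move=> /forallP sup; apply/ffunP => x; apply: val_inj => /=; have /eqP := sup x.
case: (boolP ((0 < (pos x).1)%N && ((pos x).2 < natfun b (pos x).1.-1)%N)) => h f0.
  by rewrite -[x in raise _ x]/(val (Sub x h : inner_cells)) raise_val ffunE /= prednK.
by rewrite raise_out //; move: f0; case: (nat_of_ord (f x)).
Qed.

Lemma raise_supported g : supported (raise g) b.
Proof.
apply/forallP => x; apply/eqP.
case: (boolP ((0 < (pos x).1)%N && ((pos x).2 < natfun b (pos x).1.-1)%N)) => h.
  by rewrite -[x in raise _ x]/(val (Sub x h : inner_cells)) raise_val.
by rewrite raise_out.
Qed.

Lemma raise_sum g : (\sum_x raise g x = \sum_i b i + \sum_x' g x')%N.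
Proof.
pose A := [pred x | (0 < (pos x).1)%N && ((pos x).2 < natfun b (pos x).1.-1)%N].
rewrite (bigID (mem A)) /= [X in (_ + X)%N]big1 ?addn0; last first.
  by move=> x; rewrite inE => h; rewrite raise_out.
rewrite (big_sub A).
transitivity (\sum_(x' : inner_cells) (1 + g x'))%N.
  by apply: eq_bigr => x' _; rewrite raise_val.
rewrite big_split /= sum1_card (card_diagram_pos inner_diagram).
by congr (_ + _)%N; apply: eq_bigr => i _; rewrite natfunE.
Qed.

Let innerP (x : I) : (0 < (pos x).1)%N && ((pos x).2 < natfun b (pos x).1.-1)%N ->
  exists x' : inner_cells, x = val x'.
Proof. by move=> h; exists (Sub x h). Qed.

Let b_nondecr i j : (i <= j < n)%N -> (natfun b i <= natfun b j)%N.
Proof.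
apply: nondecr_upto => {}i im; have im' := ltnW im.
rewrite -[i in leqLHS]/(val (Ordinal im')) -[i.+1]/(val (Ordinal im)) !natfunE.
have /andP[_ h1] := forallP ab (Ordinal im').
by have /andP[h2 _] := forallP ab (Ordinal im); apply: leq_trans h1 h2.
Qed.

(** Outside the inner cells the raised filling is 0. The point is that a cell to the left of an
    inner cell, or above any cell of the diagram, is itself inner; the latter is the inequality
    [a i <= b i] of interlacing. *)
Lemma raise_strict g :
  strictpp r c (raise g) = strictpp (pos_row inner_pos) (pos_col inner_pos) g.
Proof.
have [inj posP surj] := posI.
apply/strictppP/strictppP => st x y; last first.
  split => [/andP[/eqP e1 e2]|/andP[/eqP e1 e2]].
    case: (boolP ((0 < (pos y).1)%N && ((pos y).2 < natfun b (pos y).1.-1)%N)) => hy; last by rewrite raise_out.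
    have hx : (0 < (pos x).1)%N && ((pos x).2 < natfun b (pos x).1.-1)%N.
      by rewrite e1; case/andP: hy => -> hy; apply: ltn_trans hy.
    have [y' ey] := innerP hy; have [x' ex] := innerP hx; subst x y.
    rewrite !raise_val ltnS; have [+ _] := st x' y'; apply.
    by rewrite /pos_row /inner_pos /= e1 eqxx.
  have /andP[xm xa] := posP x; have /andP[ym ya] := posP y.
  have x0 : (0 < (pos x).1)%N by lia.
  case: (boolP ((0 < (pos y).1)%N && ((pos y).2 < natfun b (pos y).1.-1)%N)) => hy.
    have hx : (0 < (pos x).1)%N && ((pos x).2 < natfun b (pos x).1.-1)%N.
      rewrite x0 e1; case/andP: hy => y0 hy; apply: leq_trans hy _.
      by apply: b_nondecr; lia.
    have [y' ey] := innerP hy; have [x' ex] := innerP hx; subst x y.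
    rewrite !raise_val ltnS; have [_ ] := st x' y'; apply.
    case/andP: hy => y0 _.
    have lt : ((pos (val y')).1.-1 < (pos (val x')).1.-1)%N by clear -e2 y0; lia.
    by rewrite /pos_col /inner_pos /= e1 eqxx.
  have hx : (0 < (pos x).1)%N && ((pos x).2 < natfun b (pos x).1.-1)%N.
    have im : ((pos x).1.-1 < n)%N by lia.
    have /andP[h _] := forallP ab (Ordinal im).
    rewrite x0 e1 -[(pos x).1.-1]/(val (Ordinal im)) natfunE; apply: leq_trans h => /=.
    by apply: leq_trans ya _; apply: (nondecr_upto mono); lia.
  by have [x' ex] := innerP hx; subst x; rewrite raise_val (raise_out _ hy).
have /andP[x0 _] := valP x; have /andP[y0 _] := valP y.
have [h1 h2] := st (val x) (val y); rewrite !raise_val !ltnS in h1 h2.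
rewrite /= in x0 y0; rewrite /r /c /pos_row /pos_col /inner_pos /= in h1 h2 *.
split=> /andP[/eqP e1 e2]; [apply: h1|apply: h2]; apply/andP; split=> //; try apply/eqP; lia.
Qed.

End Inner.

(** [raise] and [lower] are inverse bijections between the fibre of [shape] over [b] and the plane
    partitions on the inner cells. *)
Lemma pp_poly_step : pp_poly r c n.+1 =
  \sum_(b : {ffun 'I_n -> 'I_k} | interlacing a b)
    'X^(\sum_i b i) * pp_poly (pos_row (@inner_pos b)) (pos_col (@inner_pos b)) n.
Proof.
rewrite /pp_poly (partition_big shape (interlacing a)) => [|f]; last exact: strict_shape.
apply: eq_bigr => b ab; rewrite mulr_sumr.
rewrite (reindex_onto (@raise b) (lower ab)); last first.
  by move=> f /andP[/strict_supported sf /eqP fb]; apply: lowerK; rewrite -fb.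
apply: eq_big => [g|g _]; last by rewrite raise_sum // exprD.
rewrite raiseK eqxx andbT raise_strict //.
by rewrite (supported_shape ab (raise_supported g)) eqxx andbT.
Qed.

End Step.

(** The bound on the entries and the number of rows are both [n], and both drop by one when a layer
    is peeled off. *)
Lemma pp_poly_gt (I : finType) (pos : I -> nat * nat) n k a :
  diagram_pos pos n a ->
  (forall i, i.+1 < n -> a i <= a i.+1)%N -> (forall i, i < n -> a i < k)%N ->
  pp_poly (pos_row pos) (pos_col pos) n = gt_poly K k n a.
Proof.
elim: n I pos a => [|n IH] I pos a posI mono bnd.
  have I0 : #|I| = 0%N by rewrite (card_diagram_pos posI) big_ord0.
  have e (x : I) : false by have := fintype0 x I0.
  rewrite /pp_poly /= (big_pred1 (ffun0 I0)) ?big1 ?expr0 //.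
    by move=> x _; have := e x.
  move=> f; rewrite /= (_ : f = ffun0 I0) ?eqxx; last by apply/ffunP => x; have := e x.
  by apply/strictppP => x; have := e x.
rewrite (pp_poly_step posI mono bnd) /=; apply: eq_bigr => b ab.
congr (_ * _); apply: IH.
- exact: (inner_diagram posI ab).
- move=> i im; have im' := ltnW im.
  rewrite -[i in leqLHS]/(val (Ordinal im')) -[i.+1]/(val (Ordinal im)) !natfunE.
  have /andP[_ h1] := forallP ab (Ordinal im').
  by have /andP[h2 _] := forallP ab (Ordinal im); apply: leq_trans h1 h2.
- by move=> i im; rewrite -[i]/(val (Ordinal im)) natfunE.
Qed.

End StrictPlanePartitions.

(** * Descents and the major index *)

Section Rank.
Variables (T : finType) (lt : rel T).
Hypotheses (irr : irreflexive lt) (trans : transitive lt).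
Hypothesis total : forall x y, [|| lt x y, x == y | lt y x].

Lemma rank_subproof x : (#|[pred y | lt y x]| < #|T|)%N.
Proof.
by apply/proper_card/properP; split; [apply/fintype.subsetP | exists x; rewrite // inE irr].
Qed.

Definition rank : {ffun T -> 'I_#|T|} := [ffun x => Ordinal (rank_subproof x)].

Lemma rank_lt x y : lt x y -> (rank x < rank y)%N.
Proof.
move=> xy; rewrite !ffunE; apply/proper_card/properP; split.
  by apply/fintype.subsetP => z; rewrite !inE => /trans; apply.
by exists x; rewrite inE // irr.
Qed.

Lemma rank_ltE x y : (rank x < rank y)%N = lt x y.
Proof.
apply/idP/idP => [xy|]; last exact: rank_lt.
case/or3P: (total x y) => // [/eqP e|/rank_lt yx]; first by rewrite e ltnn in xy.
by have := ltn_trans xy yx; rewrite ltnn.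
Qed.

Lemma rank_inj : injective rank.
Proof.
move=> x y e; case/or3P: (total x y) => [|/eqP//|].
  by rewrite -rank_ltE e ltnn.
by rewrite -rank_ltE e ltnn.
Qed.

Lemma rank_unique (t : {ffun T -> 'I_#|T|}) :
  injective t -> (forall x y, (t x < t y)%N = lt x y) -> t = rank.
Proof.
move=> tinj tlt; apply/ffunP => x; apply: val_inj; rewrite ffunE /=.
have [g tK gK] := inj_card_bij tinj (eq_leq (card_ord _)).
transitivity (\sum_(i < #|T| | (i < t x)%N) 1)%N.
  by rewrite -(big_ord_widen _ (fun=> 1%N)) ?(ltnW (ltn_ord _)) // sum_nat_const card_ord muln1.
rewrite (reindex t) /=; last by exists g => y _; [apply: tK|apply: gK].
by rewrite -[RHS]sum1_card; apply: eq_bigl => y; rewrite inE tlt.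
Qed.

End Rank.

Section Congruence.
Variable K : fieldType.
Local Open Scope ring_scope.

(** Stands for equality of power series up to degree [n]: plane partitions with an entry at least
    [k] have weight at least [k], so bounding the entries by [k] is harmless modulo ['X^k]. *)
Definition eqmodX n (p q : {poly K}) := 'X^n %| p - q.

Lemma eqmodX_refl n p : eqmodX n p p.
Proof. by rewrite /eqmodX subrr dvdp0. Qed.

Lemma eqmodX_sym n p q : eqmodX n p q -> eqmodX n q p.
Proof. by rewrite /eqmodX -[q - p]opprB dvdpNr. Qed.

Lemma eqmodX_trans n q p r : eqmodX n p q -> eqmodX n q r -> eqmodX n p r.
Proof. by move=> h1 h2; rewrite /eqmodX -[p - r](subrKA q) dvdp_add. Qed.

Lemma eqmodXM n p1 q1 p2 q2 :
  eqmodX n p1 q1 -> eqmodX n p2 q2 -> eqmodX n (p1 * p2) (q1 * q2).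
Proof.
move=> h1 h2; rewrite /eqmodX (_ : _ - _ = (p1 - q1) * p2 + q1 * (p2 - q2)); last by ring.
by apply: dvdp_add; [exact: dvdp_mulr|exact: dvdp_mull].
Qed.

Lemma eqmodX_sum n I (s : seq I) (P : pred I) (F G : I -> {poly K}) :
  (forall i, P i -> eqmodX n (F i) (G i)) ->
  eqmodX n (\sum_(i <- s | P i) F i) (\sum_(i <- s | P i) G i).
Proof.
move=> h; rewrite /eqmodX -sumrB; elim/big_rec: _ => [|i p Pi IH]; first exact: dvdp0.
by apply: dvdp_add => //; apply: h.
Qed.

Lemma eqmodX_prod n I (s : seq I) (P : pred I) (F G : I -> {poly K}) :
  (forall i, P i -> eqmodX n (F i) (G i)) ->
  eqmodX n (\prod_(i <- s | P i) F i) (\prod_(i <- s | P i) G i).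
Proof.
by move=> h; elim/big_rec2: _ => [|i p q Pi IH]; [apply: eqmodX_refl|apply: eqmodXM => //; apply: h].
Qed.

Lemma eqmodX_Xn n m : (n <= m)%N -> eqmodX n 'X^m 0.
Proof. by move=> nm; rewrite /eqmodX subr0 dvdp_exp2l. Qed.

Lemma eqmodX_leq m n p q : (m <= n)%N -> eqmodX n p q -> eqmodX m p q.
Proof. by move=> mn; apply: dvdp_trans; apply: dvdp_exp2l. Qed.

Lemma eqmodX_eq p q : (forall n, eqmodX n p q) -> p = q.
Proof.
move=> h; apply/eqP; rewrite -subr_eq0; apply/negPn/negP => n0.
by have := dvdp_leq n0 (h (size (p - q))); rewrite size_polyXn ltnn.
Qed.

End Congruence.

(** * Decreasing sequences with prescribed strict drops *)

Section BoundedSequences.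
Variable K : fieldType.
Local Open Scope ring_scope.

Definition ffun_rcons n (A : Type) (g : {ffun 'I_n -> A}) (c : A) : {ffun 'I_n.+1 -> A} :=
  [ffun i => oapp g c (unlift ord_max i)].

Lemma ffun_rcons_max n A (g : {ffun 'I_n -> A}) c : ffun_rcons g c ord_max = c.
Proof. by rewrite ffunE unlift_none. Qed.

Lemma ffun_rcons_lift n A (g : {ffun 'I_n -> A}) c i : ffun_rcons g c (lift ord_max i) = g i.
Proof. by rewrite ffunE liftK. Qed.

Lemma big_ffun_rcons n (A : finType) (P : pred {ffun 'I_n.+1 -> A}) (F : {ffun 'I_n.+1 -> A} -> {poly K}) :
  \sum_(g | P g) F g = \sum_(c : A) \sum_(g | P (ffun_rcons g c)) F (ffun_rcons g c).
Proof.
rewrite pair_big_dep /= (reindex (fun p : A * {ffun 'I_n -> A} => ffun_rcons p.2 p.1)) //.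
exists (fun f : {ffun 'I_n.+1 -> A} => (f ord_max, [ffun i : 'I_n => f (lift ord_max i)])) => [[c g] _|f _] /=.
  by rewrite ffun_rcons_max; congr (_, _); apply/ffunP => i; rewrite ffunE ffun_rcons_lift.
apply/ffunP => i; case: (unliftP ord_max i) => [j ->|->].
  by rewrite ffun_rcons_lift ffunE.
by rewrite ffun_rcons_max.
Qed.

(** Weakly decreasing sequences bounded below by [a], with a strict drop from position [j - 1] to
    position [j] when [delta j]. Counting positions from 1, the drop occurs after position [j], as
    for a descent at [j]. *)
Definition des_compat (delta : pred nat) (a n k : nat) (g : {ffun 'I_n -> 'I_k}) :=
  [forall i, (a <= g i)%N] &&
  [forall i : 'I_n, forall j : 'I_n, (i.+1 == j :> nat) ==> (g j + delta j <= g i)%N].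

Definition des_poly (delta : pred nat) (a n k : nat) : {poly K} :=
  \sum_(g : {ffun 'I_n -> 'I_k} | des_compat delta a g) 'X^(\sum_i g i).

Lemma des_compat_nonincr delta a n k (g : {ffun 'I_n -> 'I_k}) : des_compat delta a g ->
  forall i j : 'I_n, (i <= j)%N -> (g j <= g i)%N.
Proof.
move=> /andP[_ /forallP h] i j; case: j => j jn /=; elim: j jn => [|j IH] jn.
  by rewrite leqn0 => /eqP i0; apply: eq_leq; congr (nat_of_ord (g _)); apply: val_inj.
rewrite leq_eqVlt => /predU1P[e|]; first by apply: eq_leq; congr (nat_of_ord (g _)); apply: val_inj.
rewrite ltnS => ij; apply: leq_trans (IH (ltnW jn) ij).
have := forallP (h (Ordinal (ltnW jn))) (Ordinal jn); rewrite /= eqxx /=.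
exact/leq_trans/leq_addr.
Qed.

Lemma des_compat_rcons delta a n k (g : {ffun 'I_n -> 'I_k}) c :
  des_compat delta a (ffun_rcons g c) = (a <= c)%N && des_compat delta (c + delta n) g.
Proof.
apply/idP/andP => [h|[ac /andP[/forallP h1 /forallP h2]]]; last first.
  apply/andP; split.
    apply/forallP => i; case: (unliftP ord_max i) => [j ->|->].
      by rewrite ffun_rcons_lift; apply: leq_trans ac (leq_trans (leq_addr _ _) (h1 j)).
    by rewrite ffun_rcons_max.
  apply/forallP => i; apply/forallP => j; apply/implyP => /eqP.
  case: (unliftP ord_max j) => [j' ->|->]; case: (unliftP ord_max i) => [i' ->|->].
  - rewrite !ffun_rcons_lift !lift_max => e; have := forallP (h2 i') j'.
    by rewrite e eqxx.
  - by rewrite lift_max; case: j' => j' /= hj e; lia.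
  - by rewrite ffun_rcons_lift ffun_rcons_max.
  - by move=> /=; lia.
have mono := des_compat_nonincr h; case/andP: h => /forallP h1 /forallP h2.
have ac : (a <= c)%N by have := h1 ord_max; rewrite ffun_rcons_max.
split=> //; apply/andP; split.
  apply/forallP => i; case: n => [|n] in g h1 h2 mono i *; first by case: i.
  have := forallP (h2 (lift ord_max (ord_max : 'I_n.+1))) ord_max.
  rewrite lift_max eqxx ffun_rcons_max ffun_rcons_lift /= => /leq_trans; apply.
  have := mono (lift ord_max i) (lift ord_max ord_max).
  by rewrite !lift_max !ffun_rcons_lift; apply; rewrite -ltnS.
apply/forallP => i; apply/forallP => j; have := forallP (h2 (lift ord_max i)) (lift ord_max j).
by rewrite !ffun_rcons_lift !lift_max.
Qed.

(** The last entry [c] is peeled off: the others form a sequence bounded below by [c + delta n], and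
    the sum over [c] is geometric of ratio ['X^(n.+1)]. A drop before the last position raises the
    [n] preceding entries, whence its contribution [n] to the major index. *)
Lemma des_polyE delta a n k :
  eqmodX k (des_poly delta a n k * \prod_(i < n) (1 - 'X^(i.+1)))
           'X^(a * n + \sum_(1 <= j < n | delta j) j).
Proof.
elim: n a => [|n IH] a.
  rewrite big_geq // big_ord0 mulr1 muln0 /des_poly.
  have I0 : #|'I_0| = 0%N by rewrite card_ord.
  rewrite (big_pred1 (ffun0 I0)); first by rewrite big_ord0 eqmodX_refl.
  move=> g; rewrite /= (_ : g = ffun0 I0) ?eqxx; last by apply/ffunP; case.
  by apply/andP; split; apply/forallP; case.
rewrite /des_poly big_ffun_rcons big_ord_recr /=.
pose e := (delta n * n + \sum_(1 <= j < n | delta j) j)%N.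
have -> : (\sum_(1 <= j < n.+1 | delta j) j = e)%N.
  rewrite /e; case: (n) => [|m]; first by rewrite !big_geq ?muln0.
  by rewrite big_mkcond big_nat_recr //= -big_mkcond /= addnC; case: (delta _); rewrite ?mul1n.
pose S : {poly K} := (\sum_(c < k | (a <= c)%N) 'X^(c * n.+1 + e)) * (1 - 'X^(n.+1)).
apply: (@eqmodX_trans _ _ S); rewrite /S.
  rewrite mulrA; apply: eqmodXM (eqmodX_refl _ _).
  rewrite [X in eqmodX _ _ X]big_mkcond mulr_suml; apply: eqmodX_sum => c _.
  case: ifPn => ac; last first.
    rewrite big_pred0 ?mul0r ?eqmodX_refl // => g.
    by rewrite des_compat_rcons (negbTE ac).
  rewrite (eq_bigr (fun g : {ffun 'I_n -> 'I_k} => 'X^c * 'X^(\sum_i g i))); last first.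
    move=> g _; rewrite -exprD big_ord_recr ffun_rcons_max addnC; congr ('X^(_ + _)).
    apply: eq_bigr => i _; rewrite -[widen_ord _ i](_ : lift ord_max i = _) ?ffun_rcons_lift //.
    by apply: ord_inj; rewrite lift_max.
  rewrite -mulr_sumr -mulrA.
  have -> : (c * n.+1 + e = c + ((c + delta n) * n + \sum_(1 <= j < n | delta j) j))%N.
    by rewrite /e mulnS mulnDl !addnA.
  rewrite exprD; apply: eqmodXM (eqmodX_refl _ _) _.
  rewrite (eq_bigl (fun g : {ffun _} => des_compat delta (c + delta n) g)); first exact: IH.
  by move=> g; rewrite des_compat_rcons ac.
(* For [a > k] no sequence is left and the right-hand side vanishes modulo ['X^k]; otherwise the sum
   telescopes, with an error ['X^(k * n.+1)]. *)
have [ak|ka] := leqP a k; last first.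
  rewrite big_pred0 ?mul0r; last by move=> c; have := ltn_ord c; lia.
  by apply/eqmodX_sym/eqmodX_Xn; nia.
under eq_bigr do rewrite exprD.
rewrite -mulr_suml mulrAC exprD; apply: eqmodXM (eqmodX_refl _ _).
rewrite -opprB mulrN.
have -> : \sum_(c < k | (a <= c)%N) 'X^(c * n.+1) = \sum_(a <= c < k) 'X^(c * n.+1) :> {poly K}.
  by rewrite (big_nat_widenl _ 0%N) // big_mkord.
rewrite telescope_geom // opprB /eqmodX addrAC subrr add0r dvdpNr dvdp_exp2l //.
by rewrite leq_pmulr.
Qed.

End BoundedSequences.

Section DisjointUnion.
Variable K : fieldType.
Local Open Scope ring_scope.

Lemma pp_poly_union (I I1 I2 : finType) (r c : rel I) (r1 c1 : rel I1) (r2 c2 : rel I2)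
    (h : I1 + I2 -> I) n :
  bijective h ->
  (forall x y, r (h (inl x)) (h (inl y)) = r1 x y) ->
  (forall x y, c (h (inl x)) (h (inl y)) = c1 x y) ->
  (forall x y, r (h (inr x)) (h (inr y)) = r2 x y) ->
  (forall x y, c (h (inr x)) (h (inr y)) = c2 x y) ->
  (forall x y, [|| r (h (inl x)) (h (inr y)), c (h (inl x)) (h (inr y)),
                   r (h (inr y)) (h (inl x)) | c (h (inr y)) (h (inl x))] = false) ->
  pp_poly K r c n = pp_poly K r1 c1 n * pp_poly K r2 c2 n.
Proof.
move=> [g hK gK] hr1 hc1 hr2 hc2 hx.
pose glue (p : {ffun I1 -> 'I_n} * {ffun I2 -> 'I_n}) : {ffun I -> 'I_n} :=
  [ffun x => match g x with inl y => p.1 y | inr y => p.2 y end].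
have gl p x : glue p (h (inl x)) = p.1 x by rewrite ffunE hK.
have gr p x : glue p (h (inr x)) = p.2 x by rewrite ffunE hK.
rewrite /pp_poly big_distrlr /= pair_big_dep /= (reindex glue) /=; last first.
  exists (fun f : {ffun I -> 'I_n} => ([ffun x => f (h (inl x))] : {ffun I1 -> 'I_n},
                    [ffun x => f (h (inr x))] : {ffun I2 -> 'I_n})).
    by move=> [f1 f2] _; congr (_, _); apply/ffunP => x; rewrite ffunE ?gl ?gr.
  move=> f _; apply/ffunP => x; rewrite -[x]gK.
  by case: (g x) => y; rewrite ?gl ?gr ffunE.
apply: eq_big => [p|p _]; last first.
  rewrite -exprD (reindex h) /=; last by exists g => y _; [apply: hK|apply: gK].
  by rewrite big_sumType /=; congr ('X^(_ + _)); apply: eq_bigr => y _; rewrite ?gl ?gr.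
apply/strictppP/andP => [st|[/strictppP st1 /strictppP st2] x y].
  split; apply/strictppP => x y.
    by have := st (h (inl x)) (h (inl y)); rewrite hr1 hc1 !gl.
  by have := st (h (inr x)) (h (inr y)); rewrite hr2 hc2 !gr.
rewrite -[x]gK -[y]gK; case: (g x) => x'; case: (g y) => y'.
- by rewrite hr1 hc1 !gl; apply: st1.
- case/negbT/norP: (hx x' y') => n1 /norP[n2 _].
  by split=> e; [case/negP: n1|case/negP: n2].
- case/negbT/norP: (hx y' x') => _ /norP[_ /norP[n1 n2]].
  by split=> e; [case/negP: n1|case/negP: n2].
- by rewrite hr2 hc2 !gr; apply: st2.
Qed.

Lemma eq_pp_poly (I : finType) (r r' c c' : rel I) n :
  (forall x y, r x y = r' x y) -> (forall x y, c x y = c' x y) ->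
  pp_poly K r c n = pp_poly K r' c' n.
Proof.
move=> er ec; apply: eq_bigl => f; apply/strictppP/strictppP => st x y.
  by rewrite -er -ec; apply: st.
by rewrite er ec; apply: st.
Qed.

Lemma pp_poly_empty (I : finType) (r c : rel I) n : #|I| = 0%N -> pp_poly K r c n = 1.
Proof.
move=> I0; have e (x : I) : false by have := fintype0 x I0.
rewrite /pp_poly (big_pred1 (ffun0 I0)) ?big1 ?expr0 //; first by move=> x; have := e x.
move=> f; rewrite /= (_ : f = ffun0 I0) ?eqxx; last by apply/ffunP => x; have := e x.
by apply/strictppP => x; have := e x.
Qed.

End DisjointUnion.

Section CellRelations.
Variable D : seq (nat * nat).

Definition left_of : rel (cell D) :=
  fun x y => (row_of x == row_of y) && (col_of x < col_of y)%N.
Definition above : rel (cell D) :=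
  fun x y => (col_of x == col_of y) && (row_of x < row_of y)%N.

End CellRelations.

(** * Plane partitions on block diagonal shapes *)

Section SkewShapes.
Variable K : fieldType.
Local Open Scope ring_scope.

Lemma head_ge_nth (p : intpart) i : (nth 0 p i <= head 0 p)%N.
Proof.
case: p => p /= /andP[sp _]; case: p sp => [|a p] /=; first by rewrite nth_nil.
case: i => [//|i] sp /=; case: (ltnP i (size p)) => ip; last by rewrite nth_default.
move: sp; rewrite path_sortedE; last by move=> x y z h1 h2; apply: leq_trans h2 h1.
by case/andP => /allP h _; apply: h; rewrite mem_nth.
Qed.

Lemma diagramP (p : seq nat) r c : reflect (r < size p /\ c < nth 0 p r)%N ((r, c) \in diagram p).
Proof.
apply: (iffP allpairsPdep) => [[r' [c' []]]|[rp cp]].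
  by rewrite !mem_iota !add0n => /andP[_ h1] /andP[_ h2] [-> ->].
by exists r, c; rewrite !mem_iota !add0n.
Qed.

Lemma skew_cells_col (l : block_skew) x :
  x \in skew_cells l -> (x.2 < \sum_(q <- l) head 0%N q)%N.
Proof.
elim: l x => // p l IH x; rewrite big_cons /= mem_cat => /orP[]/mapP[[r c] h ->] /=.
  by case/diagramP: h => _ /leq_trans/(_ (head_ge_nth _ _)); rewrite ltn_add2r.
by have := IH _ h; rewrite /= addn0; lia.
Qed.

Lemma uniq_diagram (p : seq nat) : uniq (diagram p).
Proof. by rewrite /diagram allpairs_uniq_dep ?iota_uniq// => [? _|[? ?] [? ?] _ _ [-> ->]//]; exact: iota_uniq. Qed.

Lemma pp_poly_skew (l : block_skew) n :
  pp_poly K (@left_of (skew_cells l)) (@above (skew_cells l)) n =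
  \prod_(p <- l) pp_poly K (@left_of (diagram p)) (@above (diagram p)) n.
Proof.
elim: l => [|p l IH].
  by rewrite big_nil; apply: pp_poly_empty; rewrite card_cells /block_size big_nil.
rewrite big_cons -IH.
set w := (\sum_(q <- l) head 0 q)%N.
have h1 (x : cell (diagram p)) : shift_cell 0 w (val x) \in skew_cells (p :: l).
  by rewrite /= mem_cat; apply/orP; left; apply: map_f; exact: valP.
have h2 (x : cell (skew_cells l)) : shift_cell (size p) 0 (val x) \in skew_cells (p :: l).
  by rewrite /= mem_cat; apply/orP; right; apply: map_f; exact: valP.
pose h (s : cell (diagram p) + cell (skew_cells l)) : cell (skew_cells (p :: l)) :=
  match s with inl x => SeqSub (h1 x) | inr x => SeqSub (h2 x) end.
have row1 (x : cell (diagram p)) : ((val x).1 < size p)%N by apply: diagram_row (valP x).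
have col2 (x : cell (skew_cells l)) : ((val x).2 < w)%N by apply: skew_cells_col (valP x).
apply: (@pp_poly_union _ _ _ _ _ _ _ _ _ _ h).
- apply: inj_card_bij; last first.
    rewrite card_sum !card_cells /block_size big_cons card_seq_sub ?uniq_diagram // size_diagram.
    by rewrite leqnn.
  move=> [x|x] [y|y] /(congr1 val) /= [] e1 e2.
  + case: x y e1 e2 => [[r c] m] [[r' c'] m'] /= e1 e2.
    by congr inl; apply: val_inj => /=; congr (_, _); lia.
  + by case: x y e1 e2 => [[r c] m] [[r' c'] m'] /=; have /= := row1 (SeqSub m); lia.
  + by case: x y e1 e2 => [[r c] m] [[r' c'] m'] /=; have /= := row1 (SeqSub m'); lia.
  + case: x y e1 e2 => [[r c] m] [[r' c'] m'] /= e1 e2.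
    by congr inr; apply: val_inj => /=; congr (_, _); lia.
- by move=> x y; rewrite /left_of /row_of /col_of /= !addn0 ltn_add2r.
- by move=> x y; rewrite /above /row_of /col_of /= !addn0 eqn_add2r.
- by move=> x y; rewrite /left_of /row_of /col_of /= !addn0 eqn_add2r.
- by move=> x y; rewrite /above /row_of /col_of /= !addn0 ltn_add2r.
- move=> [[r c] m] [[r' c'] m']; rewrite /above /left_of /row_of /col_of /= !addn0.
  by have /= := row1 (SeqSub m); have /= := col2 (SeqSub m'); lia.
Qed.

(** Row lengths from the bottom. The default value of [nth] adds empty rows below until there are
    [n], so that the number of rows equals the bound on the entries. *)
Definition bottom_rows (p : seq nat) n i := nth 0%N p (n.-1 - i).

Lemma rows_upto_bottom (p : seq nat) n : (size p <= n)%N ->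
  rows_upto n (bottom_rows p n) = p ++ nseq (n - size p) 0%N.
Proof.
move=> pn; apply: (@eq_from_nth _ 0%N).
  by rewrite size_rev size_mkseq size_cat size_nseq subnKC.
rewrite size_rev size_mkseq => i im; rewrite nth_rev size_mkseq // nth_mkseq; last by lia.
rewrite /bottom_rows nth_cat nth_nseq if_same (_ : n.-1 - (n - i.+1) = i)%N; last by lia.
by case: ltnP => // h; rewrite nth_default.
Qed.

Lemma diagram_pos_bottom (p : seq nat) n : (size p <= n)%N ->
  diagram_pos (fun x : cell (diagram p) => ((n.-1 - (val x).1)%N, (val x).2)) n (bottom_rows p n).
Proof.
move=> pn; split.
- move=> [[r c] m] [[r' c'] m'] /= [e1 e2]; apply: val_inj => /=.
  have /= := diagram_row m; have /= := diagram_row m'.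
  by move=> h h'; congr (_, _); lia.
- move=> x /=; have := valP x; rewrite [val x]surjective_pairing => /diagramP[h1 h2] /=.
  rewrite /bottom_rows (_ : n.-1 - (n.-1 - (val x).1) = (val x).1)%N ?h2 ?andbT; lia.
- move=> r c rn cp; have h : (n.-1 - r, c)%N \in diagram p.
    apply/diagramP; split=> //; rewrite ltnNge; apply/negP => h.
    by move: cp; rewrite /bottom_rows nth_default.
  by exists (SeqSub h) => /=; congr (_, _); lia.
Qed.

(** Macdonald's n(lambda), the least weight of a strict plane partition of this shape. *)
Definition partition_stat (p : seq nat) : nat := (\sum_(r < size p) r * nth 0 p r)%N.

Lemma sum_bottom_rows (p : seq nat) n : (size p <= n)%N ->
  (\sum_(j < n) \sum_(i < j) bottom_rows p n i = partition_stat p)%N.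
Proof.
move=> pn.
transitivity (\sum_(i < n) \sum_(j < n | i < j) bottom_rows p n i)%N.
  rewrite [RHS](exchange_big_dep xpredT) //=; apply: eq_bigr => j _.
  by rewrite (big_ord_widen n (bottom_rows p n)) ?(ltnW (ltn_ord j)).
transitivity (\sum_(i < n) (n.-1 - i) * bottom_rows p n i)%N.
  apply: eq_bigr => i _; rewrite sum_nat_const; congr (_ * _)%N.
  rewrite -sum1_card -(big_mkord (fun j => i < j)%N (fun=> 1%N)).
  rewrite -(big_nat_widenl _ _ _ xpredT) ?sum_nat_const_nat ?muln1; last by [].
  by have := ltn_ord i; lia.
rewrite (reindex_inj rev_ord_inj) /= /partition_stat.
rewrite (big_ord_widen n (fun r => r * nth 0 p r)%N pn) [RHS]big_mkcond.
apply: eq_bigr => i _; rewrite /bottom_rows (_ : n.-1 - (n - i.+1) = i)%N; last first.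
  by have := ltn_ord i; lia.
by case: ltnP => // h; rewrite nth_default ?muln0.
Qed.

Lemma pp_poly_diagram (p : intpart) n : (size p <= n)%N ->
  pp_poly K (@left_of (diagram p)) (@above (diagram p)) n *
  \prod_(h <- hooks p) ('X^h - 1) =
  'X^(partition_stat p) *
  \prod_(j < n) \prod_(i < bottom_rows p n j) ('X^((j + i).+1) - 1).
Proof.
move=> pn; have dp := diagram_pos_bottom pn.
have mono i : (i.+1 < n -> bottom_rows p n i <= bottom_rows p n i.+1)%N.
  move=> im; rewrite /bottom_rows; case: p {pn dp} => p /= /andP[sp _].
  case: (ltnP (n.-1 - i) (size p)) => h; last by rewrite nth_default.
  have := @sorted_leq_nth _ geq _ _ 0%N p sp (n.-1 - i.+1)%N (n.-1 - i)%N; apply.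
  - by move=> x y z h1 h2; apply: leq_trans h2 h1.
  - exact: leqnn.
  - by rewrite inE; lia.
  - by rewrite inE.
  - lia.
have bnd i : (i < n -> bottom_rows p n i < (head 0 p).+1)%N.
  by move=> _; rewrite ltnS head_ge_nth.
rewrite -(sum_bottom_rows pn) -(gt_poly_hooks K mono bnd) rows_upto_bottom //.
rewrite hooks_nseq0 -(pp_poly_gt K dp mono bnd); congr (_ * _).
apply: eq_pp_poly => -[[r c] m] [[r' c'] m'];
  rewrite /left_of /above /pos_row /pos_col /row_of /col_of /=;
  by have /= := diagram_row m; have /= := diagram_row m'; lia.
Qed.

(** With at least [m] empty rows below, nonempty rows have height [j >= m], so every exponent of the
    hook-content product exceeds [m] and its factor is congruent to -1. There is one sign per cell,
    as for the hooks. *)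
Lemma pp_poly_diagram_mod (p : intpart) n m : (size p + m <= n)%N ->
  eqmodX m (pp_poly K (@left_of (diagram p)) (@above (diagram p)) n *
            \prod_(h <- hooks p) (1 - 'X^h))
           'X^(partition_stat p).
Proof.
move=> pn; have pn' : (size p <= n)%N by lia.
have flip s : \prod_(h <- s) (1 - 'X^h) = (-1) ^+ size s * \prod_(h <- s) ('X^h - 1) :> {poly K}.
  elim: s => [|h s IH]; first by rewrite !big_nil mulr1.
  by rewrite !big_cons IH /= exprS; ring.
rewrite flip mulrCA pp_poly_diagram // size_hooks.
rewrite mulrCA -[X in eqmodX _ _ X]mulr1; apply: eqmodXM (eqmodX_refl _ _) _.
have -> : sumn p = (\sum_(j < n) bottom_rows p n j)%N.
  by rewrite -(card_diagram_pos (diagram_pos_bottom pn')) card_seq_sub ?uniq_diagram // size_diagram.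
apply: (@eqmodX_trans _ _ ((-1) ^+ (\sum_(j < n) bottom_rows p n j) *
    \prod_(j < n) \prod_(i < bottom_rows p n j) (-1))); last first.
  under [X in _ * X]eq_bigr do rewrite big_const_ord iter_mulr mulr1.
  by rewrite -expr_sum -exprD addnn -mul2n exprM sqrrN expr1n expr1n eqmodX_refl.
apply: eqmodXM (eqmodX_refl _ _) _; apply: eqmodX_prod => j _; apply: eqmodX_prod => i _.
rewrite /eqmodX opprK subrK dvdp_exp2l //.
have /= := ltn_ord i; rewrite /bottom_rows => h.
case: (ltnP (n.-1 - j) (size p)) => h'; first lia.
by have := nth_default 0%N h'; move: h; lia.
Qed.

End SkewShapes.

(** * The generating function of the major index *)

Section StandardTableaux.
Variable K : fieldType.
Variable D : seq (nat * nat).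
Local Open Scope ring_scope.
Let n := #|{: cell D}|.

(* Order of the cells by decreasing value, ties (which form a horizontal strip)
   being broken from left to right, so that no descent occurs within a tie. *)
Definition pp_before (f : cell D -> nat) : rel (cell D) := fun x y =>
  (f y < f x)%N || (f x == f y) &&
  ((row_of y < row_of x)%N || (row_of x == row_of y) && (col_of x < col_of y)%N).

Lemma pp_before_irr f : irreflexive (pp_before f).
Proof. by move=> x; rewrite /pp_before !ltnn !eqxx. Qed.

Lemma pp_before_trans f : transitive (pp_before f).
Proof. by move=> y x z; rewrite /pp_before; lia. Qed.

Lemma pp_before_total f x y : [|| pp_before f x y, x == y | pp_before f y x].
Proof.
rewrite /pp_before; case: (ltngtP (f x) (f y)) => //= fxy; rewrite ?orbT //.
case: (ltngtP (row_of x) (row_of y)) => //= xy; rewrite ?orbT//.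
case: (ltngtP (col_of x) (col_of y)) => //= xy'; rewrite ?orbT//.
by rewrite orbF; apply/eqP/val_inj/injective_projections.
Qed.

Definition standardization k (f : {ffun cell D -> 'I_k}) : filling D :=
  rank (@pp_before_irr (fun x => f x)).

Lemma standardization_lt k (f : {ffun cell D -> 'I_k}) x y :
  (standardization f x < standardization f y)%N = pp_before (fun x => f x) x y.
Proof. by apply: rank_ltE; [exact: pp_before_trans|exact: pp_before_total]. Qed.

Lemma standardization_syt k (f : {ffun cell D -> 'I_k}) :
  strictpp (@left_of D) (@above D) f -> is_syt (standardization f).
Proof.
move=> /strictppP st; apply/and3P; split.
- by apply/injectiveP/rank_inj; [exact: pp_before_trans|exact: pp_before_total].
- apply/forallP => x; apply/forallP => y; apply/implyP => xy.
  have [/(_ xy) h _] := st x y; rewrite standardization_lt /pp_before.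
  case/andP: xy => /eqP -> ->; rewrite eqxx orbT andbT eq_sym orbC.
  by rewrite -leq_eqVlt.
- apply/forallP => x; apply/forallP => y; apply/implyP => xy.
  by have [_ /(_ xy) h] := st x y; rewrite standardization_lt /pp_before h.
Qed.

Section OneTableau.
Variables (T : SYT D) (k : nat).

Let Tinj : injective (val T).
Proof. by case/and3P: (valP T) => /injectiveP. Qed.

Let t (x : cell D) : nat := val T x.

Let t_inj x y : t x = t y -> x = y.
Proof. by move=> e; apply/Tinj/val_inj. Qed.

Let t_lt x : (t x < n)%N.
Proof. exact: ltn_ord. Qed.

Let Trow x y : left_of x y -> (t x < t y)%N.
Proof.
by case/and3P: (valP T) => _ /forallP/(_ x)/forallP/(_ y)/implyP h _; exact: h.
Qed.

Let Tcol x y : above x y -> (t x < t y)%N.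
Proof.
by case/and3P: (valP T) => _ _ /forallP/(_ x)/forallP/(_ y)/implyP h; exact: h.
Qed.

Let Tsurj i : (i < n)%N -> exists x, t x = i.
Proof.
move=> i_n; have [g _ gK] := inj_card_bij Tinj (eq_leq (card_ord _)).
by exists (g (Ordinal i_n)); rewrite /t gK.
Qed.

Let is_descentE x y : t y = (t x).+1 -> is_descent T (t y) = (row_of x < row_of y)%N.
Proof.
move=> e; apply/existsP/idP => [[x' /existsP[y' /and3P[/eqP e1 /eqP e2 h]]]|h].
  have -> : x = x' by apply: t_inj; move: e1; rewrite e => -[].
  by have -> : y = y' by apply: t_inj; move: e2 => -[].
by exists x; apply/existsP; exists y; rewrite /entry -/(t x) -/(t y) e !eqxx.
Qed.

Let h (g : {ffun 'I_n -> 'I_k}) : {ffun cell D -> 'I_k} := [ffun x => g (val T x)].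

Let hE g x : h g x = g (val T x).
Proof. by rewrite ffunE. Qed.

(** Within a run of equal values no step is a descent, so the rows can only go up; the induction is
    on the distance between the two entries. *)
Let compat_row g : des_compat (is_descent T) 0 g -> forall x y,
  (t x <= t y)%N -> (h g y <= h g x)%N /\
    (h g y = h g x -> (row_of y <= row_of x)%N).
Proof.
move=> cg x y xy; have mono x' y' : (t x' <= t y')%N -> (h g y' <= h g x')%N.
  by rewrite !hE; apply: des_compat_nonincr cg _ _.
split; first exact: mono.
move: {2}(t y - t x)%N (erefl (t y - t x)%N) => d.
elim: d y xy => [|d IH] y xy exy.
  by rewrite (_ : x = y) //; apply: t_inj; lia.
have yn := t_lt y.
have [|z ez] := @Tsurj (t y).-1; first by lia.
have zy : t y = (t z).+1 by lia.
have xz : (t x <= t z)%N by lia.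
move=> e; have h1 := mono _ _ xz.
have h2 : (h g y + (row_of z < row_of y) <= h g z)%N.
  case/andP: cg => _ /forallP/(_ (val T z))/forallP/(_ (val T y)).
  by rewrite -/(t y) -/(t z) (is_descentE zy) zy eqxx /= !hE.
have ezx : h g z = h g x.
  by apply: val_inj => /=; move: (congr1 val e) => /= e'; lia.
have dz : (t z - t x)%N = d by lia.
have {}IH := IH _ xz dz ezx.
case: ltnP h2 => h3 h2; last exact: leq_trans h3 IH.
by move: (congr1 val e) => /= e'; lia.
Qed.

(** MacMahon's correspondence for one tableau: a sequence that drops at the descents of [T], written
    on the cells in the order of their entries, is a strict plane partition whose cells, sorted by
    value, give back [T]. *)
Lemma des_compat_standardization g :
  des_compat (is_descent T) 0 g =
  strictpp (@left_of D) (@above D) (h g) && (standardization (h g) == val T).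
Proof.
apply/idP/andP => [cg|[/strictppP st /eqP sT]].
  have lt x y : (t x < t y)%N -> pp_before (fun x => h g x) x y.
    move=> xy; have [h1 h2] := compat_row cg (ltnW xy).
    rewrite /pp_before /=; case: ltngtP h1 => //= e _.
    have {}h2 : (row_of y <= row_of x)%N by apply: h2; apply: val_inj.
    case: ltngtP h2 => //= er _.
    case: ltngtP => // ec.
      by have := @Trow y x; rewrite /left_of er eqxx ec => /(_ isT); lia.
    by move: xy; rewrite (_ : x = y) ?ltnn //; apply/val_inj/injective_projections.
  split.
    apply/strictppP => x y; split=> [xy|xy].
      by have [] := compat_row cg (ltnW (Trow xy)).
    have [h1 h2] := compat_row cg (ltnW (Tcol xy)).
    rewrite ltn_neqAle h1 andbT; apply/negP => /eqP e.
    have := h2 (val_inj e); move: xy; rewrite /above; lia.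
  rewrite eq_sym; apply/eqP/rank_unique => //.
  - move=> x y; rewrite -/(t x) -/(t y); apply/idP/idP => [/lt//|xy].
    rewrite ltnNge; apply/negP; rewrite leq_eqVlt => /predU1P[/t_inj e|/lt yx].
      by rewrite e pp_before_irr in xy.
    by have := pp_before_trans xy yx; rewrite pp_before_irr.
apply/andP; split; first by apply/forallP.
apply/forallP => i; apply/forallP => j; apply/implyP => /eqP ij.
have [x ex] := Tsurj (ltn_ord i); have [y ey] := Tsurj (ltn_ord j).
have {}ex : i = val T x by apply: val_inj.
have {}ey : j = val T y by apply: val_inj.
have yx : t y = (t x).+1 by rewrite /t -ex -ey ij.
rewrite ey ex -/(t y) (is_descentE yx) -!hE.
have : pp_before (fun x => h g x) x y by rewrite -standardization_lt sT -/(t x) -/(t y) yx.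
by rewrite /pp_before; lia.
Qed.

Lemma des_poly_standardization :
  des_poly K (is_descent T) 0 n k =
  \sum_(f : {ffun cell D -> 'I_k} |
         strictpp (@left_of D) (@above D) f && (standardization f == val T))
     'X^(\sum_x f x).
Proof.
have [g Tg gT] := inj_card_bij Tinj (eq_leq (card_ord _)).
rewrite [RHS](reindex h) /=; last first.
  exists (fun f : {ffun cell D -> 'I_k} => [ffun i => f (g i)]) => f _;
    by apply/ffunP => x; rewrite !ffunE ?gT ?Tg.
apply: eq_big => [f|f _]; first exact: des_compat_standardization.
rewrite (reindex (val T)) /=; last by exists g => x _; [apply: Tg|apply: gT].
by congr 'X^_; apply: eq_bigr => x _; rewrite ffunE.
Qed.

End OneTableau.

Lemma pp_poly_syt k :
  pp_poly K (@left_of D) (@above D) k = \sum_(T : SYT D) des_poly K (is_descent T) 0 n k.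
Proof.
under eq_bigr do rewrite des_poly_standardization.
rewrite /pp_poly (partition_big (fun f : {ffun cell D -> 'I_k} => standardization f : filling D) (@is_syt D)) /=; last first.
  by move=> f; apply: standardization_syt.
rewrite (reindex_omap (val : SYT D -> filling D) insub) /=; last first.
  by move=> t tP; rewrite insubT.
by apply: eq_bigl => T; rewrite valK eqxx andbT; apply: valP.
Qed.

Definition maj_poly : {poly K} := \sum_(T : SYT D) 'X^(maj T).

Lemma pp_poly_maj k :
  eqmodX k (pp_poly K (@left_of D) (@above D) k * \prod_(i < n) (1 - 'X^(i.+1))) maj_poly.
Proof.
rewrite pp_poly_syt mulr_suml; apply: eqmodX_sum => T _.
by have := @des_polyE K (is_descent T) 0 n k; rewrite mul0n add0n.
Qed.

End StandardTableaux.

Section MajGeneratingFunction.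
Variable K : fieldType.
Local Open Scope ring_scope.

Definition block_hooks (l : block_skew) : seq nat := flatten [seq hooks p | p : intpart <- l].

Definition block_stat (l : block_skew) : nat := (\sum_(p <- l) partition_stat p)%N.

(** The count [A] of plane partitions, multiplied by both products, is evaluated in two ways modulo
    ['X^m]: summing over tableaux absorbs the product over [1, ..., n], and the hook formula absorbs
    the product over the hooks. *)
Lemma maj_poly_hooks_sub (l : block_skew) :
  maj_poly K (skew_cells l) * \prod_(h <- block_hooks l) (1 - 'X^h) =
  'X^(block_stat l) * \prod_(i < block_size l) (1 - 'X^(i.+1)).
Proof.
(* This [k] leaves room for at least [m] empty rows under every block. *)
apply: eqmodX_eq => m; pose k := (\sum_(p <- l) size p + m)%N.
have mk : (m <= k)%N by rewrite leq_addl.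
pose A := pp_poly K (@left_of (skew_cells l)) (@above (skew_cells l)) k.
pose Q := \prod_(i < block_size l) (1 - 'X^(i.+1)) : {poly K}.
have h1 : eqmodX m (A * Q) (maj_poly K (skew_cells l)).
  by apply: (eqmodX_leq mk); have := pp_poly_maj K (skew_cells l) k; rewrite card_cells.
have h2 : eqmodX m (A * \prod_(h <- block_hooks l) (1 - 'X^h)) 'X^(block_stat l).
  rewrite /A pp_poly_skew /block_hooks /block_stat expr_sum big_flatten big_map -big_split /=.
  move: (leqnn k); rewrite {1}/k; elim: (l) => [|p l' IH] h.
    by rewrite !big_nil eqmodX_refl.
  rewrite !big_cons in h *; apply: eqmodXM; last by apply: IH; lia.
  by apply: pp_poly_diagram_mod; lia.
apply: eqmodX_trans (eqmodXM (eqmodX_sym h1) (eqmodX_refl _ _)) _.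
by rewrite mulrAC; apply: eqmodXM (eqmodX_refl _ _).
Qed.

Definition qnum (h : nat) : {poly K} := \sum_(i < h) 'X^i.

Lemma qnumE h : 1 - 'X^h = (1 - 'X) * qnum h.
Proof. by rewrite -[in LHS](expr1n _ h) subrXX; congr (_ * _); apply: eq_bigr => i _; rewrite expr1n mul1r. Qed.

Lemma size_block_hooks l : size (block_hooks l) = block_size l.
Proof.
rewrite /block_hooks /block_size size_flatten sumnE big_map big_map.
by apply: eq_bigr => p _; rewrite size_hooks.
Qed.

(** Each side has [n] factors [1 - 'X^h], one per cell, so [(1 - 'X) ^+ n] cancels. The q-numbers
    left do not vanish at 1, where masses and moments are read off. *)
Lemma maj_poly_hooks (l : block_skew) :
  maj_poly K (skew_cells l) * \prod_(h <- block_hooks l) qnum h =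
  'X^(block_stat l) * \prod_(1 <= i < (block_size l).+1) qnum i.
Proof.
have nz : (1 - 'X) ^+ block_size l != 0 :> {poly K}.
  by rewrite expf_neq0 // -opprB oppr_eq0 polyXsubC_eq0.
have e1 : \prod_(h <- block_hooks l) (1 - 'X^h) =
    (1 - 'X) ^+ block_size l * \prod_(h <- block_hooks l) qnum h.
  under eq_bigr do rewrite qnumE.
  by rewrite big_split /= big_const_seq iter_mulr mulr1 count_predT size_block_hooks.
have e2 : \prod_(i < block_size l) (1 - 'X^(i.+1)) =
    (1 - 'X) ^+ block_size l * \prod_(1 <= i < (block_size l).+1) qnum i :> {poly K}.
  rewrite (eq_bigr (fun i : 'I_(block_size l) => (1 - 'X) * qnum i.+1)) => [|i _]; last exact: qnumE.
  by rewrite big_split /= prodr_const card_ord big_add1 big_mkord.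
apply: (mulfI nz); rewrite mulrCA -e1 mulrCA -e2; exact: maj_poly_hooks_sub.
Qed.

End MajGeneratingFunction.

(** * Cancelling the hooks of the longest line *)

Lemma big_iota1 (T : Type) (idx : T) (op : T -> T -> T) n (F : nat -> T) :
  \big[op/idx]_(i <- iota 1 n) F i = \big[op/idx]_(1 <= i < n.+1) F i.
Proof. by rewrite /index_iota subn1. Qed.

Section Domination.

(** Amounts to the [j]-th smallest element being at most [j]. The form with test functions needs no
    sorting, passes to concatenations, and applies directly to sums of squares. *)
Definition dominated (s : seq nat) := forall g : nat -> nat,
  {homo g : x y / x <= y} -> \sum_(h <- s) g h <= \sum_(1 <= j < (size s).+1) g j.

Lemma dominated_cat s1 s2 : dominated s1 -> dominated s2 -> dominated (s1 ++ s2).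
Proof.
move=> d1 d2 g mg; rewrite big_cat size_cat.
apply: leq_trans (leq_add (d1 g mg) (d2 g mg)) _.
rewrite [leqRHS](@big_cat_nat _ _ _ (size s1).+1 1) //=; last by lia.
rewrite leq_add2l big_add1 /=.
rewrite [leqRHS](_ : _ = \sum_(0 <= i < size s2) g (i + (size s1).+1)).
  by apply: leq_sum => i _; apply: mg; lia.
by rewrite -[X in \sum_(X <= _ < _) _]add0n big_addn subSS addKn.
Qed.

Lemma dominated_le s h : dominated s -> h \in s -> h <= size s.
Proof.
move=> ds hs; rewrite leqNgt; apply/negP => lt.
have mono : {homo (fun x => nat_of_bool (size s < x)) : x y / x <= y}.
  by move=> x y xy; case: (ltnP (size s) x) => // /leq_trans /(_ xy) ->.
have := ds _ mono; rewrite (big_rem h hs) /= lt.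
rewrite [X in _ <= X]big_nat [X in _ <= X]big1 // => j /andP[_].
by rewrite ltnS leqNgt => /negbTE ->.
Qed.

Lemma count_gt_sumn c s : count (fun r => c < r) s <= sumn s.
Proof. by elim: s => //= r s IH; case: ltnP; lia. Qed.

(** A leg has at most [sumn s] cells, so the hooks of the top row are bounded one by one by the last
    [p] integers, from [sumn s + 1] to [sumn s + p]. *)
Lemma dominated_hooks s : dominated (hooks s).
Proof.
elim: s => [|p s IH] /= g mg; first by rewrite big_nil.
rewrite big_cat size_cat size_map size_iota size_hooks addnC.
rewrite (@big_cat_nat _ _ _ (sumn s).+1 1) //=; last by rewrite ltnS leq_addr.
rewrite [leqLHS]addnC leq_add //; first by have := IH g mg; rewrite size_hooks.
rewrite big_map big_iota0 -addSn addnC -[(sumn s).+1]add0n big_addn addnK big_mkord.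
rewrite [leqRHS](reindex_inj rev_ord_inj) /= leq_sum // => i _.
by apply: mg; have := count_gt_sumn i s; have := ltn_ord i; lia.
Qed.

Lemma dominated_block_hooks l : dominated (block_hooks l).
Proof.
elim: l => [|p l IH]; first by move=> g mg; rewrite big_nil.
by rewrite /block_hooks /=; apply: dominated_cat => //; apply: dominated_hooks.
Qed.

Lemma hooks_gt0 s h : h \in hooks s -> 0 < h.
Proof.
elim: s => //= p s IH; rewrite mem_cat => /orP[/mapP[c]|/IH//].
by rewrite mem_iota add0n => /andP[_ cp] ->; lia.
Qed.

Lemma hooks_ub s a b h : all (leq^~ a) s -> size s <= b -> h \in hooks s -> h <= a + b.
Proof.
elim: s => //= p s IH /andP[pa sa] sb; rewrite mem_cat => /orP[/mapP[c]|/IH->//]; last exact: ltnW.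
rewrite mem_iota add0n => /andP[_ cp] ->.
by have := count_size (fun r => c < r) s; lia.
Qed.

End Domination.

Section Lines.

Definition col_hooks := fix loop (s : seq nat) : seq nat :=
  if s is r :: s' then (r + size s')%N :: loop s' else [::].

Lemma size_col_hooks s : size (col_hooks s) = size s.
Proof. by elim: s => //= r s ->. Qed.

Lemma perm_hooks_col (s : seq nat) : 0 \notin s ->
  perm_eq (hooks s) (col_hooks s ++ hooks (map predn s)).
Proof.
elim: s => //= r s IH; rewrite inE negb_or => /andP[r0 s0].
have -> : row_hooks r s = (r + size s) :: row_hooks r.-1 (map predn s).
  case: r r0 => // r _; rewrite /row_hooks /= subn0; congr (_ + _ :: _).
    apply/eqP; rewrite -all_count; apply/allP => x xs; rewrite lt0n.
    by apply: contraNneq s0 => <-.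
  rewrite (iotaDl 1 0) -map_comp; apply: eq_map => c /=.
  by rewrite subSS count_map; congr (_ + _); apply: eq_count => x /=; lia.
rewrite cat_cons perm_cons (perm_trans (perm_cat (perm_refl _) (IH s0))) //.
by rewrite perm_catCA.
Qed.

Lemma col_hooks_lt s r : path geq r s -> all (fun h => h < r + size s) (col_hooks s).
Proof.
elim: s r => //= p s IH r /andP[pr ps]; apply/andP; split; first by lia.
by apply: sub_all (IH _ ps) => h /=; lia.
Qed.

Lemma uniq_col_hooks s : sorted geq s -> uniq (col_hooks s).
Proof.
elim: s => //= p s IH ps; rewrite IH ?(path_sorted ps) // andbT.
by apply/negP => /(allP (col_hooks_lt ps)); rewrite ltnn.
Qed.

Lemma sumn_col_hooks s : 2 * sumn (col_hooks s) + 2 * size s = 2 * sumn s + size s * (size s).+1.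
Proof. by elim: s => //= p s; nia. Qed.

Lemma sumn_predn s : 0 \notin s -> sumn (map predn s) + size s = sumn s.
Proof. by elim: s => //= p s IH; rewrite inE negb_or => /andP[p0 /IH]; lia. Qed.

Lemma size_le_sumn (s : seq nat) : 0 \notin s -> size s <= sumn s.
Proof. by move/sumn_predn => <-; rewrite leq_addl. Qed.

Lemma sumn_row_hooks p s : 2 * sumn (row_hooks p s) <= p * p.+1 + 2 * sumn s.
Proof.
rewrite sumnE big_map big_iota0 big_split /= mulnDr leq_add //.
  rewrite (reindex_inj rev_ord_inj) /=.
  elim: p => [|p IH]; first by rewrite big_ord0.
  rewrite big_ord_recr /= mulnDr.
  rewrite (eq_bigr (fun i : 'I_p => p - (p - i.+1))) => [|i _]; last by have := ltn_ord i; lia.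
  by move: IH; nia.
rewrite leq_mul2l /=; elim: s => [|r s IH] /=; first by rewrite big1.
rewrite big_split leq_add //=.
have := sum_nat_const 'I_p 1; rewrite card_ord muln1 => _.
rewrite -(big_mkord xpredT (fun c => nat_of_bool (c < r))).
case: (leqP p r) => pr.
  apply: leq_trans pr; rewrite -[leqRHS]muln1 -[X in X * _]subn0 -sum_nat_const_nat.
  by apply: leq_sum => i _; apply: leq_b1.
rewrite (@big_cat_nat _ _ _ r 0 p) //= ?(ltnW pr) //.
rewrite [X in _ + X <= _](_ : _ = 0) ?addn0; last first.
  by rewrite big_nat big1 // => i /andP[h _]; rewrite ltnNge h.
rewrite -[leqRHS]muln1 -[X in _ <= X * _]subn0 -sum_nat_const_nat.
by apply: leq_sum => i _; apply: leq_b1.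
Qed.

(** [A] holds the hooks of a row or column with [m] cells, [B] the others. The last inequality
    bounds the sum of [A] by [m * (m - 1) / 2 + sumn s], so that the integers missing from [A] have
    a large sum. *)
Definition line_part (s A B : seq nat) (m : nat) :=
  [/\ perm_eq (hooks s) (A ++ B), uniq A,
      all (fun h => 0 < h <= sumn s) A, size A = m &
      dominated B /\ 2 * sumn A + 2 * m <= m * m.+1 + 2 * sumn s].

(** The first row is taken; the complementation with beta-numbers shows that its hooks are distinct
    and at most its length plus the number of rows below. *)
Lemma row_line (p : intpart) : exists A B, line_part p A B (head 0 p).
Proof.
case: p => [[|p s] ps] /=; first by exists [::], [::]; split=> //; split => // g _; rewrite big_nil.
case/andP: (ps) => sp s0; exists (row_hooks p s), (hooks s).
pose P := IntPart ps; pose a := bottom_rows (p :: s) (size s).+1.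
have aE : rows_upto (size s).+1 a = p :: s.
  by rewrite rows_upto_bottom // subnn cats0.
have am : a (size s) = p by rewrite /a /bottom_rows /= subnn.
have sE : rows_upto (size s) a = s by move: aE; rewrite rows_uptoS => -[].
have mono i : i.+1 < (size s).+1 -> a i <= a i.+1.
  move=> im; rewrite /a /bottom_rows.
  have := @sorted_leq_nth _ geq _ _ 0%N (p :: s) sp ((size s).+1.-1 - i.+1)%N ((size s).+1.-1 - i)%N; apply.
  - by move=> x y z h1 h2; apply: leq_trans h2 h1.
  - exact: leqnn.
  - by rewrite inE /=; lia.
  - by rewrite inE /=; lia.
  - by move=> /=; lia.
have := perm_row_hooks mono; rewrite am sE => perm.
have up : uniq (row_hooks p s) by have := perm_uniq perm; rewrite iota_uniq cat_uniq => /andP[].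
have ss : size s <= sumn s by apply: size_le_sumn; move: s0; rewrite inE negb_or => /andP[].
split=> //=.
- apply/allP => h hp; have : h \in iota 1 (p + size s) by rewrite -(perm_mem perm) mem_cat hp.
  by rewrite mem_iota; lia.
- by rewrite size_map size_iota.
- by split; [exact: dominated_hooks|have := sumn_row_hooks p s; lia].
Qed.

Lemma col_line (p : intpart) : exists A B, line_part p A B (size p).
Proof.
case: p => [s ps] /=; case/andP: (ps) => sp s0; exists (col_hooks s), (hooks (map predn s)).
split=> //=.
- exact: perm_hooks_col.
- exact: uniq_col_hooks.
- case: s sp s0 {ps} => //= r s sp; rewrite inE negb_or => /andP[r0 s0].
  have ss := size_le_sumn s0; apply/andP; split; first by lia.
  apply/allP => h hs; have := allP (col_hooks_lt sp) _ hs.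
  have : 0 < h.
    by apply: (@hooks_gt0 s); rewrite (perm_mem (perm_hooks_col s0)) mem_cat hs.
  by move=> /=; lia.
- exact: size_col_hooks.
- by split; [exact: dominated_hooks|have := sumn_col_hooks s; lia].
Qed.

Lemma head_conj_part (p : intpart) : head 0 (conj_part p) = size p.
Proof.
case: p => [s /= /andP[_ s0]]; rewrite /conj_part; case: s s0 => //= r s.
rewrite inE negb_or => /andP[r0 s0]; case: r r0 => //= r _; congr _.+1.
apply/eqP; rewrite -all_count; apply/allP => x xs; rewrite lt0n.
by apply: contraNneq s0 => <-.
Qed.

Definition longest_line (l : block_skew) : nat :=
  \max_(p <- l) maxn (head 0 p) (head 0 (conj_part p)).

Lemma longest_line_split (l : block_skew) : l <> [::] ->
  exists l1 p l2, l = l1 ++ p :: l2 /\ longest_line l = maxn (head 0 p) (size p).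
Proof.
elim: l => // p l IH _; rewrite /longest_line big_cons head_conj_part.
case: l IH => [_|q l /(_ _)[]// l1 [r [l2 [-> e]]]].
  by exists [::], p, [::]; rewrite big_nil maxn0.
rewrite -/(longest_line _) e.
case: (leqP (maxn (head 0 r) (size r)) (maxn (head 0 p) (size p))) => h.
  by exists [::], p, (l1 ++ r :: l2).
by exists (p :: l1), r, l2.
Qed.

Lemma perm_line_part (l : block_skew) : exists A B,
  [/\ perm_eq (block_hooks l) (A ++ B), uniq A,
      all (fun h => 0 < h <= block_size l) A, size A = longest_line l &
      dominated B /\ 2 * sumn A + 2 * longest_line l
        <= longest_line l * (longest_line l).+1 + 2 * block_size l].
Proof.
have [->|l0] := pselect (l = [::]).
  rewrite /longest_line big_nil; exists [::], [::]; split=> //; split=> // g _; by rewrite big_nil.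
have [l1 [p [l2 [-> ->]]]] := longest_line_split l0.
have sz : block_size (l1 ++ p :: l2) = block_size l1 + (sumn p + block_size l2).
  by rewrite /block_size big_cat big_cons.
have hk : block_hooks (l1 ++ p :: l2) = block_hooks l1 ++ hooks p ++ block_hooks l2.
  by rewrite /block_hooks map_cat flatten_cat.
have [A [B [pA uA aA sA [dB sumA]]]] : exists A B, line_part p A B (maxn (head 0 p) (size p)).
  by case: leqP => _; [exact: col_line|exact: row_line].
exists A, (block_hooks l1 ++ B ++ block_hooks l2); split=> //.
- rewrite hk perm_sym perm_catCA perm_cat2l catA perm_cat2r perm_sym //.
- by apply: sub_all aA => h /=; rewrite sz; lia.
- split; last by rewrite sz; lia.
  apply: dominated_cat; first exact: dominated_block_hooks.
  by apply: dominated_cat => //; exact: dominated_block_hooks.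
Qed.

Lemma block_hooks_gt0 l h : h \in block_hooks l -> 0 < h.
Proof.
by elim: l => //= p l IH; rewrite /block_hooks /= mem_cat => /orP[/hooks_gt0|/IH].
Qed.

Lemma block_hooks_ub l h : h \in block_hooks l -> h <= 2 * longest_line l.
Proof.
rewrite /longest_line; elim: l => //= p l IH; rewrite big_cons /block_hooks /= mem_cat.
move=> /orP[|/IH]; last by move=> h'; apply: leq_trans h' _; rewrite leq_mul2l leq_maxr.
rewrite head_conj_part => /(@hooks_ub _ (head 0 p) (size p)) h'.
have {}h' : h <= head 0 p + size p.
  by apply: h' => //; apply/(all_nthP 0) => i _; apply: head_ge_nth.
lia.
Qed.

Lemma sum_id n : 2 * \sum_(1 <= j < n.+1) j = n * n.+1.
Proof.
elim: n => [|n IH]; first by rewrite big_geq.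
by rewrite big_nat_recr //= mulnDr IH; nia.
Qed.

Lemma sum_sqr n : 6 * \sum_(1 <= j < n.+1) j ^ 2 = n * n.+1 * (2 * n).+1.
Proof.
elim: n => [|n IH]; first by rewrite big_geq.
by rewrite big_nat_recr //= mulnDr IH -mulnn; nia.
Qed.

Lemma sum_sqr_lb (t : nat) (s : seq nat) :
  2 * t * (2 * sumn s) <= \sum_(j <- s) (4 * j ^ 2) + size s * t ^ 2.
Proof.
elim: s => [|j s IH] /=; first by rewrite !muln0.
have h : 4 * (t * j) <= 4 * j ^ 2 + t ^ 2.
  by have [+ _] := nat_Cauchy (2 * j) t; rewrite -!mulnn; lia.
by rewrite big_cons mulSn; lia.
Qed.

(** [k] is the aft, [b] and [c] are the sums of squares over [B] and [C], and [s] is the sum of [C],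
    whose mean is at least [t / 2]. Hence [c] is at least [k * t ^ 2 / 4], while domination keeps
    [b] near [k ^ 3 / 3]. *)
Lemma long_line_ineq (n k t s b c : nat) : 7 <= n -> t + k.+1 = 2 * n -> 4 * k <= 3 * n ->
  6 * b <= k * k.+1 * (2 * k).+1 ->
  2 * t * (2 * s) <= 4 * c + k * t ^ 2 -> k * t <= 2 * s ->
  20 * b + n ^ 2 * k <= 20 * c.
Proof.
rewrite -!mulnn => n7 tE k3 h1 h2 h3.
have h5 : k * (t * t) <= 4 * c.
  have : t * (k * t) <= t * (2 * s) by rewrite leq_mul2l h3 orbT.
  by rewrite mulnCA; lia.
have h6 : 5 * n <= 4 * t + 4 by lia.
have [p pE] : exists p, 3 * n = 4 * k + p by exists (3 * n - 4 * k); lia.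
have h7 : 16 * (k.+1 * (2 * k).+1) <= (3 * n + 4) * (6 * n + 4).
  have e1 : 4 * k.+1 <= 3 * n + 4 by lia.
  have e2 : 4 * (2 * k).+1 <= 6 * n + 4 by lia.
  by have := leq_mul e1 e2; lia.
have h8 : (5 * n - 4) * (5 * n - 4) <= 16 * (t * t).
  have e1 : 5 * n - 4 <= 4 * t by lia.
  by have := leq_mul e1 e1; lia.
(* The difference of the two sides is [29 * n ^ 2 - 192 * n + 16], positive exactly from [n = 7] on
   among positive sizes; this is the origin of the bound 7. *)
have h9 : 2 * ((3 * n + 4) * (6 * n + 4)) + 10 * (n * n) <= 3 * ((5 * n - 4) * (5 * n - 4)).
  have [n' ->] : exists n', n = n' + 7 by exists (n - 7); lia.
  by rewrite (_ : 5 * (n' + 7) - 4 = 5 * n' + 31); lia.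
have h10 : 32 * (k.+1 * (2 * k).+1) + 10 * (n * n) <= 48 * (t * t) by lia.
have h11 : k * (32 * (k.+1 * (2 * k).+1) + 10 * (n * n)) <= k * (48 * (t * t)).
  by rewrite leq_mul2l h10 orbT.
rewrite -mulnA in h1; lia.
Qed.

(** [a] is the sum of squares over [A]. All hooks together have squares summing to at most
    [n ^ 3 / 4], against at least [n ^ 3 / 3] for [1, ..., n]; the difference is ample. *)
Lemma short_line_ineq (n k a b c : nat) : k <= n ->
  4 * (a + b) <= n ^ 2 * n -> 6 * (a + c) = n * n.+1 * (2 * n).+1 ->
  20 * b + n ^ 2 * k <= 20 * c.
Proof.
rewrite -!mulnn => kn h1 h2.
have : n * n * k <= n * n * n by rewrite leq_mul2l kn orbT.
by lia.
Qed.

(** [C] consists of the integers of [1, ..., n] that are not hooks of the longest line. The sum of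
    [C] falls short of [aft l * n] by at most half of [aft l * (aft l).+1], which bounds the defect
    of each element. For the variance, either [4 * aft l <= 3 * n], and [B] is small while [C] is
    large, or the longest line is shorter than [n / 4] and every hook is at most [n / 2]. *)
Lemma line_decomposition l : exists B C,
  [/\ size B = aft l, size C = aft l,
      perm_eq (block_hooks l ++ C) (iota 1 (block_size l) ++ B),
      all (fun h => 0 < h <= aft l) B &
      [/\ all (fun j => 0 < j <= block_size l) C,
          all (fun j => 2 * (block_size l - j) <= aft l * (aft l).+1) C &
          7 <= block_size l ->
          20 * \sum_(h <- B) h ^ 2 + block_size l ^ 2 * aft l <= 20 * \sum_(j <- C) j ^ 2]].
Proof.
have [A [B [pA uA aA sA [dB sumA]]]] := perm_line_part l.
set n := block_size l in aA sumA *; set m := longest_line l in sA sumA.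
pose C := [seq j <- iota 1 n | j \notin A].
have pC : perm_eq (iota 1 n) (A ++ C).
  apply: uniq_perm; first exact: iota_uniq.
    rewrite cat_uniq uA filter_uniq ?iota_uniq // andbT; apply/hasPn => j.
    by rewrite mem_filter => /andP[].
  move=> j; rewrite mem_cat mem_filter; case: (boolP (j \in A)) => //= jA.
  by have := allP aA _ jA; rewrite mem_iota; lia.
have sAC : size A + size C = n by have := perm_size pC; rewrite size_cat size_iota.
have sAB : size A + size B = n.
  by have := perm_size pA; rewrite size_cat size_block_hooks.
have kE : aft l = n - m by [].
have mn : m <= n by rewrite -sA -sAC leq_addr.
have sB : size B = aft l by lia.
have sC : size C = aft l by lia.
have B0 : all (fun h => 0 < h <= aft l) B.
  apply/allP => h hB; rewrite -sB (dominated_le dB hB) andbT.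
  by apply: (@block_hooks_gt0 l); rewrite (perm_mem pA) mem_cat hB orbT.
have C0 : all (fun j => 0 < j <= n) C.
  by apply/allP => j; rewrite mem_filter mem_iota => /andP[_]; lia.
have sumC : aft l * (n + m) <= 2 * sumn C + aft l.
  have : sumn (iota 1 n) = sumn A + sumn C by rewrite (perm_sumn pC) sumn_cat.
  have : 2 * sumn (iota 1 n) = n * n.+1.
    by rewrite sumnE big_iota1 sum_id.
  by rewrite kE; nia.
exists B, C; split=> //.
  rewrite (perm_trans (perm_cat pA (perm_refl C))) // -catA perm_sym.
  by rewrite (perm_trans (perm_cat pC (perm_refl B))) // -catA perm_cat2l perm_catC.
split=> //.
  apply/allP => j jC.
  have : sumn C + (n - j) <= aft l * n.
    have jn : j <= n by have := allP C0 _ jC; lia.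
    rewrite (perm_sumn (perm_to_rem jC)) /= -addnA addnCA subnKC // addnC.
    have : size (rem j C) = (aft l).-1 by rewrite size_rem // sC.
    have : 0 < aft l by rewrite -sC; case: (C) jC.
    have : all (leq^~ n) (rem j C).
      by apply/allP => i /mem_rem /(allP C0) /andP[].
    move: (rem j C) => D; move: (aft l) => [//|k] aD _ /= <-.
    rewrite mulSn leq_add2l; elim: D aD => //= x D IH /andP[xn /IH]; lia.
  by nia.
move=> n7; case: (leqP (4 * aft l) (3 * n)) => k3.
  have h1 : 6 * \sum_(h <- B) h ^ 2 <= aft l * (aft l).+1 * (2 * aft l).+1.
    rewrite -sum_sqr leq_mul2l /= -sB; apply: (dB (fun h => h ^ 2)) => x y xy.
    by rewrite leq_exp2r.
  have h2 := sum_sqr_lb (n + m - 1) C; rewrite -big_distrr /= sC in h2.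
  by apply: (@long_line_ineq n (aft l) (n + m - 1) (sumn C)) => //; nia.
have allh : 4 * \sum_(h <- block_hooks l) h ^ 2 <= n ^ 2 * n.
  rewrite big_distrr /= -[X in _ <= _ * X](size_block_hooks l).
  have : all (fun h => 4 * h ^ 2 <= n ^ 2) (block_hooks l).
    apply/allP => h /block_hooks_ub; rewrite -/m -!mulnn => h'.
    by have : 2 * h <= n by [lia]; nia.
  elim: (block_hooks l) => [|h s IH] /=; first by rewrite big_nil.
  by rewrite big_cons mulnS => /andP[h1 /IH]; apply: leq_add.
have e1 : \sum_(h <- block_hooks l) h ^ 2 = \sum_(h <- A) h ^ 2 + \sum_(h <- B) h ^ 2.
  by rewrite (perm_big _ pA) big_cat.
have e2 : \sum_(1 <= j < n.+1) j ^ 2 = \sum_(h <- A) h ^ 2 + \sum_(h <- C) h ^ 2.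
  by rewrite -big_iota1 (perm_big _ pC) big_cat.
apply: (@short_line_ineq n (aft l) (\sum_(h <- A) h ^ 2)); first by lia.
  by rewrite -e1.
by rewrite -e2 sum_sqr.
Qed.

End Lines.

Local Open Scope classical_set_scope.
Local Open Scope ring_scope.

(** * The Gaussian characteristic function *)

Section GaussianDensity.
Variable R : realType.
Local Notation mu := (@lebesgue_measure R).

Lemma integral_normal_prob (m s : R) (f : R -> \bar R) :
  measurable_fun setT f -> (\int[normal_prob m s]_x `|f x| < +oo)%E ->
  (\int[normal_prob m s]_x f x = \int[mu]_x (f x * (normal_pdf m s x)%:E))%E.
Proof.
move=> mf finf.
rewrite -(Radon_Nikodym_change_of_variables (normal_prob_dominates m s))//=; last first.
  by apply/integrableP; split.
apply: ae_eq_integral => //.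
- apply: emeasurable_funM => //; apply: (measurable_int mu).
  by apply: Radon_Nikodym_integrable; exact: normal_prob_dominates.
- apply: emeasurable_funM => //=; apply/measurableT_comp => //=.
  exact: measurable_normal_pdf.
- apply: ae_eqe_mul2l => /=.
  rewrite Radon_NikodymE//=; first exact: normal_prob_dominates.
  move=> abmu.
  case: cid => /= h [h1 h2 h3].
  apply: integral_ae_eq => //=.
  + by apply/measurableT_comp =>//; exact: measurable_normal_pdf.
  + by move=> E E01 mE; rewrite -h3//=.
Qed.

Local Notation g := (normal_pdf (0 : R) 1).

Lemma std_normal_pdfE (z : R) : g z = normal_peak (1 : R) * expR (- z ^+ 2 / 2).
Proof. by rewrite normal_pdfE ?oner_neq0 // /normal_fun subr0 expr1n. Qed.

Lemma is_derive_std_normal_pdf (z : R) : is_derive z 1 g (- z * g z).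
Proof.
have -> : g = fun z => normal_peak (1 : R) * expR (- z ^+ 2 / 2).
  by apply/funext => x; exact: std_normal_pdfE.
by apply: is_derive_eq; rewrite /GRing.scale /=; field.
Qed.

(** The exponent is split into halves: one keeps a Gaussian density, of doubled variance, and the
    other is left to absorb a factor [|z|] or to bound a tail. *)
Lemma normal_pdf_sqrt2 (m s u : R) : s != 0 ->
  normal_pdf m s u =
  Num.sqrt 2 * normal_pdf m (Num.sqrt 2 * s) u * expR (- ((u - m) / (2 * s)) ^+ 2).
Proof.
move=> s0; have s2 : Num.sqrt 2 != 0 :> R by rewrite gt_eqF // sqrtr_gt0.
rewrite !normal_pdfE ?mulf_neq0 // /normal_peak /normal_fun.
rewrite [(_ * s) ^+ 2]exprMn sqr_sqrtr // -[2 * s ^+ 2 * pi *+ 2](_ : 2 * (s ^+ 2 * pi *+ 2) = _); last by ring.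
rewrite sqrtrM // invfM mulrA mulVKf // -mulrA -expRD; congr (_ * expR _).
by field.
Qed.

Lemma normM_std_normal_pdf_le (z : R) :
  `|z| * g z <= Num.sqrt 2 * normal_pdf 0 (Num.sqrt 2) z.
Proof.
rewrite (normal_pdf_sqrt2 0 z (oner_neq0 _)) mulr1 mulrCA ler_piMr //.
  by rewrite mulr_ge0 // normal_pdf_ge0.
rewrite subr0 mulr1 expRN ler_pdivrMr ?expR_gt0 // mul1r.
apply: le_trans (expR_ge1Dx _).
have -> : (z / 2) ^+ 2 = (`|z| / 2) ^+ 2 by rewrite !expr_div_n real_normK ?num_real.
have : 0 <= (`|z| / 2 - 1) ^+ 2 by exact: sqr_ge0.
nra.
Qed.

Lemma integrable_normM_std_normal_pdf :
  mu.-integrable setT (EFin \o (fun z => `|z| * g z)).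
Proof.
apply: (@le_integrable _ _ _ mu setT _ _
   (fun z => (Num.sqrt 2 * normal_pdf 0 (Num.sqrt 2) z)%:E)) => //.
- apply/measurable_EFinP; apply: measurable_funM; last exact: measurable_normal_pdf.
  exact: normr_measurable.
- move=> z _ /=; rewrite lee_fin ger0_norm; last by rewrite mulr_ge0 // normal_pdf_ge0.
  by apply: le_trans (normM_std_normal_pdf_le z) _; exact: ler_norm.
- under eq_fun do rewrite EFinM; apply: integrableZl => //.
  exact: integrable_normal_pdf.
Qed.

Lemma integrable_bounded_std_normal_pdf (f : R -> R) : measurable_fun setT f ->
  (forall z, `|f z| <= 1) -> mu.-integrable setT (EFin \o (fun z => f z * g z)).
Proof.
move=> mf f1; apply: (le_integrable _ _ _ (integrable_normal_pdf 0 1)) => //.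
- by apply/measurable_EFinP; apply: measurable_funM => //; exact: measurable_normal_pdf.
- move=> z _ /=; rewrite lee_fin normrM; apply: ler_piMl => //; exact: f1.
Qed.

Lemma integrable_boundedM_std_normal_pdf (f : R -> R) : measurable_fun setT f ->
  (forall z, `|f z| <= 1) -> mu.-integrable setT (EFin \o (fun z => z * f z * g z)).
Proof.
move=> mf f1; apply: (le_integrable _ _ _ integrable_normM_std_normal_pdf) => //.
- apply/measurable_EFinP; apply: measurable_funM; last exact: measurable_normal_pdf.
  exact: measurable_funM.
- move=> z _ /=; rewrite lee_fin !normrM normr_id -mulrA ler_wpM2l //.
  by rewrite ler_piMl.
Qed.

Lemma measurable_cos_affine (t a : R) : measurable_fun setT (fun z => cos (t * z + a)).
Proof.
apply: continuous_measurable_fun => z; apply: continuous_comp; last exact: continuous_cos.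
by apply: cvgD; [apply: cvgM; [exact: cvg_cst|exact: cvg_id]|exact: cvg_cst].
Qed.

Lemma measurable_sin_affine (t a : R) : measurable_fun setT (fun z => sin (t * z + a)).
Proof.
apply: continuous_measurable_fun => z; apply: continuous_comp; last exact: continuous_sin.
by apply: cvgD; [apply: cvgM; [exact: cvg_cst|exact: cvg_id]|exact: cvg_cst].
Qed.

Lemma std_normal_pdf_nat_le (n : nat) : g n%:R <= 2 * normal_peak 1 * n.+1%:R^-1.
Proof.
rewrite std_normal_pdfE -mulrA [2 * _]mulrC -mulrA ler_wpM2l ?normal_peak_ge0 //.
rewrite mulNr expRN [leRHS]mulrC -[2]invrK -invfM lef_pV2 ?posrE ?expR_gt0 ?mulr_gt0 //.
apply: le_trans (expR_ge1Dx _).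
have : 0 <= (n%:R - 1 : R) ^+ 2 by exact: sqr_ge0.
have : 0 <= n%:R :> R by [].
rewrite invrK (_ : n.+1%:R = n%:R + 1 :> R) ?natr1 //; nra.
Qed.

Lemma cvg_std_normal_pdf_nat : g n%:R @[n --> \oo] --> (0 : R).
Proof.
apply: (@squeeze_cvgr _ _ _ _ (cst 0) (fun n => 2 * normal_peak 1 * harmonic n)) => //.
- by apply: nearW => n; rewrite normal_pdf_ge0 std_normal_pdf_nat_le.
- exact: cvg_cst.
- by rewrite -[X in _ --> X](mulr0 (2 * normal_peak 1)); apply: cvgMr; exact: cvg_harmonic.
Qed.

Lemma std_normal_pdfN (z : R) : g (- z) = g z.
Proof. by rewrite !std_normal_pdfE sqrrN. Qed.

(* Integration by parts: the derivative of [g z * sin (t * z + a)] has integral zero. *)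
Lemma integral_std_normal_pdf_by_parts (t a : R) :
  \int[mu]_z (z * sin (t * z + a) * g z) = t * \int[mu]_z (cos (t * z + a) * g z).
Proof.
pose F (z : R) : R := g z * sin (t * z + a).
pose f (z : R) : R := t * (cos (t * z + a) * g z) - z * sin (t * z + a) * g z.
have dF (z : R) : is_derive z 1 F (f z).
  have h := is_derive_std_normal_pdf z.
  by apply: is_derive_eq; rewrite /GRing.scale /= /f; ring.
have i1 : mu.-integrable setT (EFin \o (fun z => cos (t * z + a) * g z)).
  by apply: integrable_bounded_std_normal_pdf; [exact: measurable_cos_affine|move=> z; exact: cos_max].
have i1' : mu.-integrable setT (EFin \o (fun z => t * (cos (t * z + a) * g z))).
  by rewrite /comp; under eq_fun do rewrite EFinM; apply: integrableZl.
have i2 : mu.-integrable setT (EFin \o (fun z => z * sin (t * z + a) * g z)).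
  by apply: integrable_boundedM_std_normal_pdf; [exact: measurable_sin_affine|move=> z; exact: sin_max].
have if_ : mu.-integrable setT (EFin \o f).
  by rewrite /f /comp; under eq_fun do rewrite EFinB; apply: integrableB.
suff I0 : (\int[mu]_z (f z)%:E = 0)%E.
  apply/esym/eqP; rewrite -subr_eq0 -RintegralZl // -RintegralB //; apply/eqP.
  by rewrite /Rintegral I0.
have cf : continuous f.
  move=> z; apply: differentiable_continuous; apply/derivable1_diffP.
  have h := is_derive_std_normal_pdf z.
  exact: ex_derive.
have FTC (n : nat) : (\int[mu]_(z in `[(- n.+1%:R)%R, (n.+1%:R)%R]) (f z)%:E = ((F n.+1%:R - F (- n.+1%:R))%R)%:E)%E.
  rewrite EFinB; apply: continuous_FTC2.
  - by rewrite -subr_gt0 opprK addr_gt0.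
  - exact: continuous_subspaceT.
  - have cF : continuous F.
      by move=> z; apply: differentiable_continuous; apply/derivable1_diffP; exact: ex_derive.
    split.
    + by move=> z _; exact: ex_derive.
    + by apply: cvg_at_right_filter; exact: cF.
    + by apply: cvg_at_left_filter; exact: cF.
  - by move=> z _; rewrite derive1E; exact: derive_val.
have lim1 : (\int[mu]_(z in `[(- n.+1%:R)%R, (n.+1%:R)%R]) (f z)%:E)%E @[n --> \oo] --> (\int[mu]_z (f z)%:E)%E.
  under eq_fun do rewrite integral_mkcond.
  apply: (@dominated_cvg _ _ _ mu setT measurableT _ _ (fun z => `|(f z)%:E|%E)) => //.
  - move=> n; apply/(measurable_restrictT _ _).1 => //.
    exact/measurable_funTS/measurable_int/if_.
  - move=> z _; apply: cvg_near_cst; near=> n.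
    rewrite patchE ifT // inE /= in_itv /= -ler_norml.
    near: n; exists (Num.truncn `|z|) => // n /= zn; apply/ltW/(lt_le_trans (truncnS_gt _)).
    by rewrite ler_nat ltnS.
  - exact: integrable_abse.
  - move=> n z _; rewrite patchE; case: ifP => // _; rewrite abse0; exact: abse_ge0.
have lim2 : (F n.+1%:R - F (- n.+1%:R))%:E @[n --> \oo] --> (0 : \bar R)%E.
  apply: cvg_EFin; first exact: nearW.
  rewrite /comp /=.
  apply/norm_cvg0P.
  apply: (@squeeze_cvgr _ _ _ _ (cst 0) (fun n => 2 * g n.+1%:R)).
  - apply: nearW => n; rewrite normr_ge0 /=; apply: le_trans (ler_normB _ _) _.
    rewrite /F !normrM std_normal_pdfN mulr_natl mulr2n lerD //;
      rewrite ger0_norm ?normal_pdf_ge0 //; rewrite ler_piMr ?normal_pdf_ge0 //; exact: sin_max.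
  - exact: cvg_cst.
  - rewrite -[X in _ --> X](mulr0 2); apply: cvgMr.
    by have := cvg_std_normal_pdf_nat; rewrite -(cvg_shiftS (fun n => g n%:R)).
have e : (fun n : nat => \int[mu]_(z in `[(- n.+1%:R)%R, (n.+1%:R)%R]) (f z)%:E)%E =
    (fun n : nat => (F n.+1%:R - F (- n.+1%:R))%:E) by apply/funext => n; exact: FTC.
rewrite e in lim1; exact: (cvg_unique _ lim1 lim2).
Unshelve. all: by end_near.
Qed.

(** Differentiation under the integral sign and integration by parts give [psi' = - s * psi], so
    that [psi s * expR (s ^+ 2 / 2)] is constant. *)
Lemma std_normal_characteristic (t a : R) :
  \int[mu]_z (cos (t * z + a) * g z) = cos a * expR (- t ^+ 2 / 2).
Proof.
pose psi (s : R) : R := \int[mu]_z (cos (s * z + a) * g z).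
have dpsi (s : R) : is_derive s 1 psi (- s * psi s).
  pose f (s z : R) : R := cos (s * z + a) * g z.
  have df x y : is_derive (x : R) 1 (f ^~ y) (- (y * sin (x * y + a) * g y)).
    by apply: is_derive_eq; rewrite /GRing.scale /=; ring.
  have Is : `]s - 1, s + 1[%classic s by rewrite /= in_itv /=; apply/andP; split; lra.
  have If x : `]s - 1, s + 1[%classic x -> mu.-integrable setT (EFin \o f x).
    by move=> _; apply: integrable_bounded_std_normal_pdf; [exact: measurable_cos_affine|move=> z; exact: cos_max].
  have Df x y : `]s - 1, s + 1[%classic x -> setT y -> derivable (f ^~ y) x 1.
    by move=> _ _; have := df x y => h; exact: ex_derive.
  have G0 y : 0 <= `|y| * g y by rewrite mulr_ge0 // normal_pdf_ge0.
  have Gub x y : `]s - 1, s + 1[%classic x -> setT y -> `|partial1of2 f x y| <= `|y| * g y.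
    move=> _ _; rewrite partial1of2E (@derive_val _ _ _ _ _ _ _ (df x y)).
    rewrite normrN !normrM [`|g y|]ger0_norm ?normal_pdf_ge0 // -mulrA ler_wpM2l // ler_piMl ?normal_pdf_ge0 //.
    exact: sin_max.
  have d1 := derivable_under_integral measurableT Is If Df G0 integrable_normM_std_normal_pdf Gub.
  have d2 := differentiation_under_integral measurableT Is If Df G0 integrable_normM_std_normal_pdf Gub.
  apply: DeriveDef; first exact: d1.
  rewrite -derive1E d2.
  transitivity (\int[mu]_z (- (z * sin (s * z + a) * g z))).
    by apply: eq_Rintegral => y _; rewrite partial1of2E (@derive_val _ _ _ _ _ _ _ (df s y)).
  have i2 : mu.-integrable setT (EFin \o (fun z => z * sin (s * z + a) * g z)).
    by apply: integrable_boundedM_std_normal_pdf; [exact: measurable_sin_affine|move=> z; exact: sin_max].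
  transitivity (- 1 * \int[mu]_z (z * sin (s * z + a) * g z)).
    by rewrite -RintegralZl //; apply: eq_Rintegral => y _; rewrite mulN1r.
  by rewrite integral_std_normal_pdf_by_parts mulN1r mulNr.
have cst_ (s : R) : psi s * expR (s ^+ 2 / 2) = psi 0 * expR (0 ^+ 2 / 2).
  apply: (@is_derive_0_is_cst _ (fun s => psi s * expR (s ^+ 2 / 2))) => x.
  by have h := dpsi x; apply: is_derive_eq; rewrite /GRing.scale /=; field.
have psi0 : psi 0 = cos a.
  rewrite /psi; transitivity (\int[mu]_z (cos a * g z)).
    by apply: eq_Rintegral => z _; rewrite mul0r add0r.
  rewrite RintegralZl //; last exact: integrable_normal_pdf.
  by rewrite /Rintegral integral_normal_pdf mulr1.
have := cst_ t; rewrite psi0 expr0n mul0r expR0 mulr1 => <-.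
by rewrite -mulrA -expRD mulNr subrr expR0 mulr1.
Qed.

End GaussianDensity.

Section BoundedIntegrals.
Context d (T : measurableType d) (R : realType) (P : probability T R).

Lemma integral_prob_cst (c : R) : (\int[P]__ c%:E = c%:E)%E.
Proof. by rewrite integral_cst // [X in (_ * X)%E](_ : _ = 1%E) ?mule1 //; exact: probability_setT. Qed.

Lemma Rintegral_prob_cst (c : R) : \int[P]__ c = c.
Proof. by rewrite /Rintegral integral_prob_cst. Qed.

Lemma integrable_bounded (f : T -> R) (c : R) : measurable_fun setT f ->
  (forall x, `|f x| <= c) -> P.-integrable setT (EFin \o f).
Proof.
move=> mf fc; apply: (@le_integrable _ _ _ P setT _ _ (EFin \o cst c)) => //.
- exact/measurable_EFinP.
- by move=> x _ /=; rewrite lee_fin; apply: le_trans (fc x) (ler_norm _).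
- exact: finite_measure_integrable_cst.
Qed.

Lemma Rintegral_bounded_le (f : T -> R) (c : R) : measurable_fun setT f ->
  (forall x, `|f x| <= c) -> `|\int[P]_x f x| <= c.
Proof.
move=> mf fc; have if_ := integrable_bounded mf fc.
apply: le_trans (le_normr_Rintegral _ if_) _ => //.
apply: le_trans (_ : _ <= \int[P]_x cst c x) _.
  apply: le_Rintegral => //; last exact: finite_measure_integrable_cst.
  by apply: (@integrable_bounded _ c) => [|x]; [exact: measurableT_comp|rewrite normr_id].
by rewrite Rintegral_prob_cst.
Qed.

Lemma EFin_Rintegral (f : T -> R) : P.-integrable setT (EFin \o f) ->
  (\int[P]_x f x)%:E = (\int[P]_x (f x)%:E)%E.
Proof. by move=> if_; rewrite /Rintegral fineK //; exact: integrable_fin_num. Qed.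

End BoundedIntegrals.

Section BoundedFubini.
Context d1 d2 (T1 : measurableType d1) (T2 : measurableType d2) (R : realType).
Variables (P1 : probability T1 R) (P2 : probability T2 R).
Variables (f : T1 * T2 -> R) (c : R).
Hypothesis mf : measurable_fun setT f.
Hypothesis fc : forall z, `|f z| <= c.

Let m1 x : measurable_fun setT (fun y => f (x, y)).
Proof. exact: (measurableT_comp mf (measurable_pair1 _)). Qed.

Let m2 y : measurable_fun setT (fun x => f (x, y)).
Proof. exact: (measurableT_comp mf (measurable_pair2 _)). Qed.

Let iP : (P1 \x P2)%E.-integrable setT (EFin \o f).
Proof. exact: (@integrable_bounded _ _ _ (P1 \x P2)%E f c). Qed.

Lemma measurable_Rintegral1 : measurable_fun setT (fun x => \int[P2]_y f (x, y)).
Proof.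
apply/measurable_EFinP.
rewrite (_ : EFin \o _ = fun x => \int[P2]_y (f (x, y))%:E)%E.
  exact: (measurable_fubini_F iP).
by apply/funext => x /=; apply: EFin_Rintegral; apply: (integrable_bounded P2 (m1 x) (fun y => fc (x, y))).
Qed.

Lemma measurable_Rintegral2 : measurable_fun setT (fun y => \int[P1]_x f (x, y)).
Proof.
apply/measurable_EFinP.
rewrite (_ : EFin \o _ = fun y => \int[P1]_x (f (x, y))%:E)%E.
  exact: (measurable_fubini_G iP).
by apply/funext => y /=; apply: EFin_Rintegral; apply: (integrable_bounded P1 (m2 y) (fun x => fc (x, y))).
Qed.

Lemma bounded_Fubini :
  \int[P1]_x \int[P2]_y f (x, y) = \int[P2]_y \int[P1]_x f (x, y).
Proof.
rewrite /Rintegral; congr fine.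
transitivity (\int[P1]_x \int[P2]_y (f (x, y))%:E)%E.
  apply: eq_integral => x _; rewrite -EFin_Rintegral //.
  by apply: (integrable_bounded P2 (m1 x) (fun y => fc (x, y))).
rewrite (Fubini iP); apply: eq_integral => y _; rewrite -EFin_Rintegral //.
by apply: (integrable_bounded P1 (m2 y) (fun x => fc (x, y))).
Qed.

Lemma Rintegral_prod : \int[(P1 \x P2)%E]_z f z = \int[P1]_x \int[P2]_y f (x, y).
Proof.
rewrite /Rintegral; congr fine; rewrite -(integral12_prod_meas1 iP).
apply: eq_integral => x _.
exact: (esym (EFin_Rintegral (integrable_bounded P2 (m1 x) (fun y => fc (x, y))))).
Qed.

End BoundedFubini.

(** * Characteristic functions and Gaussian smoothing *)

Section PhaseIntegral.
Variable R : realType.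
Implicit Types mu nu : probability R R.

(* The real form of the characteristic function: for [a = 0] and [a = - pi / 2]
   these are its real and imaginary parts. *)
Definition phase_integral mu (t a : R) : R := \int[mu]_x cos (t * x + a).

Lemma measurable_cos_affineR (t a : R) : measurable_fun setT (fun z : R => cos (t * z + a)).
Proof. exact: measurable_cos_affine. Qed.

Lemma phase_integral_le1 mu t a : `|phase_integral mu t a| <= 1.
Proof.
apply: Rintegral_bounded_le; first exact: measurable_cos_affineR.
by move=> x; exact: cos_max.
Qed.

Let gam : probability (measurableTypeR R) R := normal_prob (0 : R) 1.

Lemma gauss_phase (t a : R) : \int[gam]_z cos (t * z + a) = cos a * expR (- t ^+ 2 / 2).
Proof.
rewrite -std_normal_characteristic /Rintegral integral_normal_prob.
- by congr fine; apply: eq_integral => z _; rewrite EFinM.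
- by apply/measurable_EFinP; exact: measurable_cos_affine.
- have /integrableP[_] // := @integrable_bounded _ _ _ gam (fun z => cos (t * z + a)) 1 (measurable_cos_affine t a) (fun z => cos_max _).
Qed.

Section Smoothing.
Variable e : R.
Hypothesis e0 : 0 < e.

(** The density of the sum of a variable of law [mu] and an independent centred Gaussian of standard
    deviation [e]. *)
Definition smooth_density mu (u : R) : R := \int[mu]_y normal_pdf y e u.

Let e_neq0 : e != 0. Proof. by rewrite gt_eqF. Qed.

(** The Gaussian is its own Fourier transform. Through this formula and Fubini, the smoothed density
    depends on [mu] through its characteristic function alone. *)
Lemma normal_pdf_phase (y u : R) :
  normal_pdf y e u = normal_peak e * \int[gam]_z cos (- (z / e) * y + u * z / e).
Proof.
rewrite normal_pdfE // /normal_fun; congr (_ * _).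
transitivity (\int[gam]_z cos ((u - y) / e * z + 0)); last first.
  by apply: eq_Rintegral => z _; congr cos; field.
by rewrite gauss_phase cos0 mul1r; congr expR; field.
Qed.

Lemma measurable_phase2 (u : R) : measurable_fun setT
  (fun p : R * measurableTypeR R => cos (- (p.2 / e) * p.1 + u * p.2 / e)).
Proof.
apply: measurableT_comp; first by apply: continuous_measurable_fun; exact: continuous_cos.
have m2 : measurable_fun setT (fun p : R * measurableTypeR R => p.2 : R) by exact: measurable_snd.
have m1 : measurable_fun setT (fun p : R * measurableTypeR R => p.1 : R) by exact: measurable_fst.
apply: measurable_funD; last by apply: measurable_funM => //; apply: measurable_funM.
apply: measurable_funM => //; apply: measurableT_comp => //; exact: measurable_funM.
Qed.

Lemma smooth_density_phase mu (u : R) :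
  smooth_density mu u = normal_peak e * \int[gam]_z phase_integral mu (- (z / e)) (u * z / e).
Proof.
rewrite /smooth_density; under eq_Rintegral do rewrite normal_pdf_phase.
rewrite RintegralZl //.
  congr (_ * _); exact: (bounded_Fubini mu gam (measurable_phase2 u) (fun z => cos_max _)).
apply: (@integrable_bounded _ _ _ mu _ 1).
  exact: (measurable_Rintegral1 mu gam (measurable_phase2 u) (fun z => cos_max _)).
move=> y; apply: Rintegral_bounded_le => [|z]; last exact: cos_max.
exact: (measurableT_comp (measurable_phase2 u) (measurable_pair1 _)).
Qed.

Lemma cvg_smooth_density (mu_ : nat -> probability R R) nu :
  (forall t a, phase_integral (mu_ n) t a @[n --> \oo] --> phase_integral nu t a) ->
  forall u, smooth_density (mu_ n) u @[n --> \oo] --> smooth_density nu u.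
Proof.
move=> cv u; rewrite smooth_density_phase; under eq_fun do rewrite smooth_density_phase.
apply: cvgMr.
have mP m : measurable_fun setT (fun z : measurableTypeR R => phase_integral m (- (z / e)) (u * z / e)).
  exact: (measurable_Rintegral2 m gam (measurable_phase2 u) (fun z => cos_max _)).
have iP m : gam.-integrable setT (EFin \o (fun z => phase_integral m (- (z / e)) (u * z / e))).
  by apply: (@integrable_bounded _ _ _ gam _ 1) => // z; exact: phase_integral_le1.
suff h : (\int[gam]_z phase_integral (mu_ n) (- (z / e)) (u * z / e))%:E @[n --> \oo] -->
    (\int[gam]_z phase_integral nu (- (z / e)) (u * z / e))%:E by exact: (fine_cvg h).
rewrite EFin_Rintegral //; under eq_fun do rewrite EFin_Rintegral //.
apply: (@dominated_cvg _ _ _ gam setT measurableT _ _ (EFin \o cst 1)) => //.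
- by move=> n; apply/measurable_EFinP; exact: mP.
- by move=> z _; apply: cvg_EFin; [exact: nearW|exact: cv].
- exact: finite_measure_integrable_cst.
- by move=> n z _ /=; rewrite lee_fin phase_integral_le1.
Qed.

End Smoothing.
End PhaseIntegral.

(** * Levy's continuity theorem *)

Section LevyContinuity.
Variable R : realType.
Implicit Types mu nu : probability R R.
Local Notation leb := (@lebesgue_measure R).

Section Scale.
Variable e : R.
Hypothesis e0 : 0 < e.
Let e_neq0 : e != 0. Proof. by rewrite gt_eqF. Qed.

Lemma measurable_normal_pdf2 : measurable_fun setT
  (fun p : R * measurableTypeR R => normal_pdf p.1 e p.2).
Proof.
rewrite (_ : (fun p => _) = fun p : R * measurableTypeR R =>
    normal_peak e * expR (- (p.2 - p.1) ^+ 2 / (e ^+ 2 *+ 2))); last first.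
  by apply/funext => p; rewrite normal_pdfE.
have m2 : measurable_fun setT (fun p : R * measurableTypeR R => p.2 : R) by exact: measurable_snd.
have m1 : measurable_fun setT (fun p : R * measurableTypeR R => p.1 : R) by exact: measurable_fst.
apply: measurable_funM => //; apply: measurableT_comp => //.
apply: measurable_funM => //; apply: measurableT_comp => //.
by apply: measurable_funX; apply: measurable_funB.
Qed.

Lemma smooth_density_ge0 mu u : 0 <= smooth_density e mu u.
Proof. by apply: Rintegral_ge0 => y _; exact: normal_pdf_ge0. Qed.

Lemma EFin_smooth_density mu u :
  (smooth_density e mu u)%:E = (\int[mu]_y (normal_pdf y e u)%:E)%E.
Proof.
apply: EFin_Rintegral; apply: (@integrable_bounded _ _ _ mu _ (normal_peak e)).
  exact: (measurableT_comp measurable_normal_pdf2 (measurable_pair2 _)).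
by move=> y; rewrite ger0_norm ?normal_pdf_ge0 // normal_pdf_ub.
Qed.

Lemma measurable_smooth_density mu :
  measurable_fun setT (smooth_density e mu : measurableTypeR R -> R).
Proof.
apply/measurable_EFinP.
rewrite (_ : EFin \o _ = fun u : measurableTypeR R => \int[mu]_y (normal_pdf y e u)%:E)%E; last first.
  by apply/funext => u; exact: EFin_smooth_density.
apply: (@measurable_fun_fubini_tonelli_G _ _ _ _ _ mu (fun p : R * measurableTypeR R => (normal_pdf p.1 e p.2)%:E)).
  by apply/measurable_EFinP; exact: measurable_normal_pdf2.
by move=> p; rewrite lee_fin normal_pdf_ge0.
Qed.

Let f (A : set (measurableTypeR R)) (p : R * measurableTypeR R) := (normal_pdf p.1 e p.2 * \1_A p.2)%:E.

Let mf A : measurable A -> measurable_fun setT (f A).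
Proof.
move=> mA; apply/measurable_EFinP; apply: measurable_funM; first exact: measurable_normal_pdf2.
by apply: measurableT_comp; [exact: measurable_indic|exact: measurable_snd].
Qed.

Let f0 A p : (0 <= f A p)%E.
Proof. by rewrite lee_fin mulr_ge0 // normal_pdf_ge0. Qed.

Let normal_probE (A : set (measurableTypeR R)) y : (normal_prob y e A = \int[leb]_u f A (y, u))%E.
Proof.
rewrite /normal_prob integral_mkcond; apply: eq_integral => u _.
by rewrite /f patchE indicE /=; case: ifPn; rewrite ?mulr1 ?mulr0.
Qed.

Lemma measurable_normal_prob (A : set (measurableTypeR R)) : measurable A ->
  measurable_fun setT (fun y : R => normal_prob y e A).
Proof.
move=> mA; under eq_fun do rewrite normal_probE.
by apply: measurable_fun_fubini_tonelli_F; [exact: mf|exact: f0].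
Qed.

Lemma integral_smooth_density mu (A : set (measurableTypeR R)) : measurable A ->
  (\int[leb]_(u in A) (smooth_density e mu u)%:E = \int[mu]_y normal_prob y e A)%E.
Proof.
move=> mA; transitivity (\int[leb]_u \int[mu]_y f A (y, u))%E.
  rewrite integral_mkcond; apply: eq_integral => u _.
  rewrite patchE /f /= indicE; case: ifPn => _.
    by rewrite EFin_smooth_density; apply: eq_integral => y _; rewrite mulr1.
  by rewrite integral0_eq // => y _; rewrite mulr0.
rewrite -(@fubini_tonelli _ _ _ _ _ mu leb (f A) (mf mA) (f0 A)); apply: eq_integral => y _.
by rewrite normal_probE.
Qed.

Lemma integrable_smooth_density mu :
  leb.-integrable setT (EFin \o (smooth_density e mu)).
Proof.
apply/integrableP; split; first by apply/measurable_EFinP; exact: measurable_smooth_density.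
under eq_integral do rewrite /= ger0_norm ?smooth_density_ge0 //.
rewrite integral_smooth_density //.
under eq_integral do rewrite probability_setT.
by rewrite (integral_prob_cst mu 1) ltry.
Qed.

Definition smooth_cdf mu (x : R) : R := \int[leb]_(u in `]-oo, x]) smooth_density e mu u.

Lemma Rintegral_smooth_density mu : \int[leb]_u smooth_density e mu u = 1.
Proof.
rewrite /Rintegral integral_smooth_density //.
under eq_integral do rewrite probability_setT.
by rewrite (integral_prob_cst mu 1).
Qed.

(* Scheffe's lemma: pointwise convergence of densities entails convergence in L1. *)
Lemma cvg_smooth_cdf (mu_ : nat -> probability R R) nu :
  (forall t a, phase_integral (mu_ n) t a @[n --> \oo] --> phase_integral nu t a) ->
  forall x, smooth_cdf (mu_ n) x @[n --> \oo] --> smooth_cdf nu x.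
Proof.
have aux1 (a b c r : R) : a - c <= b -> c <= r -> - r <= 1 - a - (1 - b) by lra.
have aux2 (a b c r : R) : a - c <= b -> c <= r -> a - b <= r by lra.
move=> cv x; have cvd := cvg_smooth_density e0 cv.
(* The positive part of the difference is dominated by the fixed integrable density of the limit;
   its absolute value has no such bound. *)
pose h n (u : measurableTypeR R) : R := Num.max 0 (smooth_density e nu u - smooth_density e (mu_ n) u).
have mh n : measurable_fun setT (h n).
  by apply: measurable_maxr => //; apply: measurable_funB; exact: measurable_smooth_density.
have h0 n u : 0 <= h n u by rewrite le_max lexx.
have hle n u : h n u <= smooth_density e nu u.
  by rewrite ge_max smooth_density_ge0 lerBlDr lerDl smooth_density_ge0.
have hge n u : smooth_density e nu u - smooth_density e (mu_ n) u <= h n u.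
  by rewrite le_max lexx orbT.
have ih n : leb.-integrable setT (EFin \o h n).
  apply: (le_integrable _ _ _ (integrable_smooth_density nu)) => //.
    exact/measurable_EFinP.
  by move=> u _ /=; rewrite lee_fin !ger0_norm ?smooth_density_ge0.
pose E n : R := \int[leb]_u h n u.
have E0 : E n @[n --> \oo] --> (0 : R).
  suff H : (E n)%:E @[n --> \oo] --> (0%:E : \bar R)%E by exact: (fine_cvg H).
  have EE n : (E n)%:E = (\int[leb]_u (h n u)%:E)%E.
    by rewrite /E /Rintegral fineK //; exact: (integrable_fin_num measurableT (ih n)).
  under eq_fun do rewrite EE.
  have -> : (0%:E : \bar R) = (\int[leb]_u (cst 0%E u))%E by rewrite integral0.
  apply: (@dominated_cvg _ _ _ leb setT measurableT _ _ (EFin \o smooth_density e nu)) => //.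
  - by move=> n; apply/measurable_EFinP.
  - move=> u _; apply: cvg_EFin; first exact: nearW.
    apply: (@squeeze_cvgr _ _ _ _ (cst 0) (fun n => `|smooth_density e nu u - smooth_density e (mu_ n) u|)).
    + by apply: nearW => n /=; rewrite h0 ge_max normr_ge0 ler_norm.
    + exact: cvg_cst.
    + rewrite -[X in _ --> X](normr0 R) -(subrr (smooth_density e nu u)); apply: cvg_norm.
      by apply: cvgB; [exact: cvg_cst|exact: cvd].
  - exact: integrable_smooth_density.
  - by move=> n u _ /=; rewrite lee_fin ger0_norm // hle.
have part (A : set (measurableTypeR R)) n : measurable A ->
    \int[leb]_(u in A) smooth_density e nu u - E n <= \int[leb]_(u in A) smooth_density e (mu_ n) u.
  move=> mA.
  have iS m : leb.-integrable A (EFin \o smooth_density e m).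
    by apply: integrableS (integrable_smooth_density m).
  have ihA : leb.-integrable A (EFin \o h n) by apply: integrableS (ih n).
  rewrite lerBlDr; apply: (@le_trans _ _ (\int[leb]_(u in A) (smooth_density e (mu_ n) u + h n u))).
    apply: le_Rintegral => //.
      apply: (eq_integrable mA ((EFin \o smooth_density e (mu_ n)) \+ (EFin \o h n))%E) => //.
      exact: integrableD.
    by move=> u _; rewrite -lerBlDl.
  rewrite RintegralD // lerD2l /E /Rintegral fine_le //.
  - exact: (integrable_fin_num mA ihA).
  - exact: (integrable_fin_num measurableT (ih n)).
  - apply: ge0_subset_integral => //; first exact/measurable_EFinP.
    by move=> u _; rewrite lee_fin.
(* As both masses are 1, the lower bound [part] on the complementary half-line yields the upper
   bound on this one. *)
have compl m : smooth_cdf m x = 1 - \int[leb]_(u in `]x, +oo[) smooth_density e m u.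
  rewrite -(Rintegral_smooth_density m) /smooth_cdf -(setUv `]-oo, x]) setCitvl.
  rewrite Rintegral_setU //; first by rewrite addrK.
  - by rewrite -setCitvl setUv; exact: integrable_smooth_density.
  - by rewrite -setCitvl; apply/disj_setPS; rewrite setICr.
apply/cvgrPdist_le => r r0.
have /cvgrPdist_le /(_ r r0) := E0; apply: filterS => n; rewrite sub0r normrN => En.
have {}En : E n <= r by apply: le_trans (ler_norm _) En.
rewrite ler_norml; apply/andP; split.
  rewrite !compl; apply: aux1 En; exact: part.
by apply: aux2 En; exact: part.
Qed.

Definition tail_bound (delta : R) : R := Num.sqrt 2 * expR (- (delta / (2 * e)) ^+ 2).

Lemma tail_bound_ge0 delta : 0 <= tail_bound delta.
Proof. by rewrite mulr_ge0 ?expR_ge0. Qed.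

Lemma normal_prob_tail (y delta : R) (A : set (measurableTypeR R)) : measurable A ->
  0 <= delta -> (forall u, A u -> delta <= `|u - y|) ->
  (normal_prob y e A <= (tail_bound delta)%:E)%E.
Proof.
move=> mA d0 Ad; rewrite /normal_prob.
have i2 : leb.-integrable setT (fun u => (normal_pdf y (Num.sqrt 2 * e) u)%:E).
  exact: integrable_normal_pdf.
have h0 u : (0 <= (tail_bound delta * normal_pdf y (Num.sqrt 2 * e) u)%:E)%E.
  by rewrite lee_fin mulr_ge0 ?tail_bound_ge0 ?normal_pdf_ge0.
have mh : measurable_fun setT (fun u : measurableTypeR R => (tail_bound delta * normal_pdf y (Num.sqrt 2 * e) u)%:E).
  by apply/measurable_EFinP; apply: measurable_funM => //; exact: measurable_normal_pdf.
apply: (@le_trans _ _ (\int[leb]_(u in A) (tail_bound delta * normal_pdf y (Num.sqrt 2 * e) u)%:E)%E).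
  apply: ge0_le_integral => //.
  - by move=> u _; rewrite lee_fin normal_pdf_ge0.
  - by apply/measurable_EFinP/measurable_funTS; exact: measurable_normal_pdf.
  - exact: measurable_funTS.
  move=> u Au; rewrite lee_fin normal_pdf_sqrt2 // mulrAC; apply: ler_wpM2r.
    exact: normal_pdf_ge0.
  rewrite ler_wpM2l // ler_expR lerN2 -[leRHS]real_normK ?num_real //.
  rewrite ler_sqr ?nnegrE ?divr_ge0 ?mulr_ge0 ?(ltW e0) //.
  rewrite normrM [`|(2 * e)^-1|]ger0_norm ?invr_ge0 ?mulr_ge0 ?(ltW e0) //.
  by rewrite ler_wpM2r ?invr_ge0 ?mulr_ge0 ?(ltW e0) // Ad.
apply: (@le_trans _ _ (\int[leb]_u (tail_bound delta * normal_pdf y (Num.sqrt 2 * e) u)%:E)%E).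
  exact: ge0_subset_integral.
under eq_integral do rewrite EFinM.
by rewrite integralZl // integral_normal_pdf mule1.
Qed.

Definition real_cdf mu (x : R) : R := fine (mu `]-oo, x]%classic).

Lemma EFin_real_cdf mu x : (real_cdf mu x)%:E = mu `]-oo, x]%classic.
Proof. by rewrite /real_cdf fineK // fin_num_measure. Qed.

Lemma EFin_smooth_cdf mu x : (smooth_cdf mu x)%:E = (\int[mu]_y normal_prob y e `]-oo, x]%classic)%E.
Proof.
rewrite /smooth_cdf /Rintegral -integral_smooth_density // fineK //.
apply: integrable_fin_num => //.
by apply: integrableS (integrable_smooth_density mu).
Qed.

Let integral_indic_cst mu (x c : R) : 0 <= c ->
  (\int[mu]_y (\1_(`]-oo, x]%classic : set R) y + c)%:E = (real_cdf mu x + c)%:E)%E.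
Proof.
move=> c0; rewrite EFinD EFin_real_cdf.
under eq_integral do rewrite EFinD.
rewrite ge0_integralD //; last first.
  by apply/measurable_EFinP; exact: measurable_indic.
by rewrite integral_indic // setIT integral_prob_cst.
Qed.

(** Noise smaller than [delta] can bring a variable below [x] only from below [x + delta]; larger
    noise is a Gaussian tail. *)
Lemma smooth_cdf_le mu (x delta : R) : 0 <= delta ->
  smooth_cdf mu x <= real_cdf mu (x + delta) + tail_bound delta.
Proof.
move=> d0; rewrite -lee_fin EFin_smooth_cdf -integral_indic_cst ?tail_bound_ge0 //.
apply: ge0_le_integral => //.
- exact: measurable_normal_prob.
- by apply/measurable_EFinP; apply: measurable_funD => //; exact: measurable_indic.
move=> y _; rewrite indicE; case: (leP y (x + delta)) => yx.
  rewrite mem_set /=; last by rewrite in_itv /=.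
  apply: le_trans (probability_le1 _ _) _ => //.
  by rewrite lee_fin lerDl tail_bound_ge0.
rewrite memNset /=; last by rewrite in_itv /= => /(lt_le_trans yx); rewrite ltxx.
rewrite add0r; apply: normal_prob_tail => // u; rewrite /= in_itv /= => ux.
rewrite distrC; apply: le_trans (ler_norm _); lra.
Qed.

Lemma smooth_cdf_ge mu (x delta : R) : 0 <= delta ->
  real_cdf mu (x - delta) <= smooth_cdf mu x + tail_bound delta.
Proof.
move=> d0; rewrite -lee_fin EFinD EFin_smooth_cdf EFin_real_cdf.
rewrite -[(tail_bound delta)%:E](integral_prob_cst mu).
rewrite -ge0_integralD //; last 2 first.
- exact: measurable_normal_prob.
- by move=> y _; rewrite lee_fin tail_bound_ge0.
rewrite -[X in (X <= _)%E](_ : \int[mu]_y (\1_(`]-oo, (x - delta)]%classic : set R) y)%:E = _)%E; last first.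
  by rewrite integral_indic // setIT.
apply: ge0_le_integral => //.
- by apply/measurable_EFinP; exact: measurable_indic.
- by apply: emeasurable_funD => //; exact: measurable_normal_prob.
move=> y _; rewrite indicE; case: (leP y (x - delta)) => yx; last first.
  rewrite memNset /=; last by rewrite in_itv /= => /(lt_le_trans yx); rewrite ltxx.
  by rewrite adde_ge0 // lee_fin tail_bound_ge0.
rewrite mem_set /=; last by rewrite in_itv /=.
have <- : (normal_prob y e `]-oo, x]%classic + normal_prob y e `]x, +oo[%classic = 1%:E)%E.
  rewrite -measureU //.
    by rewrite -setCitvl setUv; exact: probability_setT.
  by rewrite -setCitvl setICr.
apply: leeD2l; apply: normal_prob_tail => // u; rewrite /= in_itv /= andbT => ux.
apply: le_trans (ler_norm _); lra.
Qed.

End Scale.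

Lemma law_cdfE mu x : law_cdf mu x = (real_cdf mu x)%:E.
Proof. by rewrite EFin_real_cdf. Qed.

Lemma real_cdf_nondecreasing mu : {homo real_cdf mu : x y / x <= y}.
Proof.
move=> x y xy; rewrite -lee_fin !EFin_real_cdf; apply: le_measure; rewrite ?inE //.
by move=> z; rewrite /= !in_itv /= => /le_trans; apply.
Qed.

Lemma tail_bound_small (delta r : R) : 0 < delta -> 0 < r ->
  exists2 e, 0 < e & tail_bound e delta <= r.
Proof.
move=> d0 r0; have s2 : 0 < Num.sqrt 2 :> R by rewrite sqrtr_gt0.
(* With [y = Num.sqrt 2 / r] the tail is [Num.sqrt 2 * expR (- y ^+ 2)], and
   [y <= 1 + y ^+ 2 <= expR (y ^+ 2)]. *)
exists (delta * r / (2 * Num.sqrt 2)); first by rewrite divr_gt0 // mulr_gt0.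
rewrite /tail_bound expRN ler_pdivrMr ?expR_gt0 //.
have -> : delta / (2 * (delta * r / (2 * Num.sqrt 2))) = Num.sqrt 2 / r.
  by field; rewrite !gt_eqF.
have := expR_ge1Dx ((Num.sqrt 2 / r) ^+ 2).
set E := expR _ => hE; rewrite -ler_pdivrMl // mulrC.
have : 0 <= (Num.sqrt 2 / r - 1 / 2) ^+ 2 by exact: sqr_ge0.
have -> : Num.sqrt 2 / r = Num.sqrt 2 * r^-1 by [].
nra.
Qed.

Theorem levy_continuity (mu_ : nat -> probability R R) nu :
  (forall t a, phase_integral (mu_ n) t a @[n --> \oo] --> phase_integral nu t a) ->
  cvg_in_law mu_ nu.
Proof.
move=> cv x cx; rewrite law_cdfE.
have {}cx : {for x, continuous (real_cdf nu)}.
  have h : (real_cdf nu y)%:E @[y --> x] --> (real_cdf nu x)%:E.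
    by move: cx; rewrite (_ : law_cdf nu = fun y => (real_cdf nu y)%:E) //; apply/funext => y; exact: law_cdfE.
  exact: (fine_cvg h).
under eq_fun do rewrite law_cdfE.
apply: cvg_EFin; first exact: nearW.
rewrite /comp /=; apply/cvgrPdist_le => r r0.
(* One quarter each for the continuity of the limit, the convergence of the smoothed functions and
   the two tails; each tail shifts the argument by [d / 4]. *)
have r4 : 0 < r / 4 by lra.
have /cvgrPdist_le /(_ _ r4) /nbhs_ballP [d /= d0 hd] := cx.
have d4 : 0 < d / 4 by rewrite divr_gt0.
have [e e0 he] := tail_bound_small d4 r4.
have bl (y : R) : `|x - y| < d -> `|real_cdf nu x - real_cdf nu y| <= r / 4 by exact: hd.
have /cvgrPdist_le /(_ _ r4) c1 := @cvg_smooth_cdf e e0 mu_ nu cv (x + d / 4).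
have /cvgrPdist_le /(_ _ r4) c2 := @cvg_smooth_cdf e e0 mu_ nu cv (x - d / 4).
move: c1 c2; apply: filterS2 => n; rewrite !ler_norml => /andP[a1 a2] /andP[b1 b2].
have u1 := smooth_cdf_ge e0 (mu_ n) (x + d / 4) (ltW d4).
have u2 := smooth_cdf_le e0 nu (x + d / 4) (ltW d4).
have l1 := smooth_cdf_le e0 (mu_ n) (x - d / 4) (ltW d4).
have l2 := smooth_cdf_ge e0 nu (x - d / 4) (ltW d4).
rewrite addrK in u1; rewrite subrK in l1.
have /bl : `|x - (x + d / 4 + d / 4)| < d by rewrite ltr_norml; apply/andP; split; lra.
have /bl : `|x - (x - d / 4 - d / 4)| < d by rewrite ltr_norml; apply/andP; split; lra.
rewrite !ler_norml => /andP[p1 p2] /andP[q1 q2].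
apply/andP; split; lra.
Qed.

End LevyContinuity.

(** * Uniqueness of limits in law *)

Section Uniqueness.
Variable R : realType.
Implicit Types mu nu : probability R R.

(** The rays []x, +oo[] are stable under intersection, generate the Borel sets and have mass
    [1 - real_cdf mu x]. *)
Lemma same_law_real_cdf mu nu : (forall x, real_cdf mu x = real_cdf nu x) -> same_law mu nu.
Proof.
move=> e A mA.
have Fc (m : probability R R) x : m `]x, +oo[%classic = (1 - real_cdf m x)%:E.
  rewrite -setCitvl (@probability_setC _ _ _ m) // EFinB EFin_real_cdf //.
apply: (measure_unique (@RGenOInfty.G R) (fun n => `](- n%:R), +oo[%classic)) => //.
- exact: RGenOInfty.measurableE.
- move=> _ _ [x ->] [y ->]; exists (Num.max x y).
  by apply/seteqP; split=> z /=; rewrite !in_itv /= !andbT gt_max; [case=> -> ->|case/andP].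
- by move=> n; exists (- n%:R).
- apply/seteqP; split=> // x _; exists (Num.truncn `|x|).+1 => //=.
  rewrite in_itv /= andbT ltrNl; apply: le_lt_trans (ler_norm _) _.
  by rewrite normrN truncnS_gt.
- move=> _ [x ->].
  exact: (etrans (Fc mu x) (etrans (congr1 (fun r => (1 - r)%:E) (e x)) (esym (Fc nu x)))).
- by move=> n; exact: (eq_ind_r (fun z : \bar R => (z < +oo)%E) (ltry _) (Fc mu _)).
Qed.

Lemma real_cdf_right_continuous mu : right_continuous (real_cdf mu).
Proof.
move=> x.
have h : (real_cdf mu y)%:E @[y --> x^'+] --> (real_cdf mu x)%:E.
  rewrite -law_cdfE (_ : (fun y => _) = law_cdf mu); first exact: cdf_right_continuous.
  by apply/funext => y; rewrite law_cdfE.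
exact: (fine_cvg h).
Qed.

Lemma real_cdf_continuous mu x : mu [set x] = 0%E -> {for x, continuous (real_cdf mu)}.
Proof.
move=> mx.
pose A n := `](x - n.+1%:R^-1), x]%classic : set R.
have cA : mu (A n) @[n --> \oo] --> (0%:E : \bar R).
  rewrite [X in _ --> X](_ : _ = mu [set x]); last by rewrite mx.
  rewrite (_ : [set x] = \bigcap_n A n).
    apply: nonincreasing_cvg_mu => //.
    - have mA0 : measurable (A 0%N) by exact: measurable_itv.
      exact: (le_lt_trans (probability_le1 mu mA0) (ltry _)).
    - by move=> n; exact: measurable_itv.
    - by apply: bigcap_measurable => // n _; exact: measurable_itv.
    - apply/nonincreasing_seqP => n; apply/subsetPset => y; rewrite /A /= !in_itv /= => /andP[h ->].
      rewrite andbT; apply: le_lt_trans h; rewrite lerD2l lerN2 lef_pV2 ?posrE //.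
      by rewrite ler_nat.
  apply/seteqP; split=> y /=.
    by move=> -> n _; rewrite /A /= in_itv /= lexx andbT ltrBlDr ltrDl.
  move=> h; apply/eqP; rewrite eq_le; apply/andP; split.
    by have := h 0%N I; rewrite /A /= in_itv /= => /andP[].
  apply/ler_addgt0Pl => e e0.
  have := h (Num.truncn e^-1) I; rewrite /A /= in_itv /= => /andP[hy _].
  have : (Num.truncn e^-1).+1%:R^-1 < e.
    by rewrite invf_plt ?posrE // truncnS_gt.
  by move=> he; rewrite -lerBlDl; apply: le_trans (ltW hy); rewrite lerD2l lerN2 ltW.
have {}cA : fine (mu (A n)) @[n --> \oo] --> (0 : R) by exact: (fine_cvg cA).
apply/cvgrPdist_lt => e e0.
have /cvgrPdist_lt /(_ _ e0) := @real_cdf_right_continuous mu x.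
rewrite /at_right near_withinE => hr.
have /cvgrPdist_lt /(_ _ e0) [n _ /(_ n (leqnn n))] := cA.
rewrite sub0r normrN ger0_norm ?fine_ge0 // => hn.
near=> y.
case: (ltgtP x y) => [xy|yx|->]; last by rewrite subrr normr0.
  by move: xy; near: y; exact: hr.
have yn : x - n.+1%:R^-1 < y.
  by near: y; apply: lt_nbhsr; rewrite ltrBlDr ltrDl.
rewrite ger0_norm ?subr_ge0 ?real_cdf_nondecreasing ?(ltW yx) //.
apply: le_lt_trans hn; rewrite lerBlDl.
rewrite -lee_fin EFinD !EFin_real_cdf fineK ?fin_num_measure //; last exact: measurable_itv.
have mI (i : interval R) : measurable [set` i] by exact: measurable_itv.
apply: le_trans (measureU2 mu (mI `]-oo, y]) (mI `](x - n.+1%:R^-1), x])).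
apply: le_measure; rewrite ?inE; [exact: mI|by apply: measurableU; exact: mI|].
move=> z /=; rewrite !in_itv /= => zx; case: (leP z y) => zy; [by left|right].
by rewrite zx (lt_trans yn zy).
Unshelve. all: by end_near.
Qed.

(** The two laws have countably many atoms, and an interval of positive length is not countable. *)
Lemma continuity_points_dense mu nu (x y : R) : x < y ->
  exists z, [/\ x < z, z < y, {for z, continuous (real_cdf mu)} &
                {for z, continuous (real_cdf nu)}].
Proof.
move=> xy.
pose D m := [set r | 0 < pmf (@id_rv R : {RV m >-> R}) r].
have cD : countable (D mu `|` D nu).
  rewrite -bigcup2E; apply: bigcup_countable => // -[|[|i]] _ /=; [exact: pmf_gt0_countable..|exact: countable0].
have [z [zxy nz]] : exists z, `]x, y[%classic z /\ ~ (D mu `|` D nu) z.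
  apply: contrapT => H.
  have sub : `]x, y[%classic `<=` (D mu `|` D nu).
    by move=> z zxy; apply: contrapT => nz; apply: H; exists z.
  have := sub_countable (subset_card_le sub) cD.
  move/countable_lebesgue_measure0; rewrite lebesgue_measure_itv /= lte_fin xy.
  by rewrite -EFinB => /eqP; rewrite eqe subr_eq0 gt_eqF.
move: zxy; rewrite /= in_itv /= => /andP[xz zy].
have D0 m : ~ D m z -> m [set z] = 0%E.
  move=> /negP; rewrite /D /= -leNgt /pmf => h.
  have fz : (m [set z]) \is a fin_num by rewrite fin_num_measure.
  apply/eqP; rewrite eq_le measure_ge0 andbT -(fineK fz) lee_fin; exact: h.
exists z; split=> //; apply: real_cdf_continuous; apply: D0 => h; apply: nz; by [left|right].
Qed.

Lemma cvg_real_cdf (mu_ : nat -> probability R R) nu x : cvg_in_law mu_ nu ->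
  {for x, continuous (real_cdf nu)} -> real_cdf (mu_ n) x @[n --> \oo] --> real_cdf nu x.
Proof.
move=> cv cx.
have h : (real_cdf (mu_ n) x)%:E @[n --> \oo] --> (real_cdf nu x)%:E.
  rewrite -law_cdfE (_ : (fun n => _) = fun n => law_cdf (mu_ n) x); last first.
    by apply/funext => n; rewrite law_cdfE.
  apply: cv; rewrite (_ : law_cdf nu = fun y => (real_cdf nu y)%:E); last first.
    by apply/funext => y; exact: law_cdfE.
  by apply: cvg_EFin; first exact: nearW.
exact: (fine_cvg h).
Qed.

(** The limits agree at their common continuity points, which are dense; right continuity does the
    rest. *)
Lemma cvg_in_law_unique (mu_ : nat -> probability R R) nu nu' :
  cvg_in_law mu_ nu -> cvg_in_law mu_ nu' -> same_law nu nu'.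
Proof.
move=> c1 c2.
have le_cdf m m' : cvg_in_law mu_ m -> cvg_in_law mu_ m' ->
    forall x, real_cdf m x <= real_cdf m' x.
  move=> d1 d2 x; apply/ler_addgt0Pl => e e0.
  have /cvgrPdist_lt /(_ _ e0) := @real_cdf_right_continuous m' x.
  rewrite /at_right near_withinE => /nbhs_ballP [d /= d0 hd].
  have xd : x < x + d by rewrite ltrDl.
  have [z [xz zd z1 z2]] := continuity_points_dense m m' xd.
  apply: le_trans (_ : real_cdf m z <= _); first by apply: real_cdf_nondecreasing; exact: ltW.
  rewrite -(cvg_unique _ (cvg_real_cdf d2 z2) (cvg_real_cdf d1 z1)) //.
  have := hd z _ xz; rewrite /ball /= distrC => h.
  have : `|real_cdf m' z - real_cdf m' x| < e.
    by rewrite distrC; apply: hd => //; rewrite /ball /= distrC ger0_norm ?subr_ge0 ?(ltW xz) // ltrBlDl.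
  by move=> /(le_lt_trans (ler_norm _)); lra.
by apply: same_law_real_cdf => x; apply/eqP; rewrite eq_le !le_cdf.
Qed.

End Uniqueness.

(** * The limit laws *)

Section LimitLaws.
Variable R : realType.
Implicit Types mu nu : probability R R.

Definition sinc (x : R) : R := if x == 0 then 1 else sin x / x.

Lemma sinc0 : sinc 0 = 1. Proof. by rewrite /sinc eqxx. Qed.

Lemma sincM x : x * sinc x = sin x.
Proof. by rewrite /sinc; case: eqVneq => [->|x0]; [rewrite mul0r sin0|rewrite mulrC divfK]. Qed.

Lemma phase_integral_distribution d (T : measurableType d) (P : probability T R)
    (X : {RV P >-> R}) t a :
  phase_integral (distribution P X) t a = \int[P]_x cos (t * X x + a).
Proof.
have mc := measurable_cos_affineR t a.
rewrite /phase_integral /Rintegral integral_distribution //.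
- exact/measurable_EFinP.
- apply: (@integrable_bounded _ _ _ P (fun x => cos (t * X x + a)) 1).
    exact: (measurableT_comp mc).
  by move=> x; exact: cos_max.
Qed.

Lemma phase_std_normal t a :
  phase_integral (std_normal_law R) t a = cos a * expR (- t ^+ 2 / 2).
Proof. by rewrite phase_integral_distribution -gauss_phase. Qed.

Local Notation U := (uniform01_law R).
Local Notation leb := (@lebesgue_measure R).

Lemma ge0_integral_uniform01 (f : R -> \bar R) : measurable_fun setT f -> (forall x, 0 <= f x)%E ->
  (\int[U]_x f x = \int[leb]_(x in `[0%R, 1%R]) f x)%E.
Proof.
move=> mf f0; rewrite ge0_integral_distribution // integral_uniform //.
by rewrite subr0 invr1 mul1e.
Qed.

Lemma uniform01_FTC (f F : R -> R) : (forall x, 0 <= f x) -> continuous f ->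
  (forall x : R, is_derive x 1 F (f x)) -> (\int[U]_x (f x)%:E = (F 1 - F 0)%:E)%E.
Proof.
move=> f0 cf dF.
rewrite ge0_integral_uniform01; last 2 first.
- by apply/measurable_EFinP; exact: continuous_measurable_fun.
- by move=> x; rewrite lee_fin.
have cF : continuous F.
  by move=> z; apply: differentiable_continuous; apply/derivable1_diffP; have h := dF z; exact: ex_derive.
rewrite EFinB; apply: continuous_FTC2 => //.
- exact: continuous_subspaceT.
- split.
  + by move=> z _; have h := dF z; exact: ex_derive.
  + by apply: cvg_at_right_filter; exact: cF.
  + by apply: cvg_at_left_filter; exact: cF.
- by move=> z _; rewrite derive1E; have h := dF z; exact: derive_val.
Qed.

Lemma continuous_cos_affine t a : continuous (fun x : R => cos (t * x + a)).
Proof.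
move=> z; apply: continuous_comp; last exact: continuous_cos.
by apply: cvgD; [apply: cvgM; [exact: cvg_cst|exact: cvg_id]|exact: cvg_cst].
Qed.

Lemma phase_uniform01 t a : phase_integral U t a = sinc (t / 2) * cos (a + t / 2).
Proof.
have [->|t0] := eqVneq t 0.
  rewrite mul0r sinc0 mul1r addr0 /phase_integral.
  under eq_Rintegral do rewrite mul0r add0r.
  exact: (Rintegral_prob_cst U).
pose F (x : R) : R := x + t^-1 * sin (t * x + a).
have dF (x : R) : is_derive x 1 F (1 + cos (t * x + a)).
  apply: is_derive_eq; rewrite /GRing.scale /=; field; exact: t0.
(* The added 1 makes the integrand nonnegative, as [uniform01_FTC] asks; it is subtracted again
   below. *)
have h : (\int[U]_x (1 + cos (t * x + a))%:E = (F 1 - F 0)%:E)%E.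
  have h0 (x : R) : 0 <= 1 + cos (t * x + a) by rewrite -lerBlDl sub0r cos_geN1.
  apply: (uniform01_FTC h0) dF => x.
  by apply: cvgD; [exact: cvg_cst|exact: continuous_cos_affine].
have {}h : \int[U]_x (1 + cos (t * x + a)) = F 1 - F 0 by rewrite /Rintegral h.
have ic : U.-integrable setT (EFin \o (fun x => cos (t * x + a))).
  apply: (@integrable_bounded _ _ _ U _ 1); first exact: measurable_cos_affineR.
  by move=> x; exact: cos_max.
rewrite RintegralD // in h; last exact: finite_measure_integrable_cst.
rewrite (Rintegral_prob_cst U) in h.
have -> : phase_integral U t a = F 1 - F 0 - 1 by rewrite -h /phase_integral /= addrC addKr.
rewrite /F mulr1 mulr0 !add0r /sinc mulf_eq0 (negPf t0) invr_eq0 pnatr_eq0 /=.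
rewrite (_ : t + a = (a + t / 2) + t / 2); last by field.
have -> : sin a = sin ((a + t / 2) - t / 2) by rewrite addrK.
by rewrite [sin (_ + t / 2 + _)]sinD sinB; field.
Qed.

Lemma Rintegral_irwin_hallS M (f : R -> R) (c : R) : measurable_fun setT f -> (forall x, `|f x| <= c) ->
  \int[irwin_hall R M.+1]_x f x = \int[irwin_hall R M]_x \int[U]_y f (x + y).
Proof.
move=> mf fc.
have mfs : measurable_fun setT (f \o (@Defs.add_pair R)) by exact: (measurableT_comp mf (@Defs.measurable_add_pair R)).
rewrite -(@Rintegral_prod _ _ _ _ _ (irwin_hall R M) U (f \o (@Defs.add_pair R)) c) //.
rewrite /Rintegral /= integral_distribution //; first exact/measurable_EFinP.
by apply: (@integrable_bounded _ _ _ (irwin_hall R M \x U)%E (f \o (@Defs.add_pair R)) c) => // z; exact: fc.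
by move=> z; exact: fc.
Qed.

Lemma phase_irwin_hall M t a :
  phase_integral (irwin_hall R M) t a = sinc (t / 2) ^+ M * cos (a + M%:R * (t / 2)).
Proof.
elim: M a => [|M IH] a.
  rewrite expr0 mul1r mul0r addr0 /phase_integral /Rintegral integral_dirac //.
    by rewrite diracT mul1e mulr0 add0r.
  by apply/measurable_EFinP; exact: measurable_cos_affineR.
rewrite {1}/phase_integral (@Rintegral_irwin_hallS _ _ 1); last 2 first.
- exact: measurable_cos_affineR.
- by move=> x; exact: cos_max.
transitivity (\int[irwin_hall R M]_x (sinc (t / 2) * cos (t * x + (a + t / 2)))).
  apply: eq_Rintegral => x _; rewrite addrA -phase_uniform01; apply: eq_Rintegral => y _.
  by congr cos; ring.
rewrite RintegralZl //; last first.
  apply: (@integrable_bounded _ _ _ (irwin_hall R M) _ 1); first exact: measurable_cos_affineR.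
  by move=> x; exact: cos_max.
rewrite -/(phase_integral (irwin_hall R M) t (a + t / 2)) IH exprS -mulrA; congr (_ * (_ * cos _)).
by rewrite -[M.+1%:R]natr1; ring.
Qed.

Lemma ge0_integral_irwin_hallS M (f : R -> \bar R) : measurable_fun setT f -> (forall x, 0 <= f x)%E ->
  (\int[irwin_hall R M.+1]_x f x = \int[irwin_hall R M]_x \int[U]_y f (x + y)%R)%E.
Proof.
move=> mf f0.
have mfs : measurable_fun setT (f \o (@Defs.add_pair R)) by exact: (measurableT_comp mf (@Defs.measurable_add_pair R)).
rewrite /= ge0_integral_distribution // (@fubini_tonelli1 _ _ _ _ _ (irwin_hall R M) U (f \o (@Defs.add_pair R))) //.
by move=> x; exact: f0.
Qed.

Lemma irwin_hall_atomless M x : irwin_hall R M.+1 [set x] = 0%E.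
Proof.
have mx : measurable [set x] by [].
rewrite -(setIT [set x]) -integral_indic // ge0_integral_irwin_hallS //.
- rewrite integral0_eq // => y _.
  transitivity (\int[U]_z (\1_[set (x - y)%R] z)%:E)%E.
    apply: eq_integral => z _; rewrite !indicE; congr ((nat_of_bool _)%:R%:E); apply/idP/idP; rewrite !inE.
    by move=> <-; rewrite addrAC subrr add0r.
    by move=> ->; rewrite addrC subrK.
  rewrite integral_indic // setIT.
  apply: (@dominates_uniform_prob R 0 1 (@ltr01 R) [set x - y]) => // B mB sB.
  apply/eqP; rewrite eq_le measure_ge0 andbT -(lebesgue_measure_set1 (x - y)).
  by apply: le_measure; rewrite ?inE.
- by apply/measurable_EFinP; exact: measurable_indic.
Qed.

(** With an arbitrary centre the induction closes: one more uniform variable shifts the centre by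
    1/2 and adds 1/12. *)
Lemma irwin_hall_moment2 M c :
  (\int[irwin_hall R M]_x ((x - c) ^+ 2)%:E = ((M%:R / 2 - c) ^+ 2 + M%:R / 12)%:E)%E.
Proof.
have msq (b : R) : measurable_fun setT (fun x : R => ((x - b) ^+ 2)%:E).
  by apply/measurable_EFinP; apply: measurable_funX; apply: measurable_funB.
elim: M c => [|M IH] c.
  by rewrite integral_dirac // diracT mul1e !mul0r addr0.
rewrite ge0_integral_irwin_hallS //; last by move=> x; rewrite lee_fin sqr_ge0.
transitivity (\int[irwin_hall R M]_x (((x - (c - 1 / 2)) ^+ 2)%:E + (1 / 12 : R)%:E))%E.
  apply: eq_integral => x _.
  have dF (y : R) : is_derive y 1 (fun y : R => (x + y - c) ^+ 3 / 3) ((x + y - c) ^+ 2).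
    by apply: is_derive_eq; rewrite /GRing.scale /=; field.
  have s0 (y : R) : 0 <= (x + y - c) ^+ 2 by exact: sqr_ge0.
  rewrite (uniform01_FTC s0 _ dF).
  - by rewrite -EFinD; congr EFin; field.
  - move=> y; apply: (@continuous_comp _ _ _ (fun y => x + y - c) (fun z => z ^+ 2)); last exact: exprn_continuous.
    by apply: cvgB; [apply: cvgD; [exact: cvg_cst|exact: cvg_id]|exact: cvg_cst].
rewrite ge0_integralD //; last by move=> x _; rewrite lee_fin sqr_ge0.
rewrite IH integral_prob_cst.
by rewrite -EFinD -[M.+1%:R]natr1; congr EFin; field.
Qed.

(** The squares about 0 and about 1 differ by [2 * X - 1], whose integral gives the mean; the centre
    [m] then gives the variance. *)
Lemma moments_of_quadratic (d : measure_display) (T : measurableType d) (P : probability T R) (X : {RV P >-> R}) m v :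
  (forall c, \int[P]_x ((X x - c) ^+ 2)%:E = ((m - c) ^+ 2 + v)%:E)%E ->
  ('E_P[X] = m%:E /\ 'V_P[X] = v%:E)%E.
Proof.
move=> H.
have mX : measurable_fun setT X by [].
have iX2 c : P.-integrable setT (fun x => ((X x - c) ^+ 2)%:E).
  apply/integrableP; split.
    by apply/measurable_EFinP; apply: measurable_funX; apply: measurable_funB.
  by under eq_integral do rewrite /= ger0_norm ?sqr_ge0 //; rewrite H ltry.
have iX : P.-integrable setT (EFin \o X).
  apply: (@le_integrable _ _ _ P setT _ _ (fun x => ((X x - 0) ^+ 2 + 1)%:E)) => //.
  - exact/measurable_EFinP.
  - move=> x _ /=; rewrite lee_fin subr0 (ger0_norm (_ : 0 <= _ + _)); last by rewrite addr_ge0 ?sqr_ge0.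
    by rewrite -(real_normK (num_real (X x))); have := sqr_ge0 (`|X x| - 1); nra.
  - under eq_fun do rewrite EFinD; apply: integrableD => //.
    exact: finite_measure_integrable_cst.
have E : ('E_P[X] = m%:E)%E.
  rewrite expectation_def -EFin_Rintegral //; congr EFin.
  have h : \int[P]_x ((X x - 0) ^+ 2 - (X x - 1) ^+ 2) = m ^+ 2 - (m - 1) ^+ 2.
    have H2 c : \int[P]_x ((X x - c) ^+ 2) = (m - c) ^+ 2 + v by rewrite /Rintegral H.
    by rewrite (RintegralB measurableT (iX2 0) (iX2 1)) !H2; ring.
  have h2 : \int[P]_x ((X x - 0) ^+ 2 - (X x - 1) ^+ 2) = 2 * \int[P]_x X x - 1.
    transitivity (\int[P]_x (2 * X x - 1)); first by apply: eq_Rintegral => x _; ring.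
    rewrite RintegralB //; last 2 first.
    + by rewrite /comp; under eq_fun do rewrite EFinM; exact: integrableZl.
    + exact: finite_measure_integrable_cst.
    by rewrite RintegralZl // (Rintegral_prob_cst P).
  rewrite h in h2; lra.
split=> //.
have Hm : (\int[P]_x ((X x - m) ^+ 2)%:E = v%:E)%E by rewrite H subrr expr0n add0r.
rewrite /variance unlock /= E /= expectation_def -Hm.
by apply: eq_integral => x _ /=; rewrite expr2.
Qed.

Lemma phase_normalized_law (d : measure_display) (T : measurableType d) (P : probability T R) (X : {RV P >-> R}) t a :
  phase_integral (normalized_law X) t a =
  \int[P]_x cos (t / Num.sqrt (fine 'V_P[X]) * X x + (a - t / Num.sqrt (fine 'V_P[X]) * fine 'E_P[X])).
Proof.
rewrite /normalized_law phase_integral_distribution; apply: eq_Rintegral => x _.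
have E (e s : R) : t * ((X x - e) / s) + a = t / s * X x + (a - t / s * e) by ring.
exact: (congr1 cos (E _ _)).
Qed.

Definition irwin_hall_sd M : R := Num.sqrt (M%:R / 12).

Lemma phase_irwin_hall_star M t a :
  phase_integral (irwin_hall_star R M) t a = cos a * sinc (t / irwin_hall_sd M / 2) ^+ M.
Proof.
have [E V] := @moments_of_quadratic _ _ (irwin_hall R M) (@id_rv R) _ _ (irwin_hall_moment2 M).
rewrite /irwin_hall_star phase_normalized_law E V /= -/(irwin_hall_sd M).
rewrite -/(phase_integral (irwin_hall R M) _ _) phase_irwin_hall mulrC; congr (cos _ * _).
by ring.
Qed.

Lemma irwin_hall_star_atomless M x : irwin_hall_star R M.+1 [set x] = 0%E.
Proof.
have [E V] := @moments_of_quadratic _ _ (irwin_hall R M.+1) (@id_rv R) _ _ (irwin_hall_moment2 M.+1).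
have s0 : irwin_hall_sd M.+1 != 0 by rewrite gt_eqF // sqrtr_gt0 divr_gt0.
rewrite /irwin_hall_star /normalized_law /distribution /pushforward.
change (irwin_hall R M.+1 (normalized (@id_rv R : {RV irwin_hall R M.+1 >-> R}) @^-1` [set x]) = 0%E).
rewrite (_ : _ @^-1` _ = [set x * irwin_hall_sd M.+1 + M.+1%:R / 2]) ?irwin_hall_atomless //.
apply/seteqP; rewrite /normalized E V /= -/(irwin_hall_sd M.+1); split=> y /=.
  by move=> <-; rewrite divfK // subrK.
by move=> ->; rewrite addrK mulfK.
Qed.

Lemma std_normal_atomless x : std_normal_law R [set x] = 0%E.
Proof.
have := @normal_prob_dominates R 0 1 => /(_ [set x]).
apply => //; move=> B mB sB.
apply/eqP; rewrite eq_le measure_ge0 andbT -(lebesgue_measure_set1 x).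
by apply: le_measure; rewrite ?inE.
Qed.

Lemma same_law_phase mu nu t a : same_law mu nu -> phase_integral mu t a = phase_integral nu t a.
Proof.
move=> h; rewrite /phase_integral /Rintegral; congr fine.
by apply: eq_measure_integral => A mA _; exact: h.
Qed.

Lemma sinc_pi : sinc pi = 0.
Proof. by rewrite /sinc gt_eqF ?pi_gt0 // sinpi mul0r. Qed.

Lemma sinc_eq0_lt (x : R) : 0 < x < pi -> sinc x != 0.
Proof.
move=> /andP[x0 xp]; rewrite /sinc (gt_eqF x0); apply: mulf_neq0; last by rewrite invr_eq0 gt_eqF.
by rewrite gt_eqF //; apply: sin_gt0_pi; rewrite x0 xp.
Qed.

Lemma irwin_hall_sd_gt0 M : 0 < irwin_hall_sd M.+1.
Proof. by rewrite sqrtr_gt0 divr_gt0. Qed.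

(** For [M > 0] the Irwin-Hall characteristic function vanishes at [2 * pi * irwin_hall_sd M], and
    the Gaussian one vanishes nowhere; for [M = 0] the former is constantly 1. *)
Lemma irwin_hall_star_neq_normal M : ~ same_law (irwin_hall_star R M) (std_normal_law R).
Proof.
case: M => [|M] h.
  have := same_law_phase 1 0 h; rewrite phase_irwin_hall_star phase_std_normal cos0 !mul1r expr0.
  by move=> /esym/eqP; rewrite lt_eqF // expR_lt1 expr1n; lra.
have := same_law_phase (2 * pi * irwin_hall_sd M.+1) 0 h.
rewrite phase_irwin_hall_star phase_std_normal cos0 !mul1r mulfK ?gt_eqF ?irwin_hall_sd_gt0 //.
rewrite mulrAC mulfV ?pnatr_eq0 // mul1r sinc_pi expr0n /=.
by move=> /eqP; rewrite lt_eqF // expR_gt0.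
Qed.

(** The first positive zero [2 * pi * irwin_hall_sd M] moves to the right as [M] grows, so the zero
    of the smaller index is not a zero of the larger; index 0 has no zero at all. *)
Lemma irwin_hall_star_lt M M' : (M < M')%N -> ~ same_law (irwin_hall_star R M) (irwin_hall_star R M').
Proof.
case: M' => // M' MM' h; case: M MM' h => [|M] MM' h.
  have := same_law_phase (2 * pi * irwin_hall_sd M'.+1) 0 h.
  rewrite !phase_irwin_hall_star cos0 !mul1r mulfK ?gt_eqF ?irwin_hall_sd_gt0 //.
  rewrite [2 * pi]mulrC mulfK ?pnatr_eq0 // sinc_pi expr0 expr0n /= => /eqP.
  by rewrite oner_eq0.
have := same_law_phase (2 * pi * irwin_hall_sd M.+1) 0 h.
rewrite !phase_irwin_hall_star cos0 !mul1r mulfK ?gt_eqF ?irwin_hall_sd_gt0 //.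
rewrite [2 * pi]mulrC mulfK ?pnatr_eq0 // sinc_pi expr0n /= => /esym/eqP.
rewrite expf_eq0 /= => /eqP; apply/eqP/sinc_eq0_lt.
rewrite (_ : _ / 2 = pi * (irwin_hall_sd M.+1 / irwin_hall_sd M'.+1)); last first.
  by field; rewrite gt_eqF ?irwin_hall_sd_gt0.
rewrite mulr_gt0 ?pi_gt0 ?divr_gt0 ?irwin_hall_sd_gt0 //= gtr_pMr ?pi_gt0 //.
rewrite ltr_pdivrMr ?irwin_hall_sd_gt0 // mul1r ltr_sqrt ?divr_gt0 //.
by rewrite ltr_pM2r ?invr_gt0 // ltr_nat.
Qed.

End LimitLaws.

(** * The law of the major index *)

Section CoefficientFunctionals.
Variable R : realType.
Implicit Types (p q : {poly R}) (f g : nat -> R).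

(** Up to normalization, the expectation of [f] when the coefficients of [p] serve as weights. *)
Definition pairing f p : R := \sum_(i < size p) p`_i * f i.

Lemma pairing_wide f p n : (size p <= n)%N -> pairing f p = \sum_(i < n) p`_i * f i.
Proof.
move=> pn; rewrite /pairing (big_ord_widen _ (fun i => p`_i * f i) pn) big_mkcond.
by apply: eq_bigr => i _; case: ltnP => // /(nth_default 0) ->; rewrite mul0r.
Qed.

Lemma pairingD f p q : pairing f (p + q) = pairing f p + pairing f q.
Proof.
pose n := maxn (size p) (size q).
rewrite !(@pairing_wide f _ n) ?leq_maxl ?leq_maxr ?size_polyD // -big_split.
by apply: eq_bigr => i _; rewrite coefD mulrDl.
Qed.

Lemma pairing0 f : pairing f 0 = 0.
Proof. by rewrite /pairing size_poly0 big_ord0. Qed.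

Lemma pairing_sum (I : Type) (r : seq I) (F : I -> {poly R}) f :
  pairing f (\sum_(i <- r) F i) = \sum_(i <- r) pairing f (F i).
Proof. by apply: (big_morph (pairing f)); [exact: pairingD|exact: pairing0]. Qed.

Lemma pairingMXn f p k : pairing f (p * 'X^k) = pairing (fun i => f (i + k)%N) p.
Proof.
rewrite (@pairing_wide f _ (k + size p)); last first.
  by rewrite (leq_trans (size_polyMleq _ _)) // size_polyXn addnS /= addnC.
rewrite big_split_ord /= big1 ?add0r => [|i _]; last by rewrite coefMXn ltn_ord mul0r.
by apply: eq_bigr => i _; rewrite coefMXn ltnNge leq_addr /= addKn addnC.
Qed.

Lemma pairingXn f k : pairing f 'X^k = f k.
Proof. by rewrite -['X^k]mul1r pairingMXn /pairing size_poly1 big_ord1 coef1 mul1r. Qed.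

Lemma pairing_qnum f p j :
  pairing f (p * qnum R j) = pairing (fun k => \sum_(i < j) f (k + i)%N) p.
Proof.
rewrite /qnum mulr_sumr pairing_sum; under eq_bigr do rewrite pairingMXn.
by rewrite exchange_big; apply: eq_bigr => k _; rewrite mulr_sumr.
Qed.

Lemma eq_pairing f g p : f =1 g -> pairing f p = pairing g p.
Proof. by move=> fg; apply: eq_bigr => i _; rewrite fg. Qed.

Lemma pairingZ c f p : pairing (fun k => c * f k) p = c * pairing f p.
Proof. by rewrite /pairing mulr_sumr; apply: eq_bigr => i _; rewrite mulrCA. Qed.

Lemma pairing_add f g p : pairing (fun k => f k + g k) p = pairing f p + pairing g p.
Proof. by rewrite /pairing -big_split; apply: eq_bigr => i _; rewrite mulrDr. Qed.

(* [p] behaves as [s] times a distribution of mean [m] and variance [v]. *)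
Definition has_moments p (s m v : R) :=
  forall c, pairing (fun k => (k%:R - c) ^+ 2) p = s * ((m - c) ^+ 2 + v).

Lemma has_moments_exist p : pairing (fun=> 1) p != 0 ->
  exists m v, has_moments p (pairing (fun=> 1) p) m v.
Proof.
set s := pairing _ p => s0; pose m1 := pairing (fun k => k%:R) p.
pose m2 := pairing (fun k => k%:R ^+ 2) p.
exists (m1 / s), (m2 / s - (m1 / s) ^+ 2) => c.
transitivity (m2 + ((- (2 * c)) * m1 + c ^+ 2 * s)); last by field.
rewrite -!pairingZ -!pairing_add; apply: eq_pairing => k; ring.
Qed.

(** Multiplying by [[j]_X] adds an independent uniform variable on [0, ..., j - 1], of mean
    [(j - 1) / 2] and variance [(j ^ 2 - 1) / 12]. *)
Lemma has_moments_qnum p s m v j : has_moments p s m v -> (0 < j)%N ->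
  has_moments (p * qnum R j) (s * j%:R) (m + (j%:R - 1) / 2) (v + (j%:R ^+ 2 - 1) / 12).
Proof.
move=> h j0 c; rewrite pairing_qnum.
transitivity (\sum_(i < j) pairing (fun k => (k%:R - (c - i%:R)) ^+ 2) p).
  rewrite exchange_big; apply: eq_bigr => k _; rewrite mulr_sumr; apply: eq_bigr => i _.
  by congr (_ * _ ^+ 2); rewrite natrD; ring.
under eq_bigr do rewrite h.
case: j j0 => // j _; elim: j => [|j IH]; first by rewrite big_ord1 subr0; field.
by rewrite big_ord_recr IH /= -!natr1; field.
Qed.

Lemma has_moments_prod p s m v (B : seq nat) : has_moments p s m v -> all (fun b => 0 < b)%N B ->
  has_moments (p * \prod_(b <- B) qnum R b) (s * \prod_(b <- B) b%:R)
    (m + \sum_(b <- B) (b%:R - 1) / 2) (v + \sum_(b <- B) (b%:R ^+ 2 - 1) / 12).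
Proof.
elim: B p s m v => [|b B IH] p s m v h; first by rewrite !big_nil !mulr1 !addr0.
move=> /= /andP[b0 B0]; rewrite !big_cons !mulrA !addrA.
by apply: IH => //; exact: has_moments_qnum.
Qed.

Lemma has_moments_inj p s m v s' m' v' : has_moments p s m v -> has_moments p s' m' v' -> s != 0 ->
  [/\ s = s', m = m' & v = v'].
Proof.
move=> h h' s0.
have e c : s * ((m - c) ^+ 2 + v) = s' * ((m' - c) ^+ 2 + v') by rewrite -h -h'.
have e0 := e 0; have e1 := e 1; have eN := e (- 1).
have ss : s = s' by move: e0 e1 eN; lra.
have mm : s * m = s * m' by move: e0 e1 eN; rewrite -ss; lra.
have {}mm : m = m' by apply: (mulfI s0).
split=> //; apply: (mulfI s0); move: e0; rewrite -ss mm; lra.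
Qed.

Lemma has_moments_Xn k : has_moments 'X^k 1 k%:R 0.
Proof. by move=> c; rewrite pairingXn mul1r addr0. Qed.

(** The Dirichlet kernel, multiplied by [sinc h] instead of divided, so that zeros of the sine need
    no care. *)
Lemma cos_sum_qnum (x h : R) j :
  sinc h * \sum_(i < j) cos (x + 2 * h * i%:R) = j%:R * sinc (j%:R * h) * cos (x + (j%:R - 1) * h).
Proof.
have [->|h0] := eqVneq h 0.
  rewrite !mulr0 addr0 sinc0 !mul1r; under eq_bigr do rewrite mul0r addr0.
  by rewrite big_const_ord iter_addr_0 mulr1 mulr_natl.
apply: (mulfI h0); rewrite mulrA sincM.
transitivity (sin (j%:R * h) * cos (x + (j%:R - 1) * h)); last by rewrite -sincM; ring.
elim: j => [|j IH]; first by rewrite big_ord0 mulr0 mul0r sin0 mul0r.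
rewrite big_ord_recr mulrDr IH /=; set y := j%:R * h; set z := x + y.
have -> : x + (j%:R - 1) * h = z - h by rewrite /z /y; ring.
have -> : x + (j.+1%:R - 1) * h = z by rewrite /z /y -natr1; ring.
have -> : x + 2 * h * j%:R = z + y by rewrite /z /y; ring.
have -> : j.+1%:R * h = y + h by rewrite /y -natr1; ring.
have E (u w : R) : sin u * cos (w - h) + sin h * cos (w + u) = sin (u + h) * cos w.
  by rewrite cosB cosD sinD; ring.
exact: E.
Qed.

Lemma phase_prod p (h a : R) (B : seq nat) :
  sinc h ^+ size B * pairing (fun k => cos (2 * h * k%:R + a)) (p * \prod_(b <- B) qnum R b) =
  \prod_(b <- B) (b%:R * sinc (b%:R * h)) *
    pairing (fun k => cos (2 * h * k%:R + (a + \sum_(b <- B) (b%:R - 1) * h))) p.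
Proof.
elim: B p a => [|b B IH] p a; first by rewrite !big_nil !mul1r mulr1 addr0.
rewrite big_cons [p * _]mulrA exprS -mulrA IH mulrCA !big_cons.
set PB := \prod_(j <- B) _.
suff key : sinc h * pairing (fun k => cos (2 * h * k%:R + (a + \sum_(b <- B) (b%:R - 1) * h))) (p * qnum R b) =
    b%:R * sinc (b%:R * h) * pairing (fun k => cos (2 * h * k%:R +
       (a + ((b%:R - 1) * h + \sum_(b <- B) (b%:R - 1) * h)))) p.
  by rewrite key mulrA [PB * _]mulrC.
rewrite pairing_qnum -!pairingZ; apply: eq_pairing => k.
transitivity (sinc h * \sum_(i < b) cos ((2 * h * k%:R + (a + \sum_(b <- B) (b%:R - 1) * h)) + 2 * h * i%:R)).
  by congr (_ * _); apply: eq_bigr => i _; congr cos; rewrite natrD; ring.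
by rewrite cos_sum_qnum; congr (_ * cos _); ring.
Qed.

End CoefficientFunctionals.

Section UniformTableaux.
Variable R : realType.

Lemma integral_uniform_syt D (f : SYT D -> R) :
  (\int[uniform_syt R D]_T (f T)%:E = (#|{: SYT D}|%:R^-1 * \sum_(T : SYT D) f T)%:E)%E.
Proof.
set P := uniform_syt R D.
have mS (A : set (SYT D)) : measurable A by [].
transitivity (\int[P]_T \sum_(S : SYT D) ((f S)%:E * (\1_[set S] T)%:E))%E.
  apply: eq_integral => T _; rewrite (bigD1 T) //= indicE mem_set //= mule1 big1 ?addr0 // => S ST.
  by rewrite indicE memNset ?mule0 // => /= E; rewrite E eqxx in ST.
have iI (S : SYT D) : P.-integrable setT (fun T => (\1_[set S] T)%:E).
  by apply: integrable_bounded (_ : forall T, _ <= 1) => // T; rewrite ger0_norm // indicE; case: (_ \in _).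
rewrite integral_sum //; last by move=> S; exact: integrableZl.
rewrite mulr_sumr -sumEFin; apply: eq_bigr => S _.
rewrite integralZl // integral_indic // setIT mulrC EFinM; congr (_ * _)%E.
change (uniform_syt R D [set S] = (#|{: SYT D}|%:R^-1)%:E).
rewrite /uniform_syt /mscale /= /counting asboolT; last exact: finite_finset.
by rewrite fset_set1 finmap.cardfs1 mule1.
Qed.

Lemma card_SYT_neq0 D : #|{: SYT D}|%:R != 0 :> R.
Proof. by rewrite pnatr_eq0 -lt0n; apply/card_gt0P; exists (lex_syt D). Qed.

Lemma pairing_maj_poly D f : pairing f (maj_poly R D) = \sum_(T : SYT D) f (maj T).
Proof. by rewrite /maj_poly pairing_sum; apply: eq_bigr => T _; rewrite pairingXn. Qed.

Lemma qnum_neq0 h : (0 < h)%N -> qnum R h != 0.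
Proof.
move=> h0; apply/eqP => e; have := pairing_qnum (fun=> 1 : R) 1 h.
rewrite mul1r e pairing0 /pairing size_poly1 big_ord1 coef1 mul1r.
rewrite big_const_ord iter_addr_0 => /esym/eqP; rewrite pnatr_eq0; exact/negP/lt0n_neq0.
Qed.

Lemma maj_poly_reduced l (B C : seq nat) : perm_eq (block_hooks l ++ C) (iota 1 (block_size l) ++ B) ->
    all (fun b => 0 < b)%N B ->
  maj_poly R (skew_cells l) * \prod_(b <- B) qnum R b = 'X^(block_stat l) * \prod_(c <- C) qnum R c.
Proof.
move=> pe B0.
have h0 : \prod_(h <- block_hooks l) qnum R h != 0.
  rewrite prodf_seq_neq0; apply/allP => h hh; apply/implyP => _; apply: qnum_neq0.
  have : h \in block_hooks l ++ C by rewrite mem_cat hh.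
  rewrite (perm_mem pe) mem_cat mem_iota => /orP[/andP[]//|]; exact: (allP B0).
apply: (mulfI h0); rewrite mulrA [_ * maj_poly _ _]mulrC maj_poly_hooks [RHS]mulrCA -mulrA; congr (_ * _).
by rewrite -[RHS]big_cat (perm_big _ pe) big_cat /= /index_iota subn1.
Qed.

Lemma maj_rv_moments D : exists m v,
  [/\ has_moments (maj_poly R D) #|{: SYT D}|%:R m v,
      ('E_(uniform_syt R D)[maj_rv R D] = m%:E)%E &
      ('V_(uniform_syt R D)[maj_rv R D] = v%:E)%E].
Proof.
have s0 := card_SYT_neq0 D.
have sE : pairing (fun=> 1) (maj_poly R D) = #|{: SYT D}|%:R.
  by rewrite pairing_maj_poly sumr_const.
have [m [v]] := @has_moments_exist _ (maj_poly R D) (eq_ind_r (fun z => z != 0) s0 sE).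
rewrite sE => mom; exists m, v.
suff [] : ('E_(uniform_syt R D)[maj_rv R D] = m%:E /\ 'V_(uniform_syt R D)[maj_rv R D] = v%:E)%E by [].
apply: moments_of_quadratic => c; rewrite integral_uniform_syt.
by rewrite -(pairing_maj_poly D (fun k => (k%:R - c) ^+ 2)) mom mulKf.
Qed.

Lemma maj_star_lawE l m v (A : set R) :
  has_moments (maj_poly R (skew_cells l)) #|{: SYT (skew_cells l)}|%:R m v -> measurable A ->
  maj_star_law R l A = (#|{: SYT (skew_cells l)}|%:R^-1 *
    pairing (fun k => \1_A ((k%:R - m) / Num.sqrt v)) (maj_poly R (skew_cells l)))%:E.
Proof.
move=> mom mA; set D := skew_cells l.
have [m' [v' [mom' E V]]] := maj_rv_moments D.
have [_ mm vv] := has_moments_inj mom mom' (card_SYT_neq0 D).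
rewrite pairing_maj_poly -integral_uniform_syt mm vv.
set X := maj_rv R D : {RV uniform_syt R D >-> R}.
have mP : measurable (normalized X @^-1` A) by [].
transitivity (\int[uniform_syt R D]_T (\1_(normalized X @^-1` A) T)%:E)%E.
  by rewrite integral_indic // setIT.
apply: eq_integral => T _; rewrite !indicE; congr ((nat_of_bool _)%:R%:E).
by apply/idP/idP; rewrite !inE /= /normalized E V.
Qed.

(** The coefficients of [maj_poly] determine the number of tableaux, the mean and the variance,
    hence the normalized law. *)
Lemma same_maj_poly_law l l' : maj_poly R (skew_cells l) = maj_poly R (skew_cells l') ->
  same_law (maj_star_law R l) (maj_star_law R l').
Proof.
move=> e A mA.
have [m [v [mom E V]]] := maj_rv_moments (skew_cells l).
have c : #|{: SYT (skew_cells l)}|%:R = #|{: SYT (skew_cells l')}|%:R :> R.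
  by have := congr1 (pairing (fun=> 1)) e; rewrite !pairing_maj_poly !sumr_const.
rewrite (maj_star_lawE mom) //; rewrite c e in mom *; by rewrite (maj_star_lawE mom).
Qed.

Lemma maj_star_law_atom l : exists x, maj_star_law R l [set x] != 0%E.
Proof.
have [m [v [mom E V]]] := maj_rv_moments (skew_cells l).
exists (((maj (lex_syt (skew_cells l)))%:R - m) / Num.sqrt v).
rewrite (maj_star_lawE mom) // eqe mulf_neq0 ?invr_eq0 ?card_SYT_neq0 // pairing_maj_poly.
by rewrite gt_eqF // (bigD1 (lex_syt _)) //= indicE mem_set // ltr_pwDl // sumr_ge0 // => T _.
Qed.

Lemma maj_star_law_discrete l : discrete_law (maj_star_law R l).
Proof.
set X := maj_rv R (skew_cells l) : {RV uniform_syt R (skew_cells l) >-> R}.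
exists (range (normalized X)).
  apply: finite_set_countable; apply: finite_image; exact: finite_finset.
change (uniform_syt R (skew_cells l) (normalized X @^-1` range (normalized X)) = 1%E).
rewrite (_ : _ @^-1` _ = setT) ?probability_setT //.
by apply/seteqP; split=> // T _; exists T.
Qed.

(* The variance of maj, for the quotient of [prod_(c in C) [c]_X] by [prod_(b in B) [b]_X]. *)
Definition hook_var (B C : seq nat) : R := (\sum_(c <- C) c%:R ^+ 2 - \sum_(b <- B) b%:R ^+ 2) / 12.

(** The product over [B] stays on the left because it may vanish. Equal sizes of [B] and [C] make
    the powers of [sinc h] agree and the terms -1 of the uniform variances cancel in [hook_var]. *)
Lemma phase_maj_star l (B C : seq nat) t a : perm_eq (block_hooks l ++ C) (iota 1 (block_size l) ++ B) ->
    all (fun b => 0 < b)%N B -> all (fun b => 0 < b)%N C -> size B = size C ->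
  let h := t / Num.sqrt (hook_var B C) / 2 in
  \prod_(b <- B) sinc (b%:R * h) * phase_integral (maj_star_law R l) t a =
  cos a * \prod_(c <- C) sinc (c%:R * h).
Proof.
move=> pe B0 C0 BC.
set D := skew_cells l; set X := maj_rv R D : {RV uniform_syt R D >-> R}.
have red := maj_poly_reduced pe B0.
pose s : R := #|{: SYT D}|%:R.
have s0 : s != 0 by exact: card_SYT_neq0.
have [m [v [mom E V]]] := maj_rv_moments D.
have prod0 (A : seq nat) : all (fun b => 0 < b)%N A -> \prod_(b <- A) b%:R != 0 :> R.
  move=> A0; rewrite prodf_seq_neq0; apply/allP => b /(allP A0) b0; apply/implyP => _.
  by rewrite pnatr_eq0 -lt0n.
have momB := has_moments_prod mom B0.
have momC := has_moments_prod (@has_moments_Xn R (block_stat l)) C0.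
rewrite -red in momC; have [es em ev] := has_moments_inj momB momC (mulf_neq0 s0 (prod0 _ B0)).
have vE : v = hook_var B C.
  have : forall A : seq nat, \sum_(b <- A) (b%:R ^+ 2 - 1 : R) / 12 = (\sum_(b <- A) b%:R ^+ 2 - (size A)%:R) / 12.
    by move=> A; rewrite -mulr_suml sumrB big_const_seq count_predT iter_addr_0.
  move=> q; move: ev; rewrite !q BC /hook_var; lra.
move=> h; rewrite /maj_star_law phase_normalized_law E V /= vE.
rewrite (_ : t / Num.sqrt (hook_var B C) = 2 * h); last by rewrite [RHS]mulrC /h divfK.
rewrite /Rintegral integral_uniform_syt /= -/D -/s.
rewrite -(pairing_maj_poly D (fun k => cos (2 * h * k%:R + (a - 2 * h * m)))).
set CS := pairing _ _.
(* Chosen so that the factors of [B] carry the phase to that of the centered statistic; the equality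
   of means [em] then makes the factors of [C] carry it to [a]. *)
pose a1 := a - 2 * h * m - \sum_(b <- B) (b%:R - 1) * h.
have hB := phase_prod (maj_poly R D) h a1 B.
have hC := phase_prod 'X^(block_stat l) h a1 C.
rewrite -red -BC hB pairingXn in hC.
have e1 : a1 + \sum_(b <- B) (b%:R - 1) * h = a - 2 * h * m by rewrite /a1 subrK.
have e2 : 2 * h * (block_stat l)%:R + (a1 + \sum_(b <- C) (b%:R - 1) * h) = a.
  move: em; rewrite -!mulr_suml => em.
  rewrite /a1 -!mulr_suml; move: em; set x := \sum_(b <- B) _; set y := \sum_(b <- C) _ => em.
  have -> : m = (block_stat l)%:R + y / 2 - x / 2 by rewrite -em addrK.
  by field.
rewrite e1 e2 -/CS !big_split /= in hC.
apply: (mulfI (mulf_neq0 s0 (prod0 _ B0))).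
transitivity (\prod_(b <- B) b%:R * \prod_(b <- B) sinc (b%:R * h) * CS); first by field.
by rewrite hC es; ring.
Qed.

End UniformTableaux.

(** * Taylor bounds for sinc *)

Section SincEstimates.
Variable R : realType.
Implicit Types (x y t : R).

(** Applied repeatedly, starting from [cos x <= 1], it yields the alternating Taylor bounds up to
    degree 5. *)
Lemma nonneg_of_derive (f g : R -> R) : (forall x, is_derive x 1 f (g x)) -> f 0 = 0 ->
  (forall x, 0 <= x -> 0 <= g x) -> forall x, 0 <= x -> 0 <= f x.
Proof.
move=> df f0 g0 x x0.
have [|c cx e] := @MVT_segment R f g 0 x x0 (fun y _ => df y).
  apply: continuous_subspaceT => z; apply: differentiable_continuous; apply/derivable1_diffP.
  by have h := df z; exact: ex_derive.
have : 0 <= g c * (x - 0) by rewrite subr0 mulr_ge0 // g0 //; move: cx; rewrite in_itv /= => /andP[].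
by rewrite -e f0 subr0.
Qed.

Lemma sin_le_id x : 0 <= x -> sin x <= x.
Proof.
move=> x0; rewrite -subr_ge0; move: x x0; apply: (@nonneg_of_derive _ (fun x => 1 - cos x)).
- by rewrite sin0 subr0.
- by move=> z _; rewrite subr_ge0 cos_le1.
Qed.

Lemma cos_ge_quadratic x : 0 <= x -> 1 - x ^+ 2 / 2 <= cos x.
Proof.
move=> x0; rewrite -subr_ge0; move: x x0; apply: (@nonneg_of_derive _ (fun x => x - sin x)).
- by move=> z; apply: is_derive_eq; rewrite /GRing.scale /=; field.
- by rewrite cos0; field.
- by move=> z z0; rewrite subr_ge0 sin_le_id.
Qed.

Lemma sin_ge_cubic x : 0 <= x -> x - x ^+ 3 / 6 <= sin x.
Proof.
move=> x0; rewrite -subr_ge0; move: x x0; apply: (@nonneg_of_derive _ (fun x => cos x - (1 - x ^+ 2 / 2))).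
- by move=> z; apply: is_derive_eq; rewrite /GRing.scale /=; field.
- by rewrite sin0; field.
- by move=> z z0; rewrite subr_ge0 cos_ge_quadratic.
Qed.

Lemma cos_le_quartic x : 0 <= x -> cos x <= 1 - x ^+ 2 / 2 + x ^+ 4 / 24.
Proof.
move=> x0; rewrite -subr_ge0; move: x x0; apply: (@nonneg_of_derive _ (fun x => sin x - (x - x ^+ 3 / 6))).
- by move=> z; apply: is_derive_eq; rewrite /GRing.scale /=; field.
- by rewrite cos0; field.
- by move=> z z0; rewrite subr_ge0 sin_ge_cubic.
Qed.

Lemma sin_le_quintic x : 0 <= x -> sin x <= x - x ^+ 3 / 6 + x ^+ 5 / 120.
Proof.
move=> x0; rewrite -subr_ge0; move: x x0; apply: (@nonneg_of_derive _ (fun x => 1 - x ^+ 2 / 2 + x ^+ 4 / 24 - cos x)).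
- by move=> z; apply: is_derive_eq; rewrite /GRing.scale /=; field.
- by rewrite sin0; field.
- by move=> z z0; rewrite subr_ge0 cos_le_quartic.
Qed.

Lemma sincN x : sinc (- x) = sinc x.
Proof. by rewrite /sinc oppr_eq0 sinN invrN mulrNN. Qed.

Lemma sinc_norm x : sinc `|x| = sinc x.
Proof. by case: (ger0P x) => _ //; rewrite sincN. Qed.

Lemma sinc_bounds x : 1 - x ^+ 2 / 6 <= sinc x <= 1 - x ^+ 2 / 6 + x ^+ 4 / 120.
Proof.
wlog x0 : x / 0 < x => [H|].
  have [->|xn0] := eqVneq x 0; first by rewrite sinc0 !expr0n /= !mul0r subr0 addr0 lexx.
  by have := H `|x|; rewrite normr_gt0 sinc_norm -!normrX !ger0_norm ?sqr_ge0 ?(exprM _ 2 2) ?sqr_ge0 //; exact.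
have h1 := sin_ge_cubic (ltW x0); have h2 := sin_le_quintic (ltW x0).
have sx := sincM x.
rewrite -(ler_pM2l x0) -[X in _ && X](ler_pM2l x0) sx; apply/andP; split.
  by apply: le_trans h1; rewrite le_eqVlt; apply/orP; left; apply/eqP; field.
by apply: le_trans h2 _; rewrite le_eqVlt; apply/orP; left; apply/eqP; field.
Qed.

Lemma sinc_norm_le1 x : `|sinc x| <= 1.
Proof.
have [->|x0] := eqVneq x 0; first by rewrite sinc0 normr1.
rewrite /sinc (negPf x0) normrM normfV ler_pdivrMr ?normr_gt0 // mul1r.
wlog {x0} x0 : x / 0 <= x => [H|].
  have [/H//|/ltW xn] := lerP 0 x.
  by rewrite -(normrN (sin x)) -(normrN x) -sinN H // oppr_ge0.
have [x1|x1] := lerP x 1; last first.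
  by apply: le_trans (sin_max _) _; rewrite ger0_norm // ltW.
rewrite [`|x|]ger0_norm // ger0_norm ?sin_le_id //.
apply: sin_ge0_pi; rewrite x0 /=; apply: (le_trans x1).
by apply: le_trans (pi_ge2 R); lra.
Qed.

(** In exponential form the bounds for many factors add up in the exponent; 1/18 leaves room for the
    quartic error on [[-1, 1]]. *)
Lemma sinc_expR x : x ^+ 2 <= 1 ->
  expR (- x ^+ 2 / 6 - x ^+ 4 / 18) <= sinc x <= expR (- x ^+ 2 / 6 + x ^+ 4 / 18).
Proof.
move=> x1; have /andP[lo hi] := sinc_bounds x.
rewrite (_ : x ^+ 4 = (x ^+ 2) ^+ 2) in hi *; last by rewrite -exprM.
set y := x ^+ 2 in x1 lo hi *; have y0 : 0 <= y by exact: sqr_ge0.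
have yy : 0 <= y ^+ 2 by exact: sqr_ge0.
apply/andP; split.
  apply: le_trans lo; rewrite (_ : _ - _ = - (y / 6 + y ^+ 2 / 18)); last by ring.
  rewrite expRN -(ler_pM2r (expR_gt0 (y / 6 + y ^+ 2 / 18))) mulVf ?gt_eqF ?expR_gt0 //.
  have := expR_ge1Dx (y / 6 + y ^+ 2 / 18); set E := expR _ => hE.
  have h1 : 0 <= 1 - y / 6 by lra.
  have := ler_wpM2l h1 hE; apply: le_trans.
  have : 0 <= y ^+ 2 * (1 - y) by rewrite mulr_ge0 // subr_ge0.
  by rewrite (_ : (1 - y / 6) * _ = 1 + y ^+ 2 / 36 + y ^+ 2 * (1 - y) / 108 - y ^+ 2 / 108); [lra|field].
apply: le_trans hi _; apply: le_trans (expR_ge1Dx _); lra.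
Qed.

Lemma continuous_sinc : continuous (@sinc R).
Proof.
move=> x; have [->|x0] := eqVneq x 0.
  rewrite /continuous_at sinc0.
  apply: (@squeeze_cvgr _ _ _ _ (fun x => 1 - x ^+ 2 / 6) (fun=> 1)).
  - apply: nearW => y; have /andP[-> _] := sinc_bounds y.
    by have := sinc_norm_le1 y; rewrite ler_norml => /andP[].
  - rewrite -[X in _ --> X](_ : 1 - (0 : R) ^+ 2 / 6 = 1); last by rewrite expr0n mul0r subr0.
    apply: cvgB; first exact: cvg_cst.
    by apply: cvgMl; exact: exprn_continuous.
  - exact: cvg_cst.
have e : \forall y \near x, sin y / y = sinc y.
  have ne : \forall y \near x, y != 0 by apply: open_nbhs_nbhs; split; [exact: open_neq|exact: x0].
  by move: ne; apply: filterS => y y0; rewrite /sinc (negPf y0).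
rewrite /continuous_at {2}/sinc (negPf x0).
apply: cvg_trans (near_eq_cvg e) _; apply: cvgM; first exact: continuous_sin.
by apply: cvgV.
Qed.

End SincEstimates.

(** * Limits of the phase integrals *)

Section LimitPhases.
Variable R : realType.
Implicit Types (t a h : R) (A B C : seq nat).

Local Notation sumsq A := (\sum_(c <- A) c%:R ^+ 2 : R).

Lemma prod_sinc_bounds h (n : nat) A : (n%:R * h) ^+ 2 <= 1 -> all (fun c => c <= n)%N A ->
  let e := (size A)%:R * ((n%:R * h) ^+ 4 / 18) in
  expR (- h ^+ 2 * sumsq A / 6 - e) <= \prod_(c <- A) sinc (c%:R * h)
    <= expR (- h ^+ 2 * sumsq A / 6 + e).
Proof.
move=> nh; elim: A => [|c A IH] /=.
  by rewrite !big_nil mulr0 !mul0r addr0 subr0 expR0 lexx.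
move=> /andP[cn /IH /andP[lo hi]]; rewrite !big_cons.
have ch : (c%:R * h) ^+ 2 <= (n%:R * h) ^+ 2.
  by rewrite !exprMn ler_wpM2r ?sqr_ge0 // lerXn2r ?nnegrE ?ler_nat.
have /andP[lo1 hi1] := sinc_expR (le_trans ch nh).
have ch4 : (c%:R * h) ^+ 4 <= (n%:R * h) ^+ 4.
  by rewrite (exprM _ 2 2) (exprM (n%:R * h) 2 2) lerXn2r ?nnegrE ?sqr_ge0.
have sq : (c%:R * h) ^+ 2 = h ^+ 2 * c%:R ^+ 2 by rewrite exprMn mulrC.
have sz : (size A).+1%:R = (size A)%:R + 1 :> R by rewrite natr1.
rewrite sq in lo1 hi1.
move: lo hi lo1 hi1 ch4.
set y := (c%:R * h) ^+ 4; set z := (n%:R * h) ^+ 4; set u := h ^+ 2; set S := sumsq A.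
set PA := \prod_(_ <- A) _; set pc := sinc _ => lo hi lo1 hi1 yz.
have p0 : 0 <= PA by apply: le_trans lo; exact: expR_ge0.
have p1 : 0 <= pc by apply: le_trans lo1; exact: expR_ge0.
apply/andP; split.
  apply: le_trans (_ : expR (- (u * c%:R ^+ 2) / 6 - y / 18) * expR (- u * S / 6 - (size A)%:R * (z / 18)) <= _).
    by rewrite -expRD ler_expR sz; nra.
  by apply: ler_pM => //; exact: expR_ge0.
apply: le_trans (_ : expR (- (u * c%:R ^+ 2) / 6 + y / 18) * expR (- u * S / 6 + (size A)%:R * (z / 18)) <= _).
  exact: ler_pM.
by rewrite -expRD ler_expR sz; nra.
Qed.

Lemma sumsq_le A (n : nat) : all (fun c => c <= n)%N A -> sumsq A <= (size A)%:R * n%:R ^+ 2.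
Proof.
elim: A => [|c A IH] /=; first by rewrite big_nil mul0r.
move=> /andP[cn /IH hA]; rewrite big_cons -natr1 mulrDl mul1r addrC lerD //.
by rewrite lerXn2r ?nnegrE ?ler_nat.
Qed.

Lemma natr_sumsq A : (\sum_(c <- A) c ^ 2)%N%:R = sumsq A.
Proof. by rewrite natr_sum; apply: eq_bigr => c _; rewrite natrX. Qed.

Lemma aft_le_size l : (aft l <= block_size l)%N.
Proof. exact: leq_subr. Qed.

(** The constants come from the variance bound: [n ^ 2 * k <= 20 * 12 * V] and
    [h ^ 2 * V = t ^ 2 / 4] give [(n * h) ^ 2 <= 60 * t ^ 2 / k], at most 1 by hypothesis; the
    errors [k * (n * h) ^ 4 / 18] of the two products then add up to at most [400 * t ^ 4 / k]. *)
Lemma phase_maj_star_normal l t a : (7 <= block_size l)%N -> (0 < aft l)%N ->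
  60 * t ^+ 2 <= (aft l)%:R ->
  `|phase_integral (maj_star_law R l) t a - cos a * expR (- t ^+ 2 / 2)| <=
  expR (400 * t ^+ 4 / (aft l)%:R) - 1.
Proof.
move=> n7 k0 tk.
have [B [C [sB sC pe B0 [C0 _ /(_ n7) var]]]] := line_decomposition l.
set n := block_size l in n7 C0 var *; set k := aft l in k0 tk sB sC B0 var *.
have kn : (k <= n)%N by exact: aft_le_size.
have Bn : all (fun b => b <= n)%N B by apply: sub_all B0 => b /andP[_ /leq_trans]; apply.
have Cn : all (fun b => b <= n)%N C by apply: sub_all C0 => b /andP[].
have Bp : all (fun b => 0 < b)%N B by apply: sub_all B0 => b /andP[].
have Cp : all (fun b => 0 < b)%N C by apply: sub_all C0 => b /andP[].
have := phase_maj_star t a pe Bp Cp (etrans sB (esym sC)).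
set V := hook_var R B C; set h := t / Num.sqrt V / 2 => /=.
have {}var : 20 * sumsq B + n%:R ^+ 2 * k%:R <= 20 * sumsq C :> R.
  by rewrite -!natr_sumsq -natrX -!natrM -natrD ler_nat.
have Vd : 12 * V = sumsq C - sumsq B by rewrite /V /hook_var; field.
have k0R : 0 < k%:R :> R by rewrite ltr0n.
have n0R : 0 < n%:R :> R by rewrite ltr0n (leq_trans _ n7).
have n2 : 0 < n%:R ^+ 2 :> R by rewrite exprn_gt0.
have Vk : n%:R ^+ 2 * k%:R <= 240 * V by move: var Vd; lra.
have V0 : 0 < V by have := mulr_gt0 n2 k0R; move: Vk; lra.
have h2 : h ^+ 2 * V = t ^+ 2 / 4.
  rewrite /h !expr_div_n sqr_sqrtr ?ltW //; field; exact: lt0r_neq0.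
have nh : (n%:R * h) ^+ 2 * k%:R <= 60 * t ^+ 2.
  have := ler_wpM2l (sqr_ge0 h) Vk; rewrite [(n%:R * h) ^+ 2]exprMn.
  by move: h2; set u := h ^+ 2; set w := n%:R ^+ 2; lra.
have nh1 : (n%:R * h) ^+ 2 <= 1.
  by rewrite -(ler_pM2r k0R) mul1r; exact: le_trans nh tk.
have /andP[B1 B2] := prod_sinc_bounds nh1 Bn.
have /andP[C1 C2] := prod_sinc_bounds nh1 Cn.
rewrite sB in B1 B2; rewrite sC in C1 C2.
set e := k%:R * _ in B1 B2 C1 C2.
have e0 : 0 <= e by rewrite mulr_ge0 // divr_ge0 // (exprM _ 2 2) sqr_ge0.
have e2 : 2 * e <= 400 * t ^+ 4 / k%:R.
  rewrite ler_pdivlMr // /e (exprM _ 2 2) (exprM t 2 2).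
  set y := (n%:R * h) ^+ 2 in nh *; have y0 : 0 <= y by exact: sqr_ge0.
  have : (y * k%:R) ^+ 2 <= (60 * t ^+ 2) ^+ 2.
    have q0 : 0 <= y * k%:R by exact: mulr_ge0 y0 (ltW k0R).
    have q1 : 0 <= 60 * t ^+ 2 by apply: mulr_ge0 => //; exact: sqr_ge0.
    by rewrite lerXn2r ?nnegrE.
  rewrite !exprMn; lra.
set PB := \prod_(_ <- B) _ in B1 B2 *; set PC := \prod_(_ <- C) _ in C1 C2 *.
have PB0 : 0 < PB by apply: lt_le_trans B1; exact: expR_gt0.
move=> eq; have {eq}-> : phase_integral (maj_star_law R l) t a = cos a * (PC / PB).
  by apply: (mulfI (lt0r_neq0 PB0)); rewrite eq; field; exact: lt0r_neq0.
rewrite -mulrBr normrM; apply: le_trans (ler_piMl (normr_ge0 _) (cos_max _)) _.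
apply: le_trans (_ : expR (2 * e) - 1 <= _); last by rewrite lerB // ler_expR.
(* By the choice of [h] the quadratic exponents of the two products differ by exactly the Gaussian
   exponent. *)
have ex : - h ^+ 2 * sumsq C / 6 = - h ^+ 2 * sumsq B / 6 - t ^+ 2 / 2.
  have -> : sumsq C = 12 * V + sumsq B by rewrite Vd subrK.
  by rewrite -mulrA mulrDl mulrDr; move: h2; set u := h ^+ 2; lra.
rewrite ex in C1 C2; move: B1 B2 C1 C2; set x := - h ^+ 2 * _ / 6; set u := t ^+ 2 / 2 => B1 B2 C1 C2.
rewrite (_ : - t ^+ 2 / 2 = - u); last by rewrite /u mulNr.
have u0 : 0 <= u by rewrite divr_ge0 ?sqr_ge0.
have lo : expR (- u - 2 * e) <= PC / PB.
  rewrite ler_pdivlMr //; apply: le_trans C1.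
  apply: le_trans (ler_wpM2l (expR_ge0 _) B2) _.
  by rewrite -expRD ler_expR; lra.
have hi : PC / PB <= expR (- u + 2 * e).
  rewrite ler_pdivrMr //; apply: le_trans C2 _.
  apply: le_trans (ler_wpM2l (expR_ge0 _) B1).
  by rewrite -expRD ler_expR; lra.
have eu : expR (- u) <= 1 by rewrite -expR0 ler_expR oppr_le0.
have eu0 := expR_ge0 (- u).
have ee : 1 + 2 * e <= expR (2 * e) by exact: expR_ge1Dx.
have ee2 : 1 - 2 * e <= expR (- (2 * e)) by exact: expR_ge1Dx.
rewrite !expRD in lo hi.
rewrite ler_norml; apply/andP; split.
  have : 0 <= (1 - expR (- u)) * (1 - expR (- (2 * e))).
    by rewrite mulr_ge0 // subr_ge0 // -expR0 ler_expR oppr_le0 mulr_ge0.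
  lra.
have : 0 <= (1 - expR (- u)) * (expR (2 * e) - 1).
  by rewrite mulr_ge0 // subr_ge0 // -expR0 ler_expR mulr_ge0.
lra.
Qed.

Lemma cvg_natr_inv (u : nat -> nat) : u N @[N --> \oo] --> \oo -> ((u N)%:R^-1 : R) @[N --> \oo] --> (0 : R).
Proof.
move=> uoo; apply/cvgrPdist_le => e e0.
move/cvgnyPge : uoo => /(_ (Num.truncn e^-1).+1); apply: filterS => N hN.
rewrite sub0r normrN ger0_norm // invf_ple ?posrE //; last first.
  by rewrite ltr0n; apply: leq_trans hN.
by apply: ltW; apply: lt_le_trans (truncnS_gt _) _; rewrite ler_nat.
Qed.

Lemma cvg_phase_normal (lam : nat -> block_skew) t a : aft (lam N) @[N --> \oo] --> \oo ->
  phase_integral (maj_star_law R (lam N)) t a @[N --> \oo] --> phase_integral (std_normal_law R) t a.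
Proof.
move=> aoo; rewrite phase_std_normal.
have lim0 : expR (400 * t ^+ 4 / (aft (lam N))%:R) - 1 @[N --> \oo] --> (0 : R).
  have -> : (0 : R) = expR 0 - 1 by rewrite expR0 subrr.
  apply: cvgB; last exact: cvg_cst.
  apply: continuous_cvg; first exact: continuous_expR.
  by rewrite -[X in _ --> X](mulr0 (400 * t ^+ 4)); apply: cvgMr; exact: cvg_natr_inv.
apply/cvgrPdist_le => e e0.
move/cvgrPdist_le : lim0 => /(_ _ e0) lim0.
move/cvgnyPge : aoo => /(_ (7 + (Num.truncn (60 * t ^+ 2)).+1)%N) ha.
move: lim0 ha; apply: filterS2 => N; rewrite sub0r normrN => hl ha.
rewrite distrC; apply: le_trans (phase_maj_star_normal a _ _ _) _ => //.
- by apply: leq_trans (aft_le_size _); apply: leq_trans ha; exact: leq_addr.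
- by apply: leq_trans ha; rewrite addnS.
- apply: ltW; apply: lt_le_trans (truncnS_gt _) _; rewrite ler_nat.
  by apply: leq_trans ha; exact: leq_addl.
- by apply: le_trans hl; exact: ler_norm.
Qed.

(** Factors are replaced one at a time; all have absolute value at most 1, so the errors add up. *)
Lemma prod_sinc_near h s e A : `|s| <= 1 -> (forall c, c \in A -> `|sinc (c%:R * h) - s| <= e) ->
  `|\prod_(c <- A) sinc (c%:R * h) - s ^+ size A| <= (size A)%:R * e.
Proof.
move=> s1; elim: A => [|c A IH] hA /=; first by rewrite big_nil expr0 subrr normr0 mul0r.
rewrite big_cons exprS -natr1 mulrDl mul1r.
set P := \prod_(_ <- A) _ in IH *.
have -> : sinc (c%:R * h) * P - s * s ^+ size A =
   sinc (c%:R * h) * (P - s ^+ size A) + (sinc (c%:R * h) - s) * s ^+ size A by ring.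
apply: le_trans (ler_normD _ _) _; rewrite !normrM; apply: lerD.
  apply: le_trans (ler_piMl (normr_ge0 _) (sinc_norm_le1 _)) _; apply: IH => d dA.
  by apply: hA; rewrite inE dA orbT.
apply: le_trans (ler_piMr (normr_ge0 _) _) _; first by rewrite normrX exprn_ile1.
by apply: hA; rewrite mem_head.
Qed.

Lemma sumsq_ge A x : 0 <= x -> (forall c, c \in A -> x <= c%:R) -> (size A)%:R * x ^+ 2 <= sumsq A.
Proof.
move=> x0; elim: A => [|c A IH] hA /=; first by rewrite big_nil mul0r.
rewrite big_cons -natr1 mulrDl mul1r addrC lerD //.
  by rewrite lerXn2r ?nnegrE // hA ?mem_head.
by apply: IH => d dA; apply: hA; rewrite inE dA orbT.
Qed.

Lemma phase_maj_star_aft0 l t a : aft l = 0%N -> phase_integral (maj_star_law R l) t a = cos a.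
Proof.
move=> a0; have [B [C []]] := line_decomposition l.
rewrite a0 => /size0nil -> /size0nil -> pe _ _.
by have := phase_maj_star (R := R) t a pe isT isT erefl; rewrite /= !big_nil mul1r mulr1.
Qed.

(** The elements of [C] stay within a bounded distance of [n] and those of [B] are bounded. Hence
    [V / n ^ 2] tends to [M / 12], [n * h] to [t / (2 * irwin_hall_sd M)] and [h] to 0, for
    [M > 0]. *)
Lemma cvg_phase_irwin_hall (lam : nat -> block_skew) M t a :
  block_size (lam N) @[N --> \oo] --> \oo -> (\forall N \near \oo, aft (lam N) = M) ->
  phase_integral (maj_star_law R (lam N)) t a @[N --> \oo] --> phase_integral (irwin_hall_star R M) t a.
Proof.
move=> soo aM; rewrite phase_irwin_hall_star.
have /choice[BC hBC] : forall N, exists BC : seq nat * seq nat, let: (B, C) := BC in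
    [/\ size B = aft (lam N), size C = aft (lam N),
      perm_eq (block_hooks (lam N) ++ C) (iota 1 (block_size (lam N)) ++ B),
      all (fun b : nat => 0 < b <= aft (lam N))%N B & all (fun j : nat => 0 < j <= block_size (lam N))%N C /\
      all (fun j : nat => 2 * (block_size (lam N) - j) <= aft (lam N) * (aft (lam N)).+1)%N C].
  move=> N; have [B [C [? ? ? ? [? ? _]]]] := line_decomposition (lam N).
  by exists (B, C); split.
pose n N := block_size (lam N).
pose V N := hook_var R (BC N).1 (BC N).2; pose h N := t / Num.sqrt (V N) / 2.
have hphase N : \prod_(b <- (BC N).1) sinc (b%:R * h N) * phase_integral (maj_star_law R (lam N)) t a =
    cos a * \prod_(c <- (BC N).2) sinc (c%:R * h N).
  have := hBC N; rewrite /h /V; case: (BC N) => B C [sB sC pe B0 [C0 _]].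
  apply: phase_maj_star => //; last by rewrite sB sC.
    by apply: sub_all B0 => b /andP[].
  by apply: sub_all C0 => b /andP[].
have r0 : ((n N)%:R^-1 : R) @[N --> \oo] --> (0 : R) by exact: cvg_natr_inv.
(* For [M = 0] the laws are degenerate and the deviation is 0; both sides are [cos a]. *)
case: M aM => [|M] aM.
  apply: cvg_near_cst; move: aM; apply: filterS => N a0.
  by rewrite phase_maj_star_aft0 // expr0 mulr1.
set k := M.+1 in aM *.
pose w : R := k%:R * k.+1%:R.
have n_gt0 : \forall N \near \oo, w + 1 <= (n N)%:R.
  move/cvgnyPge : soo => /(_ (Num.truncn (w + 1)).+1); apply: filterS => N hN.
  by apply: ltW; apply: lt_le_trans (truncnS_gt _) _; rewrite ler_nat.
have w0 : 0 <= w by rewrite mulr_ge0.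
have Cw N : aft (lam N) = k -> forall c, c \in (BC N).2 -> (n N)%:R - w <= (c%:R : R) <= ((n N)%:R : R).
  have := hBC N; case: (BC N) => B C /= [_ _ _ _ [C0 C1]] ak c cC.
  have /andP[_ cn] := allP C0 _ cC; rewrite ler_nat cn andbT.
  have := allP C1 _ cC; rewrite ak -/(n N) => cw.
  rewrite lerBlDr /w -natrM -natrD ler_nat; move: cw; rewrite -/(n N) in cn *; lia.
have cvg_sq (u : nat -> R) (x : R) : u N @[N --> \oo] --> x -> u N ^+ 2 @[N --> \oo] --> x ^+ 2.
  by move=> ux; rewrite expr2; under eq_fun do rewrite expr2; exact: cvgM.
have cV : V N * (n N)%:R^-1 ^+ 2 @[N --> \oo] --> (k%:R / 12 : R).
  apply: (@squeeze_cvgr _ _ _ _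
    (fun N => (k%:R * (1 - w * (n N)%:R^-1) ^+ 2 - k%:R * (k%:R * (n N)%:R^-1) ^+ 2) / 12) (fun=> k%:R / 12)).
  - move: aM n_gt0; apply: filterS2 => N ak nw.
    have n0 : 0 < (n N)%:R :> R by move: nw; lra.
    have hC := Cw N ak; have := hBC N; rewrite /V /hook_var; move: hC; case: (BC N) => B C /= hC.
    rewrite ak => -[sB sC _ B0 _].
    have h1 : k%:R * ((n N)%:R - w) ^+ 2 <= sumsq C.
      by rewrite -sC; apply: sumsq_ge => [|c /hC /andP[]//]; move: nw; lra.
    have h2 : sumsq C <= k%:R * (n N)%:R ^+ 2.
      by rewrite -sC; apply: sumsq_le; apply/allP => c /hC /andP[_]; rewrite ler_nat.
    have h3 : sumsq B <= k%:R * k%:R ^+ 2.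
      by rewrite -sB; apply: sumsq_le; rewrite sB; apply: sub_all B0 => b /andP[].
    have h4 : 0 <= sumsq B by apply: sumr_ge0 => i _; exact: sqr_ge0.
    have nn0 : (n N)%:R != 0 :> R by rewrite gt_eqF.
    have p12 : 0 < (12 : R)^-1 by rewrite invr_gt0.
    rewrite [X in _ <= X <= _]mulrAC !(ler_pM2r p12).
    have p2 : 0 < (n N)%:R^-1 ^+ 2 :> R by rewrite exprn_gt0 ?invr_gt0.
    apply/andP; split.
      rewrite (_ : _ - _ = (k%:R * ((n N)%:R - w) ^+ 2 - k%:R * k%:R ^+ 2) * (n N)%:R^-1 ^+ 2); last by field.
      by rewrite ler_pM2r //; apply: lerB.
    rewrite -(ler_pM2r (exprn_gt0 2 n0)) -mulrA -exprMn mulVf // expr1n mulr1; lra.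
  - rewrite -[X in _ --> X](_ : (k%:R * (1 - w * 0) ^+ 2 - k%:R * (k%:R * 0) ^+ 2) / 12 = k%:R / 12); last first.
      by rewrite !mulr0 expr0n /= mulr0 !subr0 expr1n mulr1.
    apply: cvgMl; apply: cvgB; apply: cvgMr.
      by apply: cvg_sq; apply: cvgB; [exact: cvg_cst|exact: cvgMr].
    by apply: cvg_sq; exact: cvgMr.
  - exact: cvg_cst.
set x0 := t / irwin_hall_sd R k / 2.
have cnh : (n N)%:R * h N @[N --> \oo] --> x0.
  apply: (@cvg_trans _ (t / Num.sqrt (V N * (n N)%:R^-1 ^+ 2) / 2 @[N --> \oo])).
    apply: near_eq_cvg; move: n_gt0; apply: filterS => N nw.
    have n0 : 0 < (n N)%:R :> R by move: nw; lra.
    have Vh : Num.sqrt (V N * (n N)%:R^-1 ^+ 2) = Num.sqrt (V N) / (n N)%:R.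
      by rewrite mulrC sqrtrM ?exprn_ge0 ?invr_ge0 // sqrtr_sqr ger0_norm ?invr_ge0 // mulrC.
    by rewrite Vh invfM invrK /h; ring.
  apply: cvgMl; apply: cvgMr; apply: cvgV; first by rewrite gt_eqF // irwin_hall_sd_gt0.
  by apply: continuous_cvg cV; exact: sqrt_continuous.
have ch : h N @[N --> \oo] --> (0 : R).
  apply: (@cvg_trans _ ((n N)%:R * h N * (n N)%:R^-1 @[N --> \oo])).
    apply: near_eq_cvg; move: n_gt0; apply: filterS => N nw.
    have n0 : 0 < (n N)%:R :> R by move: nw; lra.
    by rewrite mulrAC mulfV ?mul1r ?gt_eqF.
  by have := cvgM cnh r0; rewrite mulr0; exact.
have cC : \prod_(c <- (BC N).2) sinc (c%:R * h N) @[N --> \oo] --> sinc x0 ^+ k.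
  apply/cvgrPdist_le => e e0.
  have ek : 0 < e / k%:R by rewrite divr_gt0.
  have /cvgrPdist_le /(_ _ ek) /nbhs_ballP[d /= d0 hd] := @continuous_sinc R x0.
  have d2 : 0 < d / 2 by rewrite divr_gt0.
  have dw : 0 < d / 2 / (w + 1) by rewrite divr_gt0 // ltr_wpDl.
  move/cvgrPdist_lt : cnh => /(_ _ d2) c1; move/cvgrPdist_lt : ch => /(_ _ dw) c2.
  near=> N.
  have ak : aft (lam N) = k by near: N; exact: aM.
  have sC : size (BC N).2 = k by have := hBC N; case: (BC N) => B C [_ -> _ _ _].
  rewrite distrC -sC; apply: le_trans (prod_sinc_near (e := e / k%:R) _ _) _.
  - exact: sinc_norm_le1.
  - move=> c /(Cw _ ak) /andP[c_lo c_hi]; rewrite distrC; apply: hd; rewrite /ball /=.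
    have -> : x0 - c%:R * h N = (x0 - (n N)%:R * h N) + ((n N)%:R - c%:R) * h N by ring.
    apply: le_lt_trans (ler_normD _ _) _; rewrite [ltRHS](splitr d); apply: ltrD.
      by near: N.
    rewrite normrM ger0_norm ?subr_ge0 //.
    apply: le_lt_trans (_ : (w + 1) * `|h N| < _); first by rewrite ler_wpM2r //; move: c_lo; lra.
    rewrite mulrC -ltr_pdivlMr ?ltr_wpDl // -(normrN (h N)) -sub0r; near: N; exact: c2.
  - by rewrite sC mulrC divfK ?lexx // pnatr_eq0.
have cB : \prod_(c <- (BC N).1) sinc (c%:R * h N) @[N --> \oo] --> (1 : R).
  apply/cvgrPdist_le => e e0.
  have ek : 0 < e / k%:R by rewrite divr_gt0.
  have /cvgrPdist_le /(_ _ ek) /nbhs_ballP[d /= d0 hd] := @continuous_sinc R 0.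
  have dw : 0 < d / k%:R by rewrite divr_gt0.
  move/cvgrPdist_lt : ch => /(_ _ dw) c2.
  near=> N.
  have ak : aft (lam N) = k by near: N; exact: aM.
  have [sB B0] : size (BC N).1 = k /\ all (fun b => b <= k)%N (BC N).1.
    have := hBC N; case: (BC N) => B C [-> _ _ B0 _]; split=> //.
    by rewrite -ak; apply: sub_all B0 => b /andP[].
  have := @prod_sinc_near (h N) 1 (e / k%:R) (BC N).1.
  rewrite expr1n sB distrC => H; apply: le_trans (H _ _) _.
  - by rewrite normr1.
  - move=> b bB; rewrite sinc0 in hd; rewrite distrC; apply: hd; rewrite /ball /= sub0r normrN normrM ger0_norm //.
    apply: le_lt_trans (_ : k%:R * `|h N| < _).
      by rewrite ler_wpM2r // ler_nat; exact: (allP B0).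
    rewrite mulrC -ltr_pdivlMr // -(normrN (h N)) -sub0r; near: N; exact: c2.
  - by rewrite mulrC divfK ?lexx // pnatr_eq0.
rewrite -[X in _ --> X](_ : cos a * sinc x0 ^+ k + 0 = _); last by rewrite addr0.
(* Instead of dividing by the product over [B], which tends to 1, its distance to 1 is multiplied by
   the bounded phase integral. *)
rewrite (_ : (fun N => _) = fun N => cos a * \prod_(c <- (BC N).2) sinc (c%:R * h N) +
  (1 - \prod_(c <- (BC N).1) sinc (c%:R * h N)) * phase_integral (maj_star_law R (lam N)) t a); last first.
  by apply/funext => N; rewrite -hphase; ring.
apply: cvgD; first exact: cvgMr.
have cB' : 1 - \prod_(c <- (BC N).1) sinc (c%:R * h N) @[N --> \oo] --> (0 : R).
  by rewrite -[X in _ --> X](subrr 1); apply: cvgB cB; exact: cvg_cst.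
apply/norm_cvg0P; apply: (@squeeze_cvgr _ _ _ _ (fun=> 0) (fun N => `|1 - \prod_(c <- (BC N).1) sinc (c%:R * h N)|)).
- apply: nearW => N; rewrite normr_ge0 normrM ler_piMr //; exact: phase_integral_le1.
- exact: cvg_cst.
- exact/norm_cvg0P.
Unshelve. all: by end_near.
Qed.

End LimitPhases.

(** * Limits of subsequences *)

Section Subsequences.

Definition cofinal (P : nat -> Prop) := forall m, exists2 N, (m <= N)%N & P N.

Lemma not_cofinal P : ~ cofinal P -> \forall N \near \oo, ~ P N.
Proof.
move=> /existsNP[m hm]; exists m => // N /= mN PN; apply: hm; by exists N.
Qed.

(** The indices tend to infinity but need not increase, which suffices to pass to limits. *)
Lemma cofinal_subseq P : cofinal P ->
  exists2 phi : nat -> nat, phi @ \oo --> \oo & forall i, P (phi i).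
Proof.
move=> cP; have /choice[phi hphi] : forall m, exists N, (m <= N)%N /\ P N.
  by move=> m; have [N mN PN] := cP m; exists N.
exists phi; last by move=> i; case: (hphi i).
by apply/cvgnyPge => A; exists A => // i /= Ai; apply: leq_trans Ai _; case: (hphi i).
Qed.

Lemma subseq_cofinal P (phi : nat -> nat) : phi @ \oo --> \oo -> cofinal (fun i => P (phi i)) -> cofinal P.
Proof.
move=> /cvgnyPge hphi cP m; have [m' _ hm'] := hphi m.
by have [i mi Pi] := cP m'; exists (phi i) => //; exact: hm'.
Qed.

Lemma pigeonhole (T : finType) (f : nat -> T) : exists i, cofinal (fun N => f N = f i).
Proof.
apply: contrapT => H.
have /choice[g hg] : forall v : T, exists m, forall N, (m <= N)%N -> f N <> v.
  move=> v; apply: contrapT => h; apply: H.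
  have cv : cofinal (fun N => f N = v).
    move=> m; apply: contrapT => h'; apply: h; exists m => N mN e; apply: h'; by exists N.
  by have [i _ e] := cv 0%N; exists i; rewrite e.
pose m := \max_(v : T) g v.
by apply: (hg (f m) m) => //; exact: (leq_bigmax (f m)).
Qed.

Lemma not_cvgny (u : nat -> nat) : ~ (u N @[N --> \oo] --> \oo) -> exists b, cofinal (fun N => (u N < b)%N).
Proof.
move=> h; apply: contrapT => h'; apply: h; apply/cvgnyPge => b.
have /not_cofinal : ~ cofinal (fun N => (u N < b)%N) by move=> c; apply: h'; exists b.
by apply: filterS => N /negP; rewrite -leqNgt.
Qed.

End Subsequences.

Section MajPolyFinite.
Variable R : realType.

Lemma coef_maj_poly D i : (maj_poly R D)`_i = #|[pred T : SYT D | maj T == i]|%:R.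
Proof.
rewrite /maj_poly coef_sum -sum1_card natr_sum [RHS]big_mkcond; apply: eq_bigr => T _.
by rewrite coefXn inE eq_sym; case: (_ == _).
Qed.

Lemma maj_le l (T : SYT (skew_cells l)) : (maj T <= block_size l ^ 2)%N.
Proof.
rewrite /maj card_cells; apply: leq_trans (_ : \sum_(1 <= i < block_size l) block_size l <= _)%N.
  rewrite big_mkcond big_nat_cond [X in (_ <= X)%N]big_nat_cond.
  by apply: leq_sum => i /andP[/andP[_ iN] _]; case: ifP => // _; exact: ltnW.
by rewrite sum_nat_const_nat -mulnn leq_mul2r leq_subr orbT.
Qed.

Lemma card_SYT_le l : (#|{: SYT (skew_cells l)}| <= block_size l ^ block_size l)%N.
Proof.
apply: leq_trans (_ : #|{: filling (skew_cells l)}| <= _)%N.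
  exact: (leq_card (val : SYT (skew_cells l) -> _) val_inj).
by rewrite card_ffun card_ord card_cells.
Qed.

(** On a subsequence of bounded size the coefficients are bounded natural numbers and the degree is
    bounded, so some polynomial recurs. *)
Lemma maj_poly_repeats (lam : nat -> block_skew) : ~ (block_size (lam N) @[N --> \oo] --> \oo) ->
  exists i, cofinal (fun N => maj_poly R (skew_cells (lam N)) = maj_poly R (skew_cells (lam i))).
Proof.
move=> /not_cvgny[b /cofinal_subseq[phi phioo hb]].
pose K := (b.+1 ^ b)%N.
pose f i : {ffun 'I_(b ^ 2).+1 -> 'I_K.+1} :=
  [ffun j : 'I_(b ^ 2).+1 => inord #|[pred T : SYT (skew_cells (lam (phi i))) | maj T == j]|].
have [i0 hi] := pigeonhole f; exists (phi i0); apply: (subseq_cofinal phioo) => m.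
have [i mi e] := hi m; exists i => //; apply/polyP => j; rewrite !coef_maj_poly; congr _%:R.
have small i' : (#|[pred T : SYT (skew_cells (lam (phi i'))) | maj T == j]| < K.+1)%N.
  rewrite ltnS; apply: leq_trans (max_card _) _; apply: leq_trans (card_SYT_le _) _.
  apply: leq_trans (_ : b.+1 ^ block_size (lam (phi i')) <= _)%N.
    have [->//|s0] := posnP (block_size (lam (phi i'))).
    by rewrite leq_exp2r //; apply/leqW/ltnW/hb.
  by rewrite leq_pexp2l // ltnW.
case: (ltnP j (b ^ 2).+1) => jb; last first.
  have z i' : #|[pred T : SYT (skew_cells (lam (phi i'))) | maj T == j]| = 0%N.
    apply: eq_card0 => T; rewrite !inE; apply/negbTE.
    rewrite neq_ltn (leq_ltn_trans (maj_le T)) //; apply: leq_trans jb.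
    by rewrite ltnS leq_sqr ltnW.
  by rewrite !z.
have := congr1 (fun g : {ffun _ -> 'I__} => g (Ordinal jb) : nat) e.
by rewrite !ffunE /= !inordK.
Qed.

End MajPolyFinite.

Section LimitsInLaw.
Variable R : realType.
Implicit Types mu nu : probability R R.

Lemma same_law_sym mu nu : same_law mu nu -> same_law nu mu.
Proof. by move=> h A mA; rewrite h. Qed.

Lemma same_law_trans nu mu rho : same_law mu nu -> same_law nu rho -> same_law mu rho.
Proof. by move=> h h' A mA; rewrite h // h'. Qed.

Lemma cvg_in_law_near (mu_ : nat -> probability R R) mu :
  (\forall N \near \oo, same_law (mu_ N) mu) -> cvg_in_law mu_ mu.
Proof.
move=> h x _; apply: cvg_near_cst; move: h; apply: filterS => N hN.
by rewrite !law_cdfE !EFin_real_cdf; apply: hN; exact: measurable_itv.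
Qed.

(** Levy's theorem for a constant sequence, together with uniqueness of limits. *)
Lemma phase_integral_inj mu nu : (forall t a, phase_integral mu t a = phase_integral nu t a) -> same_law mu nu.
Proof.
move=> h; apply: (@cvg_in_law_unique _ (fun=> mu)).
  by apply: cvg_in_law_near; apply: nearW => N A.
by apply: levy_continuity => t a; rewrite h; exact: cvg_cst.
Qed.

Lemma cvg_in_law_subseq (mu_ : nat -> probability R R) nu (phi : nat -> nat) :
  phi @ \oo --> \oo -> cvg_in_law mu_ nu -> cvg_in_law (mu_ \o phi) nu.
Proof. by move=> hphi c x cx; exact: (cvg_comp _ _ hphi (c x cx)). Qed.

Lemma cvg_in_law_cofinal (mu_ : nat -> probability R R) nu mu :
  cvg_in_law mu_ nu -> cofinal (fun N => same_law (mu_ N) mu) -> same_law nu mu.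
Proof.
move=> c /cofinal_subseq[phi phioo h].
apply: (cvg_in_law_unique (cvg_in_law_subseq phioo c)).
by apply: cvg_in_law_near; apply: nearW => i; exact: h.
Qed.

Local Notation laws lam := (fun N => maj_star_law R (lam N)).
Local Notation large lam := (block_size (lam N) @[N --> \oo] --> \oo).

Lemma cvg_maj_star_normal (lam : nat -> block_skew) : aft (lam N) @[N --> \oo] --> \oo ->
  cvg_in_law (laws lam) (std_normal_law R).
Proof. by move=> h; apply: levy_continuity => t a; exact: cvg_phase_normal. Qed.

Lemma cvg_maj_star_irwin_hall (lam : nat -> block_skew) M :
  large lam -> (\forall N \near \oo, aft (lam N) = M) ->
  cvg_in_law (laws lam) (irwin_hall_star R M).
Proof. by move=> h h'; apply: levy_continuity => t a; exact: cvg_phase_irwin_hall. Qed.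

Lemma cofinal_aft_limit (lam : nat -> block_skew) nu M : large lam ->
  cvg_in_law (laws lam) nu -> cofinal (fun N => aft (lam N) = M) ->
  same_law nu (irwin_hall_star R M).
Proof.
move=> soo c /cofinal_subseq[phi phioo h].
apply: (cvg_in_law_unique (cvg_in_law_subseq phioo c)).
apply: (@cvg_maj_star_irwin_hall (lam \o phi)).
  exact: (cvg_comp _ _ phioo soo).
by apply: nearW => i; exact: h.
Qed.

Lemma cofinal_aft_bounded (lam : nat -> block_skew) b : cofinal (fun N => (aft (lam N) < b)%N) ->
  exists M, cofinal (fun N => aft (lam N) = M).
Proof.
move=> /cofinal_subseq[phi phioo h].
have [i hi] := pigeonhole (fun i => Ordinal (h i)).
exists (aft (lam (phi i))); apply: (subseq_cofinal phioo) => m.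
by have [N mN [e]] := hi m; exists N.
Qed.

Lemma large_shapes_limit (lam : nat -> block_skew) nu : large lam ->
  cvg_in_law (laws lam) nu ->
  same_law nu (std_normal_law R) \/
  exists2 M, cofinal (fun N => aft (lam N) = M) & same_law nu (irwin_hall_star R M).
Proof.
move=> soo c; have [aoo|/not_cvgny[b /cofinal_aft_bounded[M hM]]] := pselect (aft (lam N) @[N --> \oo] --> \oo).
  by left; apply: (cvg_in_law_unique c); exact: cvg_maj_star_normal.
by right; exists M => //; exact: cofinal_aft_limit hM.
Qed.

Lemma maj_star_law_aft0 l : aft l = 0%N -> same_law (maj_star_law R l) (irwin_hall_star R 0).
Proof.
by move=> a0; apply: phase_integral_inj => t a; rewrite phase_maj_star_aft0 // phase_irwin_hall_star expr0 mulr1.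
Qed.

(** Some value [M] of the aft recurs, so the limit is the Irwin-Hall law of index [M]. If the aft
    differed from [M] infinitely often, another subsequence would make the limit normal or of
    another index. *)
Lemma limit_large_shapes (lam : nat -> block_skew) nu : large lam ->
  cvg_in_law (laws lam) nu -> ~ (aft (lam N) @[N --> \oo] --> \oo) ->
  exists M, \forall N \near \oo, aft (lam N) = M.
Proof.
move=> soo c /not_cvgny[b /cofinal_aft_bounded[M hM]]; exists M.
have nuM := cofinal_aft_limit soo c hM.
suff : ~ cofinal (fun N => aft (lam N) <> M) by move/not_cofinal; apply: filterS => N /contrapT.
move=> /cofinal_subseq[phi phioo h].
have soo' := cvg_comp _ _ phioo soo.
have [n01|[M' hM' nuM']] := large_shapes_limit soo' (cvg_in_law_subseq phioo c).
  exact: irwin_hall_star_neq_normal (same_law_trans (same_law_sym nuM) n01).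
have [i _ /= e] := hM' 0%N.
have : M' <> M by rewrite -e; exact: h.
case: (ltngtP M M') => [MM _|MM _|-> //].
  exact: irwin_hall_star_lt MM (same_law_trans (same_law_sym nuM) nuM').
exact: irwin_hall_star_lt MM (same_law_trans (same_law_sym nuM') nuM).
Qed.

(** The sizes may still be unbounded. A recurring polynomial shows that the limit is the law of some
    shape, hence has an atom. If infinitely many laws differed from it, then on these indices either
    the sizes do not tend to infinity, and one of the laws is the limit after all, or they do, and
    the limit is atomless or has index 0; in the last case some shape has aft 0, and its law is the
    limit exactly. *)
Lemma limit_small_shapes (lam : nat -> block_skew) nu : ~ large lam ->
  cvg_in_law (laws lam) nu ->
  exists N0, forall N, (N0 <= N)%N -> same_law (maj_star_law R (lam N)) (maj_star_law R (lam N0)).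
Proof.
have rep (lam' : nat -> block_skew) : ~ large lam' ->
    cvg_in_law (laws lam') nu -> exists i, same_law nu (maj_star_law R (lam' i)).
  move=> /(maj_poly_repeats R)[i hi] c; exists i; apply: (cvg_in_law_cofinal c) => m.
  by have [N mN e] := hi m; exists N => //; exact: same_maj_poly_law.
move=> nsoo c; have [i nui] := rep _ nsoo c.
have [x0 hx0] := maj_star_law_atom R (lam i).
have nux0 : nu [set x0] != 0%E by rewrite nui.
suff : ~ cofinal (fun N => ~ same_law (maj_star_law R (lam N)) nu).
  move/not_cofinal => [N0 _ hN0]; exists N0 => N /hN0 /contrapT h.
  by apply: same_law_trans h (same_law_sym _); apply: contrapT; exact: (hN0 N0 (leqnn N0)).
move=> /cofinal_subseq[phi phioo h]; have c' := cvg_in_law_subseq phioo c.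
have [soo|nsoo'] := pselect (large (lam \o phi)); last first.
  have [j nuj] := rep (lam \o phi) nsoo' c'.
  by apply: (h j); exact: same_law_sym.
have [n01|[[|M] hM nuM]] := large_shapes_limit soo c'.
- by move: nux0; rewrite n01 // std_normal_atomless eqxx.
- have [j _ /= e] := hM 0%N; apply: (h j).
  exact: same_law_trans (maj_star_law_aft0 e) (same_law_sym nuM).
- by move: nux0; rewrite nuM // irwin_hall_star_atomless eqxx.
Qed.

End LimitsInLaw.

Theorem theorem6p3 (R : realType) (lam : nat -> block_skew) :
  let law_ N := maj_star_law R (lam N) in
  let case_i := aft (lam N) @[N --> \oo] --> \oo in
  let case_ii (M : nat) :=
    block_size (lam N) @[N --> \oo] --> \oo /\ aft (lam N) @[N --> \oo] --> M in
  let case_iii :=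
    exists N0, forall N, (N0 <= N)%N -> same_law (law_ N) (law_ N0) in
  [/\ (exists nu, cvg_in_law law_ nu) <->
        [\/ case_i, exists M, case_ii M | case_iii],
      case_i -> cvg_in_law law_ (std_normal_law R),
      forall M, case_ii M -> cvg_in_law law_ (irwin_hall_star R M) &
      case_iii -> forall nu, cvg_in_law law_ nu -> discrete_law nu].
Proof.
move=> law_ case_i case_ii case_iii.
have claim_i : case_i -> cvg_in_law law_ (std_normal_law R) by exact: cvg_maj_star_normal.
have claim_ii M : case_ii M -> cvg_in_law law_ (irwin_hall_star R M).
  (* Convergence of natural numbers means that they are eventually equal to the limit. *)
  by move=> [soo /discrete_cvg aM]; exact: cvg_maj_star_irwin_hall.
have claim_iii N0 : (forall N, (N0 <= N)%N -> same_law (law_ N) (law_ N0)) -> cvg_in_law law_ (law_ N0).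
  by move=> h; apply: cvg_in_law_near; exists N0 => // N; exact: h.
split=> //.
  split; last first.
    case=> [/claim_i c|[M /claim_ii c]|[N0 /claim_iii c]]; by eexists; exact: c.
  move=> [nu c].
  have [soo|nsoo] := pselect (block_size (lam N) @[N --> \oo] --> \oo); last first.
    by apply: Or33; exact: limit_small_shapes nsoo c.
  have [aoo|naoo] := pselect case_i; first exact: Or31.
  have [M hM] := limit_large_shapes soo c naoo.
  by apply: Or32; exists M; split=> //; apply/discrete_cvg.
move=> [N0 /claim_iii c0] nu c.
have e := cvg_in_law_unique c c0.
have [A cA pA] := maj_star_law_discrete R (lam N0).
exists A => //; rewrite e //; exact: countable_measurable.
Qed.
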